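(* In the setting described in the context, assume conditions C1–C4. Let $\epsilon=\epsilon(n)>0$ satisfy $\epsilon\to0$ and $\epsilon^2n\to\infty$ as $n\to\infty$, and define $\hat d=\#\{j:\hat\theta_j\ge\epsilon\}$, where $\hat\theta_1\ge\hat\theta_2\ge\cdots$ are the eigenvalues of $\hat K$. Then $P(\hat d\neq d)\to0$ as $n\to\infty$.
   Context: $\mathcal{I}$ is a compact interval, $L_2(\mathcal{I})$ has inner product $\langle f,g\rangle=\int_{\mathcal{I}}fg$; kernels act as integral operators. Model: $Y_t(u)=X_t(u)+\varepsilon_t(u)$ with $E\varepsilon_t(u)=0$, $\operatorname{cov}(\varepsilon_t(u),\varepsilon_s(v))=0$ for all $u,v$ when $t\neq s$; $\int_{\mathcal{I}}E\{X_t^2+\varepsilon_t^2\}<\infty$; $\mu(u)=EX_t(u)$ and $M_k(u,v)=\operatorname{cov}(X_t(u),X_{t+k}(v))$ independent of $t$. With $M_0(u,v)=\sum_j\lambda_j\varphi_j(u)\varphi_j(v)$ ($\lambda_j$ decreasing, $\varphi_j$ orthonormal), $X_t$ is $d$-dimensional: $\lambda_d\ne0=\lambda_{d+1}$, $d\ge1$ fixed. For a fixed integer $p\ge1$: $N_k(u,v)=\int M_k(u,z)M_k(v,z)dz$, $K=\sum_{k=1}^pN_k$ with eigenvalues $\theta_1\ge\theta_2\ge\cdots$. From $Y_1,\ldots,Y_n$: $\bar Y=n^{-1}\sum Y_j$, $\hat M_k(u,v)=\frac1{n-p}\sum_{j=1}^{n-p}\{Y_j(u)-\bar Y(u)\}\{Y_{j+k}(v)-\bar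 Y(v)\}$, $\hat K(u,v)=\sum_{k=1}^p\int\hat M_k(u,z)\hat M_k(v,z)dz$. Conditions: C1: $\{Y_t\}$ strictly stationary and $\psi$-mixing, $\psi(l)=\sup_{A\in\mathcal{F}_{-\infty}^0,B\in\mathcal{F}_l^\infty,P(A)P(B)>0}|1-P(B|A)/P(B)|$ with $\mathcal{F}_i^j=\sigma\{Y_i,\ldots,Y_j\}$, and $\sum_l l\psi^{1/2}(l)<\infty$. C2: $E\{\int_{\mathcal{I}}Y_t(u)^2du\}^2<\infty$. C3: $\theta_1>\cdots>\theta_d>0=\theta_{d+1}=\cdots$. C4: $\operatorname{cov}\{X_s(u),\varepsilon_t(v)\}=0$ for all $s,t,u,v$. *)

(* Defs.v *)
From HB Require Import structures.
From mathcomp Require Import all_boot all_order all_algebra.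
From mathcomp Require Import all_classical all_reals all_analysis.
Set Implicit Arguments. Unset Strict Implicit. Unset Printing Implicit Defensive.
Import Order.TTheory GRing.Theory Num.Theory.
Import numFieldNormedType.Exports.
Local Open Scope classical_set_scope.
Local Open Scope ring_scope.

Section FDefs.
Variable R : realType.
Variables a b : R.

Definition Iab : set R := `[a, b].
Definition leb := (@lebesgue_measure R).

Definition sq_int (f : R -> R) : Prop :=
  measurable_fun Iab f /\ (\int[leb]_(u in Iab) ((f u) ^+ 2)%:E < +oo)%E.

Definition ip (f g : R -> R) : R := \int[leb]_(u in Iab) (f u * g u).

Definition Kop (k : R -> R -> R) (f : R -> R) : R -> R :=
  fun u => \int[leb]_(v in Iab) (k u v * f v).

Definition eigpair (k : R -> R -> R) (th : R) (phi : R -> R) : Prop :=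
  sq_int phi /\ {ae leb, forall u, Iab u -> Kop k phi u = th * phi u}.

Definition orthonormal (m : nat) (phi : 'I_m -> R -> R) : Prop :=
  forall i j : 'I_m, ip (phi i) (phi j) = (i == j)%:R.

(* k has at least m eigenvalues (counted with multiplicity) satisfying Q *)
Definition has_eigs (Q : R -> Prop) (k : R -> R -> R) (m : nat) : Prop :=
  exists (phi : 'I_m -> R -> R) (th : 'I_m -> R),
    orthonormal phi /\ forall i, Q (th i) /\ eigpair k (th i) (phi i).

(* #{ j : Q (eigenvalue_j of k) } = m  (eigenvalues counted with multiplicity) *)
Definition eig_count (Q : R -> Prop) (k : R -> R -> R) (m : nat) : Prop :=
  has_eigs Q k m /\ ~ has_eigs Q k m.+1.

(* C3 : theta_1 > ... > theta_m > 0 = theta_{m+1} = ... for the kernel k *)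
Definition C3_eig (k : R -> R -> R) (m : nat) : Prop :=
  (exists (phi : 'I_m -> R -> R) (th : 'I_m -> R),
    orthonormal phi /\ (forall i, 0 < th i /\ eigpair k (th i) (phi i)) /\
    (forall i j : 'I_m, (i < j)%N -> th j < th i))
  /\ ~ has_eigs (fun t => 0 < t) k m.+1.

Section Prob.
Variables (dO : measure_display) (Omega : measurableType dO).
Variable P : probability Omega R.

Definition Ex (f : Omega -> R) : R := \int[P]_(w in setT) f w.
Definition cov (f g : Omega -> R) : R := Ex (fun w => f w * g w) - Ex f * Ex g.

Definition Mk (X : int -> Omega -> R -> R) (k : nat) : R -> R -> R :=
  fun u v => cov (fun w => X 0 w u) (fun w => X (k%:Z) w v).
Definition Kker (X : int -> Omega -> R -> R) (p : nat) : R -> R -> R :=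
  fun u v => \sum_(1 <= k < p.+1)
     \int[leb]_(z in Iab) (Mk X k u z * Mk X k v z).

Definition Ybar (Y : int -> Omega -> R -> R) (n : nat) (w : Omega) : R -> R :=
  fun u => n%:R^-1 * \sum_(1 <= j < n.+1) Y (j%:Z) w u.
Definition Mhat (Y : int -> Omega -> R -> R) (p n k : nat) (w : Omega)
    : R -> R -> R :=
  fun u v => (((n%:Z - p%:Z)%:~R : R)^-1) *
    \sum_(1 <= j < (n - p).+1)
      (Y (j%:Z) w u - Ybar Y n w u) * (Y ((j + k)%:Z) w v - Ybar Y n w v).
Definition Khat (Y : int -> Omega -> R -> R) (p n : nat) (w : Omega)
    : R -> R -> R :=
  fun u v => \sum_(1 <= k < p.+1)
     \int[leb]_(z in Iab) (Mhat Y p n k w u z * Mhat Y p n k w v z).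

Definition cyl (Y : int -> Omega -> R -> R) (t : int) (g : R -> R) (B : set R)
  : set Omega := [set w | B (ip (Y t w) g)].

(* F_i^j = sigma{Y_t : i <= t <= j}, with i = -oo / j = +oo allowed *)
Definition gen_F (Y : int -> Omega -> R -> R) (T : set int) : set (set Omega) :=
  [set A | exists t g B, T t /\ sq_int g /\ measurable B /\ A = cyl Y t g B].
Definition F_ (Y : int -> Omega -> R -> R) (T : set int) : set (set Omega) :=
  <<s setT, gen_F Y T >>.

Definition psi (Y : int -> Omega -> R -> R) (l : nat) : \bar R :=
  ereal_sup [set x | exists A B,
     F_ Y [set t | (t <= 0)%R] A /\ F_ Y [set t | (l%:Z <= t)%R] B /\
     (0 < fine (P A) * fine (P B))%R /\
     x = (`| 1 - fine (P (A `&` B)) / (fine (P A) * fine (P B)) |)%:E].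

Definition strictly_stationary (Y : int -> Omega -> R -> R) : Prop :=
  forall (s : seq (int * (R -> R) * set R)) (h : int),
    (forall x, x \in s -> sq_int x.1.2 /\ measurable x.2) ->
    P (\bigcap_(x in [set` s]) cyl Y (x.1.1 + h) x.1.2 x.2) =
    P (\bigcap_(x in [set` s]) cyl Y x.1.1 x.1.2 x.2).

Definition C1 (Y : int -> Omega -> R -> R) : Prop :=
  strictly_stationary Y /\
  (forall l, (0 < l)%N -> (psi Y l < +oo)%E) /\
  (exists C : R, forall N,
     \sum_(1 <= l < N) (l%:R * Num.sqrt (fine (psi Y l))) <= C).

Definition C2 (Y : int -> Omega -> R -> R) : Prop :=
  forall t, (\int[P]_(w in setT)
     ((\int[leb]_(u in Iab) ((Y t w u) ^+ 2)%:E) *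
      (\int[leb]_(u in Iab) ((Y t w u) ^+ 2)%:E)) < +oo)%E.

Definition C4 (X eps : int -> Omega -> R -> R) : Prop :=
  forall s t u v, cov (fun w => X s w u) (fun w => eps t w v) = 0.

Definition model (Y X eps : int -> Omega -> R -> R) : Prop :=
  (forall t w u, Y t w u = X t w u + eps t w u) /\
  (forall t, measurable_fun setT (fun q : Omega * R => X t q.1 q.2)) /\
  (forall t, measurable_fun setT (fun q : Omega * R => eps t q.1 q.2)) /\
  (forall t u, Ex (fun w => eps t w u) = 0) /\
  (forall t s u v, t <> s -> cov (fun w => eps t w u) (fun w => eps s w v) = 0) /\
  (forall t, (\int[leb]_(u in Iab) (\int[P]_(w in setT)
        ((X t w u) ^+ 2 + (eps t w u) ^+ 2)%:E) < +oo)%E) /\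
  (forall t u, Ex (fun w => X t w u) = Ex (fun w => X 0 w u)) /\
  (forall t (k : nat) u v,
     cov (fun w => X t w u) (fun w => X (t + k%:Z) w v) =
     cov (fun w => X 0 w u) (fun w => X (k%:Z) w v)).

End Prob.
End FDefs.

(* Main.v *)
Require Import Defs.
From HB Require Import structures.
From mathcomp Require Import all_boot all_order all_algebra.
From mathcomp Require Import all_classical all_reals all_analysis.
From mathcomp Require Import measurable_realfun ring lra.
Import Order.TTheory GRing.Theory Num.Theory.
Import numFieldNormedType.Exports.
Set Implicit Arguments. Unset Strict Implicit. Unset Printing Implicit Defensive.
Local Open Scope classical_set_scope.
Local Open Scope ring_scope.

(* The kernel K is the Gram kernel of the M_k, and Khat that of the sample kernels Mhat_k.
   White noise and lags k >= 1 make M_k the lag-k autocovariance of Y itself.  Each Y_t(u)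
   is, for almost every u, the limit of averages of Y_t over balls around u, hence
   measurable with respect to Y_t, so that psi-mixing bounds the covariance of
   products W_i(u)W_{i+k}(v) and W_j(u)W_{j+k}(v), W = Y - EY, by psi(j-i-k) times the
   product of the first absolute moments.  As sum psi(l) < oo, the mean squared
   Hilbert-Schmidt norm of Mhat_k - M_k is O(1/n), apart from terms in the empirical means
   that are treated alike.

   On the event that all these squared norms are at most epsilon/(64 p), whose complement
   has probability O(1/(n epsilon)) by Markov's inequality, the two quadratic forms satisfy
   <Kf,f> <= 2 <Khat f,f> + O(epsilon) |f|^2 and the same with K and Khat exchanged.  As long
   as fewer than d eigenfunctions of Khat are known, the span of the d eigenfunctions of K
   contains a unit vector orthogonal to them on which the form of Khat is >= epsilon, which
   yields a further one.  Conversely d+1 eigenfunctions of Khat with eigenvalues >= epsilon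
   would give a unit vector orthogonal to the eigenfunctions of K on which the form of K is
   positive, hence a positive eigenvalue too many.
   The eigenfunctions are obtained without compactness
   arguments, as limits of the normalized powers T^n k_v of a kernel operator applied to
   one of its own sections, the moments <T^n k_v, k_v> being convex and nonincreasing. *)

(** * Square integrable functions and kernels *)

(** The error enters quadratically. The form of a Gram kernel is a sum of |M_k^T f|^2, and |F^T f|^2
    <= 2 |G^T f|^2 + 2 |(F - G)^T f|^2. What matters is therefore the squared Hilbert-Schmidt error
    of the M_k, of mean order 1/n, and not the norm of Khat - K. The factor 2 lost on the main term
    is harmless, because theta_d stays fixed while epsilon tends to 0. The obstacle that shapes the
    probabilistic half is that stationarity and psi-mixing speak of events determined by scalar
    products with the Y_t, while M_k and its estimator are built from pointwise values. Each
    inequality therefore travels from events to bounded functions, then along almost sure limits,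
    and the truncation is released last. The mixing bound survives this because it is
    multiplicative, hence linear in each nonnegative argument; being expressed by first absolute
    moments of products, it leads back to the fourth moment of |Y_t| given by C2. Functions are
    genuine functions, not classes: limits of kernel powers are taken pointwise, which replaces
    completeness of L2. *)

Section L2.
Context d (T : measurableType d) (R : realType).
Variable mu : {measure set T -> \bar R}.
Implicit Types f g h : T -> R.

Definition L2 f := measurable_fun setT f /\
  mu.-integrable setT (EFin \o (fun x => f x ^+ 2)).

Definition ipm f g : R := \int[mu]_x (f x * g x).

Lemma integrable_le f g : measurable_fun setT f ->
  mu.-integrable setT (EFin \o g) -> (forall x, `|f x| <= g x) ->
  mu.-integrable setT (EFin \o f).
Proof.
move=> mf ig fg; apply: le_integrable ig => //; first exact/measurable_EFinP.
by move=> x _ /=; rewrite lee_fin (le_trans (fg x))// ler_norm.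
Qed.

Lemma integrable_addR f g : mu.-integrable setT (EFin \o f) ->
  mu.-integrable setT (EFin \o g) ->
  mu.-integrable setT (EFin \o (fun x => f x + g x)).
Proof. by move=> fi gi; have := integrableD measurableT fi gi. Qed.

Lemma integrable_scaleR c f : mu.-integrable setT (EFin \o f) ->
  mu.-integrable setT (EFin \o (fun x => c * f x)).
Proof. by move=> fi; have := integrableZl measurableT c fi. Qed.

Lemma L2_measurable f : L2 f -> measurable_fun setT f. Proof. by case. Qed.

Lemma L2P f : measurable_fun setT f ->
  (\int[mu]_x ((f x) ^+ 2)%:E < +oo)%E -> L2 f.
Proof.
move=> mf ioo; split => //; apply/integrableP; split.
  exact/measurable_EFinP/measurable_funX.
by under eq_integral => x _ do rewrite /= ger0_norm ?sqr_ge0//.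
Qed.

Lemma L2_lty f : L2 f -> (\int[mu]_x ((f x) ^+ 2)%:E < +oo)%E.
Proof.
move=> [_ /integrableP[_]].
by under eq_integral => x _ do rewrite /= ger0_norm ?sqr_ge0//.
Qed.

Lemma L2_mul f g : L2 f -> L2 g -> mu.-integrable setT (EFin \o (fun x => f x * g x)).
Proof.
move=> [mf fi] [mg gi].
apply: (@integrable_le _ (fun x => f x ^+ 2 + g x ^+ 2)).
- exact: measurable_funM.
- exact: integrable_addR.
- by move=> x; rewrite ler_norml; apply/andP; split; nra.
Qed.

Lemma L2_le f g : measurable_fun setT f -> L2 g ->
  (forall x, `|f x| <= `|g x|) -> L2 f.
Proof.
move=> mf [mg gi] fg; split => //; apply: (integrable_le _ gi).
  exact: measurable_funX.
move=> x; rewrite ger0_norm ?sqr_ge0//.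
by rewrite -[leLHS]real_normK ?num_real// -[leRHS]real_normK ?num_real// ler_sqr ?nnegrE.
Qed.

Lemma L2D f g : L2 f -> L2 g -> L2 (fun x => f x + g x).
Proof.
move=> Lf Lg; have fg := L2_mul Lf Lg; case: Lf Lg => mf fi [mg gi].
split; first exact: measurable_funD.
have := integrable_addR (integrable_addR fi gi) (integrable_scaleR 2 fg).
by apply: eq_integrable => // x _ /=; congr EFin; ring.
Qed.

Lemma L2Z c f : L2 f -> L2 (fun x => c * f x).
Proof.
move=> [mf fi]; split; first exact: measurable_funM.
have := integrable_scaleR (c ^+ 2) fi.
by apply: eq_integrable => // x _ /=; congr EFin; ring.
Qed.

Lemma L20 : L2 (fun=> 0).
Proof.
split => //; have := @integrable0 _ T R mu setT.
by apply: eq_integrable => // x _ /=; rewrite expr0n.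
Qed.

Lemma L2N f : L2 f -> L2 (fun x => - f x).
Proof. by move=> /(L2Z (-1)); under eq_fun do rewrite mulN1r. Qed.

Lemma L2B f g : L2 f -> L2 g -> L2 (fun x => f x - g x).
Proof. by move=> Lf Lg; apply: (L2D Lf); exact: L2N. Qed.

Lemma L2_sum I (r : seq I) (F : I -> T -> R) :
  (forall i, L2 (F i)) -> L2 (fun x => \sum_(i <- r) F i x).
Proof.
move=> LF; elim: r => [|i r IH].
  by under eq_fun do rewrite big_nil; exact: L20.
by under eq_fun do rewrite big_cons; exact: L2D.
Qed.

Lemma eq_L2 f g : f =1 g -> L2 f -> L2 g.
Proof. by move=> /funext ->. Qed.

Lemma ipC f g : ipm f g = ipm g f.
Proof. by rewrite /ipm; apply: eq_Rintegral => x _; rewrite mulrC. Qed.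

Lemma ipDl f g h : L2 f -> L2 g -> L2 h ->
  ipm (fun x => f x + g x) h = ipm f h + ipm g h.
Proof.
move=> Lf Lg Lh; rewrite /ipm -RintegralD//; try exact: L2_mul.
by apply: eq_Rintegral => x _; rewrite mulrDl.
Qed.

Lemma ipZl c f h : L2 f -> L2 h -> ipm (fun x => c * f x) h = c * ipm f h.
Proof.
move=> Lf Lh; rewrite /ipm -RintegralZl//; try exact: L2_mul.
by apply: eq_Rintegral => x _; rewrite mulrA.
Qed.

Lemma ipNl f h : L2 f -> L2 h -> ipm (fun x => - f x) h = - ipm f h.
Proof.
move=> Lf Lh; rewrite -mulN1r -ipZl//; apply: eq_Rintegral => x _; by rewrite mulN1r.
Qed.

Lemma ipBl f g h : L2 f -> L2 g -> L2 h ->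
  ipm (fun x => f x - g x) h = ipm f h - ipm g h.
Proof. by move=> Lf Lg Lh; rewrite ipDl ?ipNl//; exact: L2N. Qed.

Lemma ipDr f g h : L2 f -> L2 g -> L2 h ->
  ipm h (fun x => f x + g x) = ipm h f + ipm h g.
Proof. by move=> Lf Lg Lh; rewrite ipC ipDl// ipC (ipC g). Qed.

Lemma ipBr f g h : L2 f -> L2 g -> L2 h ->
  ipm h (fun x => f x - g x) = ipm h f - ipm h g.
Proof. by move=> Lf Lg Lh; rewrite ipC ipBl// ipC (ipC g). Qed.

Lemma ipZr c f h : L2 f -> L2 h -> ipm h (fun x => c * f x) = c * ipm h f.
Proof. by move=> Lf Lh; rewrite ipC ipZl// ipC. Qed.

Lemma ip0l h : ipm (fun=> 0) h = 0.
Proof.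
rewrite /ipm; under eq_Rintegral do rewrite mul0r.
by rewrite /Rintegral integral0.
Qed.

Lemma ip_suml I (r : seq I) (F : I -> T -> R) h :
  (forall i, L2 (F i)) -> L2 h ->
  ipm (fun x => \sum_(i <- r) F i x) h = \sum_(i <- r) ipm (F i) h.
Proof.
move=> LF Lh; elim: r => [|i r IH].
  by under [X in ipm X]eq_fun do rewrite big_nil; rewrite ip0l big_nil.
under [X in ipm X]eq_fun do rewrite big_cons.
by rewrite ipDl ?IH ?big_cons//; exact: L2_sum.
Qed.

Lemma ip_sumr I (r : seq I) (F : I -> T -> R) h :
  (forall i, L2 (F i)) -> L2 h ->
  ipm h (fun x => \sum_(i <- r) F i x) = \sum_(i <- r) ipm h (F i).
Proof.
by move=> LF Lh; rewrite ipC ip_suml//; apply: eq_bigr => i _; rewrite ipC.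
Qed.

Lemma ip_ge0 f : 0 <= ipm f f.
Proof. by apply: Rintegral_ge0 => x _; rewrite -expr2 sqr_ge0. Qed.

Lemma ipE f : L2 f -> (ipm f f)%:E = (\int[mu]_x ((f x) ^+ 2)%:E)%E.
Proof.
move=> Lf; rewrite /ipm /Rintegral fineK; last first.
  by apply: integrable_fin_num => //; exact: L2_mul.
by apply: eq_integral => x _; rewrite expr2.
Qed.

(* Cauchy-Schwarz for any symmetric psd form, from the discriminant. *)
Lemma psd_CS (x y z : R) :
  0 <= x -> 0 <= z -> (forall t, 0 <= x + 2 * t * y + t ^+ 2 * z) -> y ^+ 2 <= x * z.
Proof.
move=> x0 z0 H; have [z00|z00] := eqVneq z 0.
  have [->|y0] := eqVneq y 0; first by rewrite expr0n/= mulr_ge0.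
  have := H (- (x + 1) / (2 * y)); rewrite z00 mulr0 addr0.
  rewrite (_ : 2 * _ * y = - (x + 1)); last by field.
  by move=> ?; exfalso; lra.
have zp : 0 < z by rewrite lt_neqAle eq_sym z00.
have := H (- y / z).
rewrite (_ : _ + _ = (x * z - y ^+ 2) / z); last by field.
by rewrite pmulr_lge0 ?invr_gt0// subr_ge0.
Qed.

Lemma ip_CS f g : L2 f -> L2 g -> (ipm f g) ^+ 2 <= ipm f f * ipm g g.
Proof.
move=> Lf Lg; apply: psd_CS; rewrite ?ip_ge0// => t.
have Ltg := L2Z t Lg.
have := ip_ge0 (fun x => f x + t * g x).
rewrite ipDl ?ipDr ?ipZl ?ipZr//; last exact: L2D.
by rewrite (ipC g f); congr (_ <= _); ring.
Qed.

Lemma ip_sqD f g : L2 f -> L2 g -> ipm (fun x => f x + g x) (fun x => f x + g x) =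
  ipm f f + 2 * ipm f g + ipm g g.
Proof.
move=> Lf Lg; rewrite ipDl ?ipDr//; last exact: L2D.
by rewrite (ipC g f); move: (ipm f f) (ipm f g) (ipm g g) => x y z; ring.
Qed.

Lemma ip_sqB f g : L2 f -> L2 g -> ipm (fun x => f x - g x) (fun x => f x - g x) =
  ipm f f - 2 * ipm f g + ipm g g.
Proof.
move=> Lf Lg; rewrite ipBl ?ipBr//; last exact: L2B.
by rewrite (ipC g f); move: (ipm f f) (ipm f g) (ipm g g) => x y z; ring.
Qed.

Lemma ip_sub_le f g : L2 f -> L2 g ->
  ipm (fun x => f x - g x) (fun x => f x - g x) <= 2 * ipm f f + 2 * ipm g g.
Proof.
move=> Lf Lg; have := ip_ge0 (fun x => f x + g x); rewrite ip_sqB// ip_sqD//.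
by move: (ipm f f) (ipm f g) (ipm g g) => x y z; lra.
Qed.

Lemma ip_add_le f g : L2 f -> L2 g ->
  ipm (fun x => f x + g x) (fun x => f x + g x) <= 2 * ipm f f + 2 * ipm g g.
Proof.
move=> Lf Lg; have := ip_ge0 (fun x => f x - g x); rewrite ip_sqB// ip_sqD//.
by move: (ipm f f) (ipm f g) (ipm g g) => x y z; lra.
Qed.

Lemma eq_ip_ae f f' g : L2 f -> L2 f' -> L2 g ->
  {ae mu, forall x, f x = f' x} -> ipm f g = ipm f' g.
Proof.
move=> [mf _] [mf' _] [mg _] ff'; rewrite /ipm /Rintegral; congr fine.
apply: ae_eq_integral => //.
- exact/measurable_EFinP/measurable_funM.
- exact/measurable_EFinP/measurable_funM.
- by apply: filterS ff' => x -> _.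
Qed.

Lemma ip_norm_sumsq n (F : 'I_n -> T -> R) (c : 'I_n -> R) :
  (forall i, L2 (F i)) -> (forall i j, ipm (F i) (F j) = (i == j)%:R) ->
  ipm (fun x => \sum_i c i * F i x) (fun x => \sum_i c i * F i x)
    = \sum_i c i ^+ 2.
Proof.
move=> LF oF; rewrite ip_suml; last 2 first.
- by move=> i; exact: L2Z.
- by apply: L2_sum => i; exact: L2Z.
apply: eq_bigr => i _; rewrite ip_sumr; last 2 first.
- by move=> j; exact: L2Z.
- exact: L2Z.
rewrite (bigD1 i)//= big1 => [|j ji].
  by rewrite ipZl ?ipZr ?oF ?eqxx ?mulr1 ?addr0 ?expr2//; exact: L2Z.
by rewrite ipZl ?ipZr ?oF 1?eq_sym ?(negbTE ji) ?mulr0//; exact: L2Z.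
Qed.

End L2.

Section Constants.
Context d (T : measurableType d) (R : realType) (P : probability T R).

Lemma L2_cst (c : R) : L2 P (cst c).
Proof. by split => //; exact: (finite_measure_integrable_cst P (c ^+ 2) (@measurableT _ T)). Qed.

Lemma ip_cst1 : ipm P (cst 1) (cst 1) = 1.
Proof.
rewrite /ipm (_ : (fun _ => _) = cst 1); last by apply/funext => w /=; rewrite mulr1.
by rewrite Rintegral_cst// [X in _ * fine X]probability_setT mulr1.
Qed.

Lemma Rintegral_sqr_le (f : T -> R) : L2 P f -> (\int[P]_w f w) ^+ 2 <= ipm P f f.
Proof.
move=> Lf; have := ip_CS Lf (L2_cst 1); rewrite ip_cst1 mulr1; apply: le_trans.
rewrite le_eqVlt; apply/orP; left; apply/eqP; congr (_ ^+ 2).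
by apply: eq_Rintegral => w _; rewrite mulr1.
Qed.

End Constants.

(** * Fubini's theorem for real-valued integrals and Hilbert-Schmidt kernels *)

Section Fubini.
Context d1 d2 (S : measurableType d1) (T : measurableType d2) (R : realType).
Variables (nu : {sigma_finite_measure set S -> \bar R})
          (mu : {sigma_finite_measure set T -> \bar R}).

(** No integrability is assumed. The integrals of the positive and negative parts are measurable by
    Tonelli, so their difference is measurable, and [fine] sends infinite values to a default in a
    measurable way. *)
Lemma measurable_Rintegral2 (f : S -> T -> R) :
  measurable_fun setT (fun q : S * T => f q.1 q.2) ->
  measurable_fun setT (fun x => \int[mu]_y f x y).
Proof.
move=> mf; rewrite /Rintegral.
have mf' : measurable_fun setT (fun q : S * T => (f q.1 q.2)%:E).
  exact/measurable_EFinP.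
apply: measurableT_comp => //.
have -> : (fun x => \int[mu]_y (f x y)%:E)%E = (fun x =>
  \int[mu]_y ((fun q : S * T => (f q.1 q.2)%:E)^\+ (x, y)) -
  \int[mu]_y ((fun q : S * T => (f q.1 q.2)%:E)^\- (x, y)))%E.
  apply/funext => x; rewrite [LHS]integralE; congr (_ - _)%E;
  by apply: eq_integral => ? _; rewrite ?funeposE ?funenegE.
by apply: emeasurable_funB; apply: measurable_fun_fubini_tonelli_F => //;
  [exact: measurable_funepos|exact: measurable_funeneg].
Qed.

Lemma measurable_integral2 (f : S -> T -> \bar R) :
  (forall x y, 0 <= f x y)%E ->
  measurable_fun setT (fun q : S * T => f q.1 q.2) ->
  measurable_fun setT (fun x => \int[mu]_y f x y)%E.
Proof.
by move=> f0 mf; apply: (@measurable_fun_fubini_tonelli_F _ _ _ _ _ mu (fun q : S * T => f q.1 q.2)).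
Qed.

Lemma measurable_Rintegral2' (f : S -> T -> R) :
  measurable_fun setT (fun q : S * T => f q.1 q.2) ->
  measurable_fun setT (fun y => \int[nu]_x f x y).
Proof.
move=> mf; rewrite /Rintegral.
have mf' : measurable_fun setT (fun q : S * T => (f q.1 q.2)%:E).
  exact/measurable_EFinP.
apply: measurableT_comp => //.
have -> : (fun y => \int[nu]_x (f x y)%:E)%E = (fun y =>
  \int[nu]_x ((fun q : S * T => (f q.1 q.2)%:E)^\+ (x, y)) -
  \int[nu]_x ((fun q : S * T => (f q.1 q.2)%:E)^\- (x, y)))%E.
  apply/funext => x; rewrite [LHS]integralE; congr (_ - _)%E;
  by apply: eq_integral => ? _; rewrite ?funeposE ?funenegE.
by apply: emeasurable_funB; apply: measurable_fun_fubini_tonelli_G => //;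
  [exact: measurable_funepos|exact: measurable_funeneg].
Qed.

Lemma Rfubini1 (f : S -> T -> R) :
  (nu \x mu)%E.-integrable setT (EFin \o (fun q : S * T => f q.1 q.2)) ->
  \int[nu]_x \int[mu]_y f x y = \int[(nu \x mu)%E]_q f q.1 q.2.
Proof.
move=> fi; rewrite /Rintegral -(integral12_prod_meas1 fi); congr fine.
have fF := integrable_fubini_F fi.
apply: ae_eq_integral => //.
- apply/measurable_EFinP/measurable_Rintegral2.
  by case/integrableP : fi => /measurable_EFinP.
- by case/integrableP : fF.
- by have := integrable_ae measurableT fF; apply: filterS => x + _; move=> /(_ I) /fineK <-.
Qed.

Lemma Rfubini2 (f : S -> T -> R) :
  (nu \x mu)%E.-integrable setT (EFin \o (fun q : S * T => f q.1 q.2)) ->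
  \int[mu]_y \int[nu]_x f x y = \int[(nu \x mu)%E]_q f q.1 q.2.
Proof.
move=> fi; rewrite /Rintegral -(integral21_prod_meas1 fi); congr fine.
have fF : mu.-integrable setT (fubini_G nu (EFin \o (fun q : S * T => f q.1 q.2))).
  apply/integrableP; split; first exact: (measurable_fubini_G fi).
  have [mf _] := integrableP _ _ _ fi.
  have := (integrable21ltyP nu mu mf).1 fi; apply: le_lt_trans.
  apply: ge0_le_integral => //.
  - exact/measurableT_comp/(measurable_fubini_G fi).
  - apply: (@measurable_fun_fubini_tonelli_G _ _ _ _ _ nu (fun q : S * T => `|(f q.1 q.2)%:E|)%E) => //.
    exact: measurableT_comp.
  - move=> y _; apply: le_abse_integral => //.
    exact: measurableT_comp (pair2_measurable y).
apply: ae_eq_integral => //.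
- apply/measurable_EFinP/measurable_Rintegral2'.
  by case/integrableP : fi => /measurable_EFinP.
- by case/integrableP : fF.
- by have := integrable_ae measurableT fF; apply: filterS => x + _; move=> /(_ I) /fineK <-.
Qed.

Definition L2K (A : S -> T -> R) := L2 (nu \x mu)%E (fun q : S * T => A q.1 q.2).

Lemma L2_tensor (f : S -> R) (g : T -> R) : L2 nu f -> L2 mu g ->
  L2K (fun x y => f x * g y).
Proof.
move=> [mf fi] [mg gi]; apply: L2P.
  by apply: measurable_funM; apply: measurableT_comp.
rewrite (@fubini_tonelli1 _ _ _ _ _ nu mu (fun q : S * T => ((f q.1 * g q.2) ^+ 2)%:E))//; last 2 first.
- apply/measurable_EFinP/measurable_funX.
  by apply: measurable_funM; apply: measurableT_comp.
- by move=> q; rewrite lee_fin sqr_ge0.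
rewrite /fubini_F.
have Ig x : (\int[mu]_y ((f x * g y) ^+ 2)%:E = (f x ^+ 2 * ipm mu g g)%:E)%E.
  under eq_integral do rewrite exprMn EFinM.
  rewrite ge0_integralZl_EFin ?sqr_ge0//; last 2 first.
  - by move=> y _; rewrite lee_fin sqr_ge0.
  - exact/measurable_EFinP/measurable_funX.
  by rewrite -ipE.
under eq_integral do rewrite Ig mulrC EFinM.
rewrite ge0_integralZl_EFin ?ip_ge0//; last 2 first.
- by move=> y _; rewrite lee_fin sqr_ge0.
- exact/measurable_EFinP/measurable_funX.
by rewrite -ipE// -EFinM ltry.
Qed.

Lemma L2K_fubini (A B : S -> T -> R) : L2K A -> L2K B ->
  (\int[nu]_x \int[mu]_y (A x y * B x y) = ipm (nu \x mu)%E (fun q : S * T => A q.1 q.2) (fun q : S * T => B q.1 q.2))%R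
  /\ (\int[mu]_y \int[nu]_x (A x y * B x y) = ipm (nu \x mu)%E (fun q : S * T => A q.1 q.2) (fun q : S * T => B q.1 q.2))%R.
Proof.
move=> LA LB; have := L2_mul LA LB => iAB.
split.
- exact: (@Rfubini1 (fun x y => A x y * B x y)).
- exact: (@Rfubini2 (fun x y => A x y * B x y)).
Qed.

(** Both sides are the integral of A(x,y) f(x) g(y) over the product. The work lies in moving the
    outer factor under the inner integral, which is done only for almost every value of the outer
    variable. *)
Lemma adjoint (A : S -> T -> R) (f : S -> R) (g : T -> R) :
  L2K A -> L2 nu f -> L2 mu g ->
  \int[nu]_x (f x * \int[mu]_y (A x y * g y)) =
  \int[mu]_y (g y * \int[nu]_x (A x y * f x)).
Proof.
move=> LA Lf Lg; have [H1 H2] := L2K_fubini LA (L2_tensor Lf Lg).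
have fiA := L2_mul LA (L2_tensor Lf Lg).
have ae1 := ae_integrable1 fiA; have ae2 := ae_integrable2 fiA.
have mA : measurable_fun setT (fun q : S * T => A q.1 q.2) by case: LA.
have mf := L2_measurable Lf; have mg := L2_measurable Lg.
have mAS x : measurable_fun setT (A x) by have := measurableT_comp mA (pair1_measurable x).
have mAT y : measurable_fun setT (A ^~ y) by have := measurableT_comp mA (pair2_measurable y).
(* Only [c * h] is known to be integrable. For nonzero [c] this gives the integrability of [h]; for
   c = 0 both sides vanish. *)
have scaleI d' (V : measurableType d') (m : {measure set V -> \bar R}) c (h h' : V -> R) :
    measurable_fun setT h ->
    m.-integrable setT (EFin \o (fun v => c * h v)) ->
    c * \int[m]_v h v = \int[m]_v (c * h v).
  move=> mh ih; have [->|c0] := eqVneq c 0.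
    rewrite mul0r; under eq_Rintegral do rewrite mul0r.
    by rewrite /Rintegral integral0.
  rewrite RintegralZl//.
  have := integrable_scaleR c^-1 ih; apply: eq_integrable => // v _ /=.
  by rewrite mulKf.
transitivity (\int[nu]_x \int[mu]_y (A x y * (f x * g y))).
  apply: (congr1 fine); apply: ae_eq_integral => //.
  - apply/measurable_EFinP/measurable_funM => //.
    apply: (@measurable_Rintegral2 (fun x y => A x y * g y)).
    by apply: measurable_funM => //; apply: measurableT_comp.
  - apply/measurable_EFinP/(@measurable_Rintegral2 (fun x y => A x y * (f x * g y))).
    apply: measurable_funM => //; apply: measurable_funM => //;
    by apply: measurableT_comp.
  - move: ae1; apply: filterS => x ix _; congr EFin; rewrite scaleI//.
    + by apply: eq_Rintegral => y _; ring.
    + exact: measurable_funM.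
    + by apply: eq_integrable ix => // y _ /=; congr EFin; ring.
rewrite H1 -H2.
apply: (congr1 fine); apply: ae_eq_integral => //.
- apply/measurable_EFinP/(@measurable_Rintegral2' (fun x y => A x y * (f x * g y))).
  apply: measurable_funM => //; apply: measurable_funM => //;
  by apply: measurableT_comp.
- apply/measurable_EFinP/measurable_funM => //.
  apply: (@measurable_Rintegral2' (fun x y => A x y * f x)).
  by apply: measurable_funM => //; apply: measurableT_comp.
- move: ae2; apply: filterS => y iy _; congr EFin; rewrite scaleI//.
  + by apply: eq_Rintegral => x _; ring.
  + exact: measurable_funM.
  + by apply: eq_integrable iy => // x _ /=; congr EFin; ring.
Qed.

End Fubini.

Section L2Kernels.
Context d1 d2 (S : measurableType d1) (T : measurableType d2) (R : realType).
Variables (nu : {sigma_finite_measure set S -> \bar R})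
          (mu : {sigma_finite_measure set T -> \bar R}).
Implicit Types (A : S -> T -> R) (f : T -> R).

Lemma L2K_measurable A : L2K nu mu A ->
  measurable_fun setT (fun q : S * T => A q.1 q.2).
Proof. by case. Qed.

Lemma measurable_section A x :
  measurable_fun setT (fun q : S * T => A q.1 q.2) -> measurable_fun setT (A x).
Proof. by move=> mA; have := measurableT_comp mA (pair1_measurable x). Qed.

Lemma measurable_section2 A y :
  measurable_fun setT (fun q : S * T => A q.1 q.2) ->
  measurable_fun setT (fun x => A x y).
Proof. by move=> mA; have := measurableT_comp mA (pair2_measurable y). Qed.

Lemma measurable_sqrE A : measurable_fun setT (fun q : S * T => A q.1 q.2) ->
  measurable_fun setT (fun q : S * T => (A q.1 q.2 ^+ 2)%:E).
Proof. by move=> mA; apply/measurable_EFinP/measurable_funX. Qed.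

Lemma L2KE A : L2K nu mu A ->
  (ipm (nu \x mu)%E (fun q => A q.1 q.2) (fun q => A q.1 q.2))%:E =
  (\int[nu]_x \int[mu]_y (A x y ^+ 2)%:E)%E.
Proof.
move=> LA; rewrite ipE//.
rewrite (@fubini_tonelli1 _ _ _ _ _ nu mu (fun q : S * T => (A q.1 q.2 ^+ 2)%:E))//.
  exact: (measurable_sqrE (L2K_measurable LA)).
by move=> q; rewrite lee_fin sqr_ge0.
Qed.

Lemma L2K_lty A : measurable_fun setT (fun q : S * T => A q.1 q.2) ->
  (\int[nu]_x \int[mu]_y (A x y ^+ 2)%:E < +oo)%E -> L2K nu mu A.
Proof.
move=> mA lty; apply: L2P => //.
rewrite (@fubini_tonelli1 _ _ _ _ _ nu mu (fun q : S * T => (A q.1 q.2 ^+ 2)%:E))//.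
  exact: (measurable_sqrE mA).
by move=> q; rewrite lee_fin sqr_ge0.
Qed.

Lemma ae_L2_section A : L2K nu mu A -> {ae nu, forall x, L2 mu (A x)}.
Proof.
move=> LA; have [mA iA] := LA.
have := ae_integrable1 iA; apply: filterS => x ix; split => //.
exact: measurable_section.
Qed.

Lemma integrable_section A : L2K nu mu A ->
  nu.-integrable setT (EFin \o (fun x => ipm mu (A x) (A x))).
Proof.
move=> LA; have mA := L2K_measurable LA.
have mi : measurable_fun setT (fun x => ipm mu (A x) (A x)).
  apply: (@measurable_Rintegral2 _ _ _ _ _ mu (fun x y => A x y * A x y)).
  exact: measurable_funM.
apply/integrableP; split; first exact/measurable_EFinP.
apply: (@le_lt_trans _ _ (\int[nu]_x \int[mu]_y (A x y ^+ 2)%:E)%E); last first.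
  by rewrite -L2KE// ltry.
apply: ae_ge0_le_integral => //.
- exact/measurableT_comp/measurable_EFinP.
- by move=> x _; apply: integral_ge0 => y _; rewrite lee_fin sqr_ge0.
- apply: (@measurable_integral2 _ _ _ _ _ mu (fun x y => (A x y ^+ 2)%:E)).
    by move=> x y; rewrite lee_fin sqr_ge0.
  exact: (measurable_sqrE mA).
- have := ae_L2_section LA; apply: filterS => x Lx _ /=.
  by rewrite -ipE// ger0_norm ?ip_ge0.
Qed.

Lemma Rintegral_section A : L2K nu mu A ->
  \int[nu]_x ipm mu (A x) (A x) =
  ipm (nu \x mu)%E (fun q => A q.1 q.2) (fun q => A q.1 q.2).
Proof. by move=> LA; have [<- _] := L2K_fubini LA LA. Qed.

(** Turns an almost everywhere bound on the square, typically Cauchy-Schwarz at a fixed point, into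
    square integrability together with a norm bound. *)
Lemma L2_sqr_le (g : S -> R) (b : S -> R) : measurable_fun setT g ->
  nu.-integrable setT (EFin \o b) -> {ae nu, forall x, g x ^+ 2 <= b x} ->
  L2 nu g /\ ipm nu g g <= \int[nu]_x b x.
Proof.
move=> mg ib gb.
have H : (\int[nu]_x (g x ^+ 2)%:E <= \int[nu]_x (b x)%:E)%E.
  have [mb _] := integrableP _ _ _ ib.
  have mb' : measurable_fun setT (fun x => `|(b x)%:E|)%E by exact: measurableT_comp.
  have mg2 : measurable_fun setT (fun x => (g x ^+ 2)%:E).
    by apply/measurable_EFinP/measurable_funX.
  apply: (@le_trans _ _ (\int[nu]_x `|(b x)%:E|)%E).
    apply: ae_ge0_le_integral => //.
    + by move=> x _; rewrite lee_fin sqr_ge0.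
    + by apply: filterS gb => x gx _; rewrite lee_fin (le_trans gx)// ler_norm.
  rewrite le_eqVlt; apply/orP; left; apply/eqP; apply: ae_eq_integral => //.
  apply: filterS gb => x gx _; rewrite gee0_abs// lee_fin.
  exact: le_trans (sqr_ge0 _) gx.
have Lg : L2 nu g.
  apply: L2P => //; apply: le_lt_trans H _.
  by apply: integrable_lty.
split => //.
by rewrite -lee_fin ipE// /Rintegral fineK//; exact: integrable_fin_num.
Qed.

Lemma kernel_op_L2 A f : L2K nu mu A -> L2 mu f ->
  L2 nu (fun x => ipm mu (A x) f) /\
  ipm nu (fun x => ipm mu (A x) f) (fun x => ipm mu (A x) f) <=
  ipm (nu \x mu)%E (fun q => A q.1 q.2) (fun q => A q.1 q.2) * ipm mu f f.
Proof.
move=> LA Lf; have mA := L2K_measurable LA; have mf := L2_measurable Lf.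
rewrite -Rintegral_section// -RintegralZr//; last exact: integrable_section.
apply: L2_sqr_le.
- apply: (@measurable_Rintegral2 _ _ _ _ _ mu (fun x y => A x y * f y)).
  by apply: measurable_funM => //; exact: measurableT_comp.
- have := integrable_scaleR (ipm mu f f) (integrable_section LA).
  by apply: eq_integrable => // x _ /=; rewrite mulrC.
- have := ae_L2_section LA; apply: filterS => x Lx.
  exact: ip_CS.
Qed.

End L2Kernels.

Lemma L2K_tr d1 d2 (S : measurableType d1) (T : measurableType d2) (R : realType)
  (nu : {sigma_finite_measure set S -> \bar R})
  (mu : {sigma_finite_measure set T -> \bar R}) (A : S -> T -> R) :
  L2K nu mu A -> L2K mu nu (fun y x => A x y).
Proof.
move=> LA; have mA := L2K_measurable LA.
apply: L2K_lty.
  have := measurableT_comp mA (@measurable_swap _ _ T S).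
  by apply: eq_measurable_fun => -[x y].
rewrite -(@fubini_tonelli _ _ _ _ _ nu mu (fun q : S * T => (A q.1 q.2 ^+ 2)%:E))//.
- by rewrite -L2KE ?ltry.
- exact: (measurable_sqrE mA).
- by move=> q; rewrite lee_fin sqr_ge0.
Qed.

(** * Eigenfunctions of positive semidefinite kernels *)

Section NormalizedOperator.
Context d (T : measurableType d) (R : realType).
Variable mu : {sigma_finite_measure set T -> \bar R}.
Variable k : T -> T -> R.
Hypothesis Lk : L2K mu mu k.
Hypothesis Lsec : forall u, L2 mu (k u).
Hypothesis ksym : forall u v, k u v = k v u.

Definition Op f : T -> R := fun u => ipm mu (k u) f.

Lemma L2_Op f : L2 mu f -> L2 mu (Op f).
Proof. by move=> Lf; have [] := kernel_op_L2 Lk Lf. Qed.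

Lemma Op_sym f g : L2 mu f -> L2 mu g -> ipm mu (Op f) g = ipm mu f (Op g).
Proof.
move=> Lf Lg; rewrite ipC [RHS](adjoint Lk Lf Lg).
apply: eq_Rintegral => y _; congr (_ * _).
by apply: eq_Rintegral => x _; rewrite ksym.
Qed.

Lemma OpB f g : L2 mu f -> L2 mu g ->
  Op (fun x => f x - g x) = (fun u => Op f u - Op g u).
Proof. by move=> Lf Lg; apply/funext => u; exact: ipBr. Qed.

Lemma OpZ c f : L2 mu f -> Op (fun x => c * f x) = (fun u => c * Op f u).
Proof. by move=> Lf; apply/funext => u; exact: ipZr. Qed.

Definition Opn n f := iter n Op f.

Lemma L2_Opn n f : L2 mu f -> L2 mu (Opn n f).
Proof. by move=> Lf; elim: n => //= n IH; exact: L2_Op. Qed.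

Lemma Opn_ip i j f g : L2 mu f -> L2 mu g ->
  ipm mu (Opn i f) (Opn j g) = ipm mu (Opn (i + j) f) g.
Proof.
move=> Lf Lg; elim: j i => [|j IH] i; first by rewrite addn0.
rewrite /= -Op_sym//; try exact: L2_Opn.
by rewrite addnS -addSn -IH.
Qed.

Hypothesis Opsd : forall f, L2 mu f -> 0 <= ipm mu (Op f) f.
Hypothesis Ople : forall f, L2 mu f -> ipm mu (Op f) f <= ipm mu f f.

(** For an operator T with 0 <= T <= 1 this is the n-th moment of the spectral measure of [f] on
    [0,1]. The inequalities below are the obvious ones for such moments, obtained without a spectral
    theorem: even moments are squared norms of T^j f, odd ones are values of the form of T at T^j
    f. *)
Definition moment f n := ipm mu (Opn n f) f.

Let parity n : exists j, n = j.*2 \/ n = j.*2.+1.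
Proof.
have E := odd_double_half n; exists n./2.
by case: (odd n) E => E; [right|left]; rewrite -[LHS]E.
Qed.

Lemma moment_ip f i j : L2 mu f -> ipm mu (Opn i f) (Opn j f) = moment f (i + j).
Proof. by move=> Lf; exact: Opn_ip. Qed.

Lemma moment_even f j : L2 mu f -> moment f j.*2 = ipm mu (Opn j f) (Opn j f).
Proof. by move=> Lf; rewrite moment_ip// addnn. Qed.

Lemma moment_odd f j : L2 mu f ->
  moment f j.*2.+1 = ipm mu (Op (Opn j f)) (Opn j f).
Proof. by move=> Lf; have := moment_ip j.+1 j Lf; rewrite addSn addnn => <-. Qed.

Lemma moment_ge0 f n : L2 mu f -> 0 <= moment f n.
Proof.
move=> Lf; have [j [->|->]] := parity n; rewrite ?moment_even ?moment_odd//.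
  exact: ip_ge0.
by apply: Opsd; exact: L2_Opn.
Qed.

(** With g = T^j f - T^(j+1) f, the second difference is |g|^2 for even n and <T g, g> for odd n. *)
Lemma moment_convex f n : L2 mu f ->
  0 <= moment f n - 2 * moment f n.+1 + moment f n.+2.
Proof.
move=> Lf; have [j [->|->]] := parity n.
  have := ip_ge0 mu (fun x => Opn j f x - Opn j.+1 f x).
  have L1 := L2_Opn j Lf; have L2' := L2_Opn j.+1 Lf.
  rewrite ipBl ?ipBr//; last exact: L2B.
  rewrite !moment_ip// !addnS !addSn !addnn.
  move: (moment f _) (moment f _) (moment f _) => x y z.
  by congr (_ <= _); ring.
have L1 := L2_Opn j Lf; have L2' := L2_Opn j.+1 Lf.
have := Opsd (L2B L1 L2'); rewrite OpB//.
have := L2_Opn j.+2 Lf => L3.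
rewrite -[Op (Opn j f)]/(Opn j.+1 f) -[Op (Opn j.+1 f)]/(Opn j.+2 f).
rewrite ipBl ?ipBr//; last exact: L2B.
rewrite !moment_ip// !addnS !addSn !addnn.
move: (moment f _) (moment f _) (moment f _) => x y z.
by congr (_ <= _); ring.
Qed.

Lemma moment_noninc f n : L2 mu f -> moment f n.+1 <= moment f n.
Proof.
move=> Lf; have [j [->|->]] := parity n.
  by rewrite moment_even// moment_odd//; apply: Ople; exact: L2_Opn.
(* T - T^2 = T (1 - T) T + (1 - T) T (1 - T) for an operator 0 <= T <= 1 *)
have := moment_convex j.*2.+1 Lf.
have : moment f j.*2.+3 <= moment f j.*2.+2.
  rewrite -doubleS moment_odd// moment_even//; apply: Ople; exact: L2_Opn.
by move: (moment f _) (moment f _) (moment f _) => x y z; lra.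
Qed.

(** By convexity the first decrement is the largest one. *)
Lemma moment_lin f n : L2 mu f ->
  moment f 0 - n%:R * (moment f 0 - moment f 1) <= moment f n.
Proof.
move=> Lf.
have D i : moment f i - moment f i.+1 <= moment f 0 - moment f 1.
  elim: i => [//|i IH]; apply: le_trans IH.
  have := moment_convex i Lf.
  by move: (moment f i) (moment f i.+1) (moment f i.+2) => x y z; lra.
elim: n => [|n IH]; first by rewrite mul0r subr0.
have := D n; rewrite -natr1; move: IH.
by move: (moment f n) (moment f n.+1) (moment f 0) (moment f 1) => x y z t; lra.
Qed.

Lemma moment_noninc_le f m n : L2 mu f -> (m <= n)%N -> moment f n <= moment f m.
Proof.
move=> Lf; elim: n => [|n IH]; first by rewrite leqn0 => /eqP ->.
rewrite leq_eqVlt => /predU1P[->//|mn].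
exact: le_trans (moment_noninc n Lf) (IH mn).
Qed.

Lemma is_cvg_moment f : L2 mu f -> cvgn (moment f).
Proof.
move=> Lf; apply: nonincreasing_is_cvgn.
  by move=> m n; exact: moment_noninc_le.
by exists 0 => _ [n _ <-]; exact: moment_ge0.
Qed.

Lemma measurable_Opn_section n :
  measurable_fun setT (fun q : T * T => Opn n (k q.1) q.2).
Proof.
elim: n => [|n IH] /=; first by case: Lk.
apply: (@measurable_Rintegral2 _ _ _ _ _ mu (fun q z => k q.2 z * Opn n (k q.1) z)).
apply: measurable_funM.
- have := measurableT_comp (L2K_measurable Lk)
    (@measurable_fun_pair _ _ _ (T * T * T)%type T T (fun q => q.1.2) (fun q => q.2) _ _).
  apply => //; exact: measurableT_comp.
- have := measurableT_comp IH
    (@measurable_fun_pair _ _ _ (T * T * T)%type T T (fun q => q.1.1) (fun q => q.2) _ _).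
  apply => //; exact: measurableT_comp.
Qed.

Lemma measurable_moment_section n : measurable_fun setT (fun v => moment (k v) n).
Proof.
apply: (@measurable_Rintegral2 _ _ _ _ _ mu (fun v u => Opn n (k v) u * k v u)).
by apply: measurable_funM; [exact: measurable_Opn_section|exact: L2K_measurable Lk].
Qed.

Lemma integrable_moment_section n :
  mu.-integrable setT (EFin \o (fun v => moment (k v) n)).
Proof.
apply: (integrable_le (measurable_moment_section n) (integrable_section Lk)) => v.
by rewrite ger0_norm ?moment_ge0//; exact: (moment_noninc_le (m := 0)).
Qed.

(** For a unit vector f, T^(n+1) f (v) = <k_v, T^n f> = <T^n k_v, f>, whose square is at most |T^n
    k_v|^2, the moment of order 2n of the section k_v. Integration over v gives the bound. *)
Lemma moment_section_int n f : L2 mu f ->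
  ipm mu f f = 1 -> moment f n.+1.*2 <= \int[mu]_v moment (k v) n.*2.
Proof.
move=> Lf f1; rewrite moment_even//.
have [] // := @L2_sqr_le _ _ _ mu (Opn n.+1 f) (fun v => moment (k v) n.*2).
- by apply: L2_measurable; exact: L2_Opn.
- exact: integrable_moment_section.
- apply: aeW => v /=; rewrite /Op -[k v]/(Opn 0 (k v)) Opn_ip//=.
  rewrite add0n; apply: le_trans (ip_CS (L2_Opn n (Lsec v)) Lf) _.
  by rewrite f1 mulr1 moment_even.
Qed.

Hypothesis Opsup : forall e, 0 < e ->
  exists f, L2 mu f /\ ipm mu f f = 1 /\ 1 - e <= ipm mu (Op f) f.

Lemma moment_section_ge1 n : 1 <= \int[mu]_v moment (k v) n.*2.
Proof.
(* The moment of order 2(n+1) of a unit vector is at least 1 minus 2(n+1) times its first decrement,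
   so the near-maximizer is chosen with that decrement at most e / (2(n+1)). *)
apply/ler_addgt0Pr => e e0; have e1 : 0 < e / n.+1.*2%:R by rewrite divr_gt0.
have [f [Lf [f1 f2]]] := Opsup e1.
have := moment_lin n.+1.*2 Lf; have := moment_section_int n Lf f1.
rewrite -[moment f 1]/(ipm mu (Op f) f) -[moment f 0]/(ipm mu f f) f1 => H1 H2.
have H3 : n.+1.*2%:R * (1 - ipm mu (Op f) f) <= e.
  rewrite mulrC -ler_pdivlMr//; move: f2; move: (ipm _ _ f) => x.
  by move: (e / _) => y; lra.
move: H1 H2 H3; move: (\int[mu]_v _) (ipm _ _ f) (moment _ _) (_%:R) => x y z t.
by lra.
Qed.

(** This replaces compactness. If all the limits were 0, dominated convergence with the integrable
    bound |k_v|^2 would send to 0 integrals that are bounded below by 1. *)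
Lemma moment_section_not0 : exists v, 0 < limn (moment (k v)).
Proof.
apply: contrapT => H.
have lim0 v : moment (k v) @ \oo --> (0:R).
  have cv := is_cvg_moment (Lsec v).
  suff <- : limn (moment (k v)) = 0 by [].
  apply/eqP; rewrite eq_le; apply/andP; split.
    by rewrite leNgt; apply/negP => ?; apply: H; exists v.
  by apply: limr_ge => //; near=> n; exact: moment_ge0.
have [|||||_ _] := @dominated_convergence _ _ _ mu setT measurableT
  (fun n v => (moment (k v) n)%:E) (fun=> 0%E)
  (fun v => (ipm mu (k v) (k v))%:E).
- by move=> n; apply/measurable_EFinP; exact: measurable_moment_section.
- exact: measurable_cst.
- by apply: aeW => v _; apply: cvg_EFin; [near=> n|exact: lim0].
- exact: integrable_section.
- apply: aeW => v n _; rewrite lee_fin ger0_norm ?moment_ge0//.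
  exact: (moment_noninc_le (m := 0)).
rewrite integral0 => C.
have : (1 <= 0 :> \bar R)%E.
  apply: (cvge_to_ge C); near=> n.
  have iM := integrable_moment_section n.
  rewrite -[leRHS]fineK; last exact: integrable_fin_num iM.
  rewrite lee_fin (le_trans (moment_section_ge1 n))//.
  apply: le_Rintegral => //; first exact: integrable_moment_section.
  by move=> v _; apply: moment_noninc_le => //; rewrite -addnn leq_addr.
by rewrite lee_fin ler10.
Unshelve. all: by end_near. Qed.

(** With g_n = T^n k_v, the squared distance |g_m - g_n|^2 is a combination of the moments of orders
    2m, m+n and 2n with coefficients 1, -2, 1. It tends to l - 2l + l = 0, while |g_n|^2 stays above
    l > 0. *)
Lemma fixpoint_exists : exists h, L2 mu h /\ 0 < ipm mu h h /\ Op h = h.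
Proof.
have [v l0] := moment_section_not0.
pose g n := Opn n (k v); pose N u := ipm mu (k u) (k u).
have Lg n : L2 mu (g n) by exact: L2_Opn.
set l := limn _ in l0.
have cl : moment (k v) @ \oo --> l by exact: is_cvg_moment.
have Cauchy e : 0 < e -> \forall M \near \oo, forall m n, (M <= m)%N -> (M <= n)%N ->
    ipm mu (fun x => g m x - g n x) (fun x => g m x - g n x) <= e.
  move=> e0; have e4 : 0 < e / 4 by rewrite divr_gt0.
  have /cvgrPdist_le/(_ _ e4)[M _ HM] := cl.
  exists M => // M' /= MM' m n M'm M'n.
  have HH j : (M <= j)%N -> `|l - moment (k v) j| <= e / 4 by exact: HM.
  rewrite ipBl ?ipBr//; last exact: L2B.
  rewrite !moment_ip//; have Mm := leq_trans MM' M'm; have Mn := leq_trans MM' M'n.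
  have := HH _ (leq_trans Mm (leq_addr m m)).
  have := HH _ (leq_trans Mn (leq_addr n n)).
  have := HH _ (leq_trans Mm (leq_addr n m)).
  have := HH _ (leq_trans Mn (leq_addr m n)).
  rewrite !ler_distl; move: (moment _ _) (moment _ _) (moment _ _) (moment _ _).
  by move=> x y z t /andP[? ?] /andP[? ?] /andP[? ?] /andP[? ?]; lra.
(* Since g_(n+1)(u) = <k_u, g_n>, a sequence that is Cauchy in norm is Cauchy at every point u after
   one more application of T. The limit [h] is thus defined everywhere, with an error controlled by
   |k_u|^2. *)
have Pdist e : 0 < e -> \forall M \near \oo, forall m n u, (M <= m)%N -> (M <= n)%N ->
    (g m.+1 u - g n.+1 u) ^+ 2 <= e * N u.
  move=> e0; have := Cauchy e e0; apply: filterS => M HM m n u Mm Mn.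
  have LB := L2B (Lg m) (Lg n).
  rewrite [X in X ^+ 2](_ : _ = ipm mu (k u) (fun x => g m x - g n x)); last first.
    by rewrite ipBr.
  rewrite mulrC; apply: le_trans (ip_CS (Lsec u) LB) _.
  by apply: ler_wpM2l; [exact: ip_ge0|exact: HM].
have cg u : cvgn (fun n => g n.+1 u).
  apply/cauchy_cvgP/cauchy_exP => e e0.
  have N1 : 0 < N u + 1 by rewrite ltr_wpDl// ip_ge0.
  have e' : 0 < e ^+ 2 / (2 * (N u + 1)) by rewrite divr_gt0// ?exprn_gt0// mulr_gt0.
  have [M _ /(_ M (leqnn M)) HM] := Pdist _ e'.
  exists (g M.+1 u); exists M => // n /= Mn; rewrite /ball/=.
  rewrite -ltr_sqr ?nnegrE// ?(ltW e0)// real_normK ?num_real//.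
  apply: le_lt_trans (HM M n u (leqnn M) Mn) _.
  rewrite mulrAC ltr_pdivrMr ?mulr_gt0// ltr_pM2l ?exprn_gt0//.
  by have := ip_ge0 mu (k u); rewrite -/(N u); move: (N u) => x; lra.
pose h u := limn (fun n => g n.+1 u).
have ch u : (fun n => g n.+1 u) @ \oo --> h u by exact: cg.
have Hdist e : 0 < e -> \forall M \near \oo, forall n u, (M <= n)%N ->
    (h u - g n.+1 u) ^+ 2 <= e * N u.
  move=> e0; have := Pdist e e0; apply: filterS => M HM n u Mn.
  have C : (fun m => (g m.+1 u - g n.+1 u) ^+ 2) @ \oo --> (h u - g n.+1 u) ^+ 2.
    by rewrite !expr2; apply: cvgM; apply: cvgB; [exact: ch|exact: cvg_cst|exact: ch|exact: cvg_cst].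
  apply: (cvgr_to_le C); exists M => // m /= Mm; exact: HM.
have mh : measurable_fun setT h.
  apply: (measurable_fun_cvg (h := fun n => g n.+1)) => // n.
  exact: L2_measurable.
have iN : mu.-integrable setT (EFin \o N) by exact: integrable_section.
have C0 : 0 <= \int[mu]_u N u by apply: Rintegral_ge0 => u _; exact: ip_ge0.
set C := \int[mu]_u N u in C0.
have Ldist e : 0 < e -> exists M, forall n, (M <= n)%N ->
    L2 mu (fun u => h u - g n.+1 u) /\
    ipm mu (fun u => h u - g n.+1 u) (fun u => h u - g n.+1 u) <= e * C.
  move=> e0; have [M _ /(_ M (leqnn M)) HM] := Hdist e e0.
  exists M => n Mn; rewrite /C -RintegralZl//; apply: L2_sqr_le.
  - by apply: measurable_funB => //; exact: L2_measurable.
  - exact: integrable_scaleR.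
  - by apply: aeW => u /=; exact: HM.
have Lh : L2 mu h.
  have [M /(_ M (leqnn M)) [H _]] := Ldist 1 ltr01.
  by have := L2D H (Lg M.+1); apply: eq_L2 => u; rewrite subrK.
exists h; split => //; split.
  rewrite lt_neqAle ip_ge0 andbT eq_sym; apply/negP => /eqP h0.
  (* If h had norm 0, then l <= |g|^2 <= 2 |h - g|^2. This choice makes |h - g|^2 less than l/2, a
     contradiction. *)
  have e0 : 0 < l / (4 * (C + 1)) by rewrite divr_gt0// mulr_gt0// ltr_wpDl.
  have [M /(_ M (leqnn M)) [H1 H2]] := Ldist _ e0.
  have H3 : l <= ipm mu (g M.+1) (g M.+1).
    rewrite moment_ip//; apply: (nonincreasing_cvgn_ge (u_ := moment (k v))).
      by move=> m n; exact: moment_noninc_le.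
    exact: is_cvg_moment.
  have [D [LD [gD D2]]] : exists D, L2 mu D /\ g M.+1 = (fun u => h u - D u) /\
      ipm mu D D <= l / (4 * (C + 1)) * C.
    exists (fun u => h u - g M.+1 u); split => //; split => //.
    by apply/funext => u; rewrite opprB addrC subrK.
  have H5 : ipm mu (g M.+1) (g M.+1) <= 2 * ipm mu h h + 2 * ipm mu D D.
    by rewrite gD; exact: ip_sub_le.
  have : l / (4 * (C + 1)) * C < l / 2.
    rewrite mulrAC ltr_pdivrMr ?mulr_gt0// ?ltr_wpDl//.
    by rewrite mulrC -subr_gt0 (_ : _ - _ = l * (C + 2)); [apply: mulr_gt0 => //; lra|field].
  move: H3 D2 H5; rewrite h0; move: (ipm _ (g _) _) (ipm _ D D) (_ * C) (l / 2) (splitr l).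
  by move=> x y z t; lra.
apply/funext => u.
have c1 := ch u; rewrite -(cvg_shiftS (fun n => g n.+1 u)) in c1.
have c2 : (fun n => g n.+2 u) @ \oo --> Op h u.
  apply/cvgrPdist_le => e e0.
  have NC : 0 < N u * C + 1 by rewrite ltr_wpDl// mulr_ge0// ip_ge0.
  have e' : 0 < e ^+ 2 / (N u * C + 1) by rewrite divr_gt0// exprn_gt0.
  have [M HM] := Ldist _ e'.
  exists M => // n /= Mn; have [H1 H2] := HM n Mn.
  rewrite -ler_sqr ?nnegrE// ?(ltW e0)// real_normK ?num_real//.
  rewrite [X in X ^+ 2](_ : _ = ipm mu (k u) (fun x => h x - g n.+1 x)); last first.
    by rewrite ipBr.
  apply: le_trans (ip_CS (Lsec u) H1) _.
  apply: (@le_trans _ _ (N u * (e ^+ 2 / (N u * C + 1) * C))).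
    by apply: ler_wpM2l => //; exact: ip_ge0.
  rewrite mulrCA mulrAC -mulrA ger_pMr ?exprn_gt0//.
  by rewrite ler_pdivrMr// mul1r mulrC lerDl.
exact: cvg_unique c2 c1.
Unshelve. all: by end_near. Qed.
End NormalizedOperator.

(** Provides the coefficients of a unit vector in the span of n orthonormal functions that is
    orthogonal to m < n others: m linear conditions on n unknowns, then normalization. *)
Lemma orthogonal_combination (R : realType) (m n : nat) (A : 'I_n -> 'I_m -> R) :
  (m < n)%N -> exists c : 'I_n -> R,
  \sum_i c i ^+ 2 = 1 /\ forall j, \sum_i c i * A i j = 0.
Proof.
move=> mn; pose M := \matrix_(i < n, j < m) A i j.
have : kermx M != 0.
  rewrite kermx_eq0 /row_free; apply: contraTN mn => /eqP <-.
  by rewrite -leqNgt rank_leq_col.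
case/rowV0Pn => v /sub_kermxP vM v0.
pose s := \sum_i v 0 i ^+ 2.
have s0 : 0 < s.
  rewrite lt_neqAle sumr_ge0 ?andbT; last by move=> i _; exact: sqr_ge0.
  apply: contra v0; rewrite eq_sym psumr_eq0; last by move=> i _; exact: sqr_ge0.
  move=> /allP H; apply/eqP/rowP => i; rewrite mxE.
  by have := H i (mem_index_enum i); rewrite sqrf_eq0 => /eqP.
exists (fun i => v 0 i / Num.sqrt s); split.
  under eq_bigr do rewrite exprMn.
  by rewrite -mulr_suml exprVn sqr_sqrtr ?ltW// divff// gt_eqF.
move=> j; under eq_bigr do rewrite mulrAC.
rewrite -mulr_suml; apply/eqP; rewrite mulf_eq0; apply/orP; left; apply/eqP.
transitivity ((v *m M) 0 j); last by rewrite vM mxE.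
by rewrite mxE; apply: eq_bigr => i _; rewrite mxE.
Qed.

Section Eigenfunctions.
Context d (T : measurableType d) (R : realType).
Variable mu : {sigma_finite_measure set T -> \bar R}.
Implicit Types (k : T -> T -> R) (f : T -> R).

Record psd_kernel k : Prop := PsdKernel {
  psd_L2K : L2K mu mu k;
  psd_sec : forall u, L2 mu (k u);
  psd_sym : forall u v, k u v = k v u;
  psd_ge0 : forall f, L2 mu f -> 0 <= ipm mu (Op mu k f) f }.

Lemma Op_form_le k f : psd_kernel k -> L2 mu f ->
  (ipm mu (Op mu k f) f) ^+ 2 <=
  ipm (mu \x mu)%E (fun q => k q.1 q.2) (fun q => k q.1 q.2) * ipm mu f f ^+ 2.
Proof.
move=> pk Lf; have [L1 L2'] := kernel_op_L2 (psd_L2K pk) Lf.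
apply: le_trans (ip_CS L1 Lf) _.
by rewrite expr2 mulrA ler_wpM2r// ip_ge0.
Qed.

(** The kernel is divided by the supremum [l] of its form over unit vectors. The rescaled form lies
    between 0 and 1 with supremum 1, and a fixed point of the rescaled operator is an eigenfunction
    for [l]. *)
Lemma top_eigenfunction k f c : psd_kernel k -> L2 mu f -> ipm mu f f = 1 ->
  0 < c -> c <= ipm mu (Op mu k f) f ->
  exists h l, L2 mu h /\ ipm mu h h = 1 /\ c <= l /\
    Op mu k h = (fun u => l * h u).
Proof.
move=> pk Lf f1 c0 cf.
pose E := [set x | exists g, L2 mu g /\ ipm mu g g = 1 /\ x = ipm mu (Op mu k g) g].
pose C := ipm (mu \x mu)%E (fun q => k q.1 q.2) (fun q => k q.1 q.2).
have Eub : ubound E (C + 1).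
  move=> _ [g [Lg [g1 ->]]]; have := Op_form_le pk Lg.
  rewrite g1 expr1n mulr1 -/C => H; have := ip_ge0 (mu \x mu)%E (fun q => k q.1 q.2).
  by rewrite -/C => C0; nra.
have hE : has_sup E by split; [exists (ipm mu (Op mu k f) f), f|exists (C + 1)].
pose l := sup E.
have cl : c <= l by apply: le_trans cf _; apply: ub_le_sup; [exact: hE.2|exists f].
have l0 : 0 < l by exact: lt_le_trans cl.
pose k' u v := l^-1 * k u v.
have Lk' : L2K mu mu k' by apply: L2Z; exact: psd_L2K.
have Lsec' u : L2 mu (k' u) by apply: L2Z; exact: psd_sec.
have sym' u v : k' u v = k' v u by rewrite /k' (psd_sym pk).
have Op' g : L2 mu g -> Op mu k' g = (fun u => l^-1 * Op mu k g u).
  by move=> Lg; apply/funext => u; apply: ipZl => //; exact: psd_sec.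
have LOp g : L2 mu g -> L2 mu (Op mu k g) by apply: L2_Op; exact: psd_L2K.
have ge0' g : L2 mu g -> 0 <= ipm mu (Op mu k' g) g.
  move=> Lg; rewrite Op'// ipZl//; last exact: LOp.
  by rewrite mulr_ge0 ?invr_ge0 ?(ltW l0)//; exact: psd_ge0.
have le' g : L2 mu g -> ipm mu (Op mu k' g) g <= ipm mu g g.
  move=> Lg; rewrite Op'// ipZl//; last exact: LOp.
  rewrite mulrC ler_pdivrMr//.
  (* A function of norm 0 cannot be normalized; its form vanishes by the Hilbert-Schmidt bound. *)
  have [g0|g0] := eqVneq (ipm mu g g) 0.
    have := Op_form_le pk Lg; rewrite g0 mul0r expr0n/= mulr0.
    by move=> H; rewrite -(ler_sqr (R:=R)) ?nnegrE ?expr0n//; exact: psd_ge0.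
  have gp : 0 < ipm mu g g by rewrite lt_neqAle eq_sym g0 ip_ge0.
  pose s := (Num.sqrt (ipm mu g g))^-1.
  have s2 : s ^+ 2 = (ipm mu g g)^-1 by rewrite exprVn sqr_sqrtr// ltW.
  have : s ^+ 2 * ipm mu (Op mu k g) g <= l.
    apply: ub_le_sup; first exact: hE.2.
    exists (fun x => s * g x); split; first exact: L2Z.
    split.
      by rewrite ipZl ?ipZr//; [rewrite mulrA -expr2 s2 mulVf|exact: L2Z].
    rewrite OpZ//; last exact: psd_sec.
    rewrite ipZl ?ipZr ?mulrA -?expr2//; [exact: LOp|exact: LOp|exact: L2Z].
  by rewrite s2 mulrC ler_pdivrMr// mulrC.
have sup' e : 0 < e -> exists g, L2 mu g /\ ipm mu g g = 1 /\ 1 - e <= ipm mu (Op mu k' g) g.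
  move=> e0; have el : 0 < e * l by rewrite mulr_gt0.
  have [_ [g [Lg [g1 ->]]] H] := sup_adherent el hE.
  exists g; split; [by []|split; [by []|]]; rewrite Op'// ipZl//; last exact: LOp.
  rewrite mulrC ler_pdivlMr//; move: H; rewrite -/l; lra.
have [h [Lh [h0 hh]]] := fixpoint_exists Lk' Lsec' sym' ge0' le' sup'.
pose s := (Num.sqrt (ipm mu h h))^-1.
exists (fun x => s * h x), l; split; first exact: L2Z.
split.
  rewrite ipZl ?ipZr//; last exact: L2Z.
  by rewrite mulrA -expr2 exprVn sqr_sqrtr ?mulVf ?gt_eqF// ltW.
split => //; rewrite OpZ//; last exact: psd_sec.
have {}hh u : Op mu k h u = l * h u.
  by rewrite -{2}hh Op'// mulVKf// gt_eqF.
by apply/funext => u; rewrite hh mulrCA.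
Qed.

Definition orthonormal_fun m (phi : 'I_m -> T -> R) :=
  forall i j, ipm mu (phi i) (phi j) = (i == j)%:R.

Definition eigenfun k th f := L2 mu f /\ {ae mu, forall u, Op mu k f u = th * f u}.

Section Deflation.
Variables (k : T -> T -> R) (m : nat) (phi : 'I_m -> T -> R) (th : 'I_m -> R).
Hypotheses (pk : psd_kernel k) (ophi : orthonormal_fun phi)
  (ephi : forall i, eigenfun k (th i) (phi i)).

Definition deflate u v := k u v - \sum_i th i * phi i u * phi i v.

Let Lphi i : L2 mu (phi i). Proof. by case: (ephi i). Qed.

Let LOp g : L2 mu g -> L2 mu (Op mu k g).
Proof. by apply: L2_Op; exact: psd_L2K. Qed.

Lemma Op_deflate f : L2 mu f ->
  Op mu deflate f = (fun u => Op mu k f u - \sum_i th i * ipm mu (phi i) f * phi i u).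
Proof.
move=> Lf; apply/funext => u; rewrite /Op /deflate ipBl//; last 2 first.
- exact: psd_sec.
- by apply: L2_sum => i; exact: L2Z.
rewrite ip_suml//; last by move=> i; exact: L2Z.
by congr (_ - _); apply: eq_bigr => i _; rewrite ipZl// mulrAC.
Qed.

Lemma ip_Op_eigen g i : L2 mu g -> ipm mu (Op mu k g) (phi i) = th i * ipm mu g (phi i).
Proof.
move=> Lg; rewrite Op_sym//; [|exact: psd_L2K|exact: psd_sym].
rewrite -ipZr// ipC [RHS]ipC; apply: eq_ip_ae => //; first exact: LOp.
  exact: L2Z.
by case: (ephi i).
Qed.

(** With [P] the orthogonal projection of f on the span of the [phi i], the deflated form at f
    equals the original form at f - P. *)
Lemma deflate_psd : psd_kernel deflate.
Proof.
split.
- apply: L2B; first exact: psd_L2K.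
  apply: (@L2_sum _ _ _ _ _ _ (fun i (q : T * T) => th i * phi i q.1 * phi i q.2)) => i.
  have := L2Z (th i) (L2_tensor (Lphi i) (Lphi i)).
  by apply: eq_L2 => q; rewrite mulrA.
- move=> u; apply: L2B; first exact: psd_sec.
  by apply: L2_sum => i; exact: L2Z.
- move=> u v; rewrite /deflate (psd_sym pk); congr (_ - _).
  by apply: eq_bigr => i _; rewrite mulrAC.
move=> f Lf; rewrite Op_deflate//.
pose c i := ipm mu (phi i) f.
pose P x := \sum_i c i * phi i x.
have LP : L2 mu P by apply: L2_sum => i; exact: L2Z.
have := psd_ge0 pk (L2B Lf LP).
have LQ : L2 mu (fun u => \sum_i th i * ipm mu (phi i) f * phi i u).
  by apply: L2_sum => i; exact: L2Z.
have OP g : L2 mu g -> ipm mu (Op mu k g) P = \sum_i c i * (th i * ipm mu g (phi i)).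
  move=> Lg; rewrite /P ip_sumr//.
  - by apply: eq_bigr => i _; rewrite ipZr ?ip_Op_eigen//; exact: LOp.
  - by move=> i; exact: L2Z.
  - exact: LOp.
have cP i : ipm mu P (phi i) = c i.
  rewrite /P ip_suml//; last by move=> j; exact: L2Z.
  rewrite (bigD1 i)//= big1 => [|j ji]; first by rewrite ipZl// ophi eqxx mulr1 addr0.
  by rewrite ipZl// ophi (negbTE ji) mulr0.
have LOf := LOp Lf; have LOP := LOp LP.
rewrite OpB//; last exact: psd_sec.
have OPf : ipm mu (Op mu k P) f = ipm mu (Op mu k f) P.
  by rewrite Op_sym//; [rewrite ipC|exact: psd_L2K|exact: psd_sym].
rewrite ipBl//; last exact: L2B.
rewrite ![ipm _ _ (fun x => f x - P x)]ipBr// OPf (OP f)// (OP P)//.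
rewrite ipBl// ip_suml//; last by move=> i; exact: L2Z.
have -> : \sum_i c i * (th i * ipm mu f (phi i)) = \sum_i th i * c i ^+ 2.
  by apply: eq_bigr => i _; rewrite (ipC _ f) -/(c i); ring.
have -> : \sum_i c i * (th i * ipm mu P (phi i)) = \sum_i th i * c i ^+ 2.
  by apply: eq_bigr => i _; rewrite cP; ring.
have -> : \sum_i ipm mu (fun x => th i * ipm mu (phi i) f * phi i x) f =
    \sum_i th i * c i ^+ 2.
  by apply: eq_bigr => i _; rewrite ipZl// -/(c i); ring.
by move: (ipm _ _ _) (\sum_i _) => x y; congr (_ <= _); ring.
Qed.

(** At an [f] orthogonal to the known eigenfunctions the deflated form agrees with the original one.
    The deflated operator is symmetric and kills each [phi i], so its eigenfunctions with positive
    eigenvalue are orthogonal to the [phi i], and on such functions the two operators coincide. *)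
Lemma eigen_extension f c : L2 mu f -> ipm mu f f = 1 ->
  (forall i, ipm mu (phi i) f = 0) -> 0 < c -> c <= ipm mu (Op mu k f) f ->
  exists h l, ipm mu h h = 1 /\ c <= l /\ eigenfun k l h /\
    forall i, ipm mu (phi i) h = 0.
Proof.
move=> Lf f1 fphi c0 cf.
have [|h [l [Lh [h1 [cl Oh]]]]] := top_eigenfunction deflate_psd Lf f1 c0.
  rewrite Op_deflate//; have : (fun u => Op mu k f u -
     \sum_i th i * ipm mu (phi i) f * phi i u) = Op mu k f.
    apply/funext => u; rewrite big1 ?subr0// => i _.
    by rewrite fphi mulr0 mul0r.
  by move=> ->.
have l0 : 0 < l by exact: lt_le_trans cl.
have hphi i : ipm mu (phi i) h = 0.
  have : ipm mu (Op mu deflate h) (phi i) = l * ipm mu h (phi i) by rewrite Oh ipZl.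
  rewrite Op_deflate// ipBl//; [|exact: LOp|by apply: L2_sum => j; exact: L2Z].
  rewrite ip_Op_eigen// ip_suml//; last by move=> j; exact: L2Z.
  rewrite (bigD1 i)//= big1 => [|j ji].
    rewrite ipZl// ophi eqxx mulr1 (ipC _ h) addr0 subrr => /esym/eqP.
    by rewrite mulf_eq0 gt_eqF//= => /eqP.
  by rewrite ipZl// ophi (negbTE ji) mulr0.
exists h, l; split => //; split => //; split => //; split => //.
apply: aeW => u /=; have := congr1 (fun g => g u) Oh.
rewrite Op_deflate//= big1 ?subr0// => i _.
by rewrite hphi mulr0 mul0r.
Qed.

End Deflation.

Definition has_eigenfuns (Q : R -> Prop) k m :=
  exists (phi : 'I_m -> T -> R) (th : 'I_m -> R),
    orthonormal_fun phi /\ forall i, Q (th i) /\ eigenfun k (th i) (phi i).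

Lemma has_eigenfunsS (Q : R -> Prop) k m phi th h l :
  orthonormal_fun (phi : 'I_m -> T -> R) ->
  (forall i, Q (th i) /\ eigenfun k (th i) (phi i)) ->
  Q l -> ipm mu h h = 1 -> eigenfun k l h -> (forall i, ipm mu (phi i) h = 0) ->
  has_eigenfuns Q k m.+1.
Proof.
move=> ophi ephi Ql h1 eh hphi.
exists (fun i => oapp phi h (unlift ord0 i)), (fun i => oapp th l (unlift ord0 i)).
split.
  move=> i j; case: unliftP => [i'|] ->; case: unliftP => [j'|] -> /=.
  - by rewrite ophi (inj_eq (@lift_inj _ ord0)).
  - by rewrite hphi.
  - by rewrite ipC hphi.
  - by rewrite h1.
by move=> i; case: unliftP => [i'|] _ /=.
Qed.

End Eigenfunctions.

(** * Perturbation of Gram kernels *)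

Section GramKernels.
Context d (T : measurableType d) (R : realType).
Variable mu : {sigma_finite_measure set T -> \bar R}.
Implicit Types (f : T -> R) (M : T -> T -> R).

Definition gram1 M : T -> T -> R := fun u v => ipm mu (M u) (M v).

Definition hsnorm2 M : R := ipm (mu \x mu)%E (fun q => M q.1 q.2) (fun q => M q.1 q.2).

(** The adjoint of the integral operator with kernel [M]; the form of [gram1 M] at f is the squared
    norm of [Opt M f]. *)
Definition Opt M f : T -> R := fun z => ipm mu (fun u => M u z) f.

(** All sections, not almost all, must be square integrable: the construction of eigenfunctions
    evaluates the operator at every point. *)
Definition L2sec M := L2K mu mu M /\ forall u, L2 mu (M u).

Lemma L2_Opt M f : L2K mu mu M -> L2 mu f -> L2 mu (Opt M f).
Proof. by move=> /L2K_tr LM Lf; have [] := kernel_op_L2 LM Lf. Qed.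

Lemma hsnorm2_tr M : L2K mu mu M -> hsnorm2 (fun z u => M u z) = hsnorm2 M.
Proof.
move=> LM; apply: EFin_inj; rewrite /hsnorm2 (L2KE (L2K_tr LM)) (L2KE LM).
rewrite -(@fubini_tonelli _ _ _ _ _ mu mu (fun q : T * T => (M q.1 q.2 ^+ 2)%:E))//.
- exact: (measurable_sqrE (L2K_measurable LM)).
- by move=> q; rewrite lee_fin sqr_ge0.
Qed.

Lemma Opt_le M f : L2K mu mu M -> L2 mu f ->
  ipm mu (Opt M f) (Opt M f) <= hsnorm2 M * ipm mu f f.
Proof.
move=> LM Lf; have [_ H] := kernel_op_L2 (L2K_tr LM) Lf.
by rewrite -(hsnorm2_tr LM); exact: H.
Qed.

(** By Cauchy-Schwarz the Gram kernel is dominated by the tensor square of u |-> |M_u|, which is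
    square integrable. *)
Lemma gram1_L2sec M : L2sec M -> L2sec (gram1 M).
Proof.
move=> [LM sM]; have iN := integrable_section LM.
have mN : measurable_fun setT (fun u => ipm mu (M u) (M u)).
  by apply/measurable_EFinP; case/integrableP : iN.
pose n u := Num.sqrt (ipm mu (M u) (M u)).
have Ln : L2 mu n.
  split.
    by apply: measurableT_comp mN; apply: continuous_measurable_fun; exact: sqrt_continuous.
  by apply: eq_integrable iN => // u _ /=; rewrite sqr_sqrtr// ip_ge0.
split; last first.
  move=> u; have [H _] := kernel_op_L2 LM (sM u).
  by apply: eq_L2 H => v; rewrite ipC.
apply: (L2_le _ (L2_tensor Ln Ln)).
  apply: (@measurable_Rintegral2 _ _ _ _ _ mu (fun (q : T * T) z => M q.1 z * M q.2 z)).
  have mM := L2K_measurable LM.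
  by apply: measurable_funM; [have := measurableT_comp mM (@measurable_fun_pair _ _ _ (T * T * T)%type T T (fun q => q.1.1) (fun q => q.2) _ _)
   |have := measurableT_comp mM (@measurable_fun_pair _ _ _ (T * T * T)%type T T (fun q => q.1.2) (fun q => q.2) _ _)];
   apply => //; exact: measurableT_comp.
move=> [u v] /=; rewrite /gram1 /n -sqrtrM ?ip_ge0// [leRHS]ger0_norm ?sqrtr_ge0//.
by rewrite -sqrtr_sqr ler_sqrt ?ip_CS// mulr_ge0// ip_ge0.
Qed.

Lemma Op_gram1 M f g : L2sec M -> L2 mu f -> L2 mu g ->
  ipm mu (Op mu (gram1 M) f) g = ipm mu (Opt M f) (Opt M g).
Proof.
move=> [LM sM] Lf Lg.
have -> : Op mu (gram1 M) f = (fun u => ipm mu (M u) (Opt M f)).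
  apply/funext => u; rewrite /Op ipC; have := adjoint LM Lf (sM u).
  rewrite /gram1 /Opt /ipm => H.
  transitivity (\int[mu]_x (f x * \int[mu]_y (M x y * M u y))).
    by apply: eq_Rintegral => v _; congr (_ * _); apply: eq_Rintegral => z _; rewrite mulrC.
  exact: H.
have LO := L2_Opt LM Lf.
rewrite ipC [LHS](adjoint LM Lg LO).
by apply: eq_Rintegral => z _; congr (_ * _); apply: eq_Rintegral => u _; rewrite mulrC.
Qed.

Variable r : seq nat.
Implicit Type F : nat -> T -> T -> R.

Definition gram F : T -> T -> R := fun u v => \sum_(i <- r) gram1 (F i) u v.

Lemma Op_gram F f g : (forall i, L2sec (F i)) -> L2 mu f -> L2 mu g ->
  ipm mu (Op mu (gram F) f) g = \sum_(i <- r) ipm mu (Opt (F i) f) (Opt (F i) g).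
Proof.
move=> LF Lf Lg.
have -> : Op mu (gram F) f = (fun u => \sum_(i <- r) Op mu (gram1 (F i)) f u).
  apply/funext => u; rewrite /Op /gram ip_suml// => i.
  by have [_] := gram1_L2sec (LF i).
rewrite ip_suml//; first by apply: eq_bigr => i _; rewrite Op_gram1.
by move=> i; apply: L2_Op => //; have [] := gram1_L2sec (LF i).
Qed.

Lemma gram_psd F : (forall i, L2sec (F i)) -> psd_kernel mu (gram F).
Proof.
move=> LF; have LG i := gram1_L2sec (LF i); split.
- by apply: (@L2_sum _ _ _ _ _ _ (fun i (q : T * T) => gram1 (F i) q.1 q.2)) => i; case: (LG i).
- by move=> u; apply: L2_sum => i; case: (LG i).
- by move=> u v; apply: eq_bigr => i _; exact: ipC.
- by move=> f Lf; rewrite Op_gram// sumr_ge0// => i _; exact: ip_ge0.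
Qed.

(** Term by term, the adjoint of F i is split into that of G i and that of F i - G i, and |x + y|^2
    <= 2 |x|^2 + 2 |y|^2. *)
Lemma gram_form_le F G f : (forall i, L2sec (F i)) -> (forall i, L2sec (G i)) ->
  L2 mu f ->
  ipm mu (Op mu (gram F) f) f <= 2 * ipm mu (Op mu (gram G) f) f +
   2 * (\sum_(i <- r) hsnorm2 (fun u v => F i u v - G i u v)) * ipm mu f f.
Proof.
move=> LF LG Lf; rewrite !Op_gram// mulr_sumr -mulrA mulr_suml mulr_sumr -big_split/=.
apply: ler_sum => i _.
have [LFi _] := LF i; have [LGi _] := LG i.
have LFG : L2K mu mu (fun u v => F i u v - G i u v) by exact: L2B.
have LOF := L2_Opt LFi Lf; have LOG := L2_Opt LGi Lf; have LOD := L2_Opt LFG Lf.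
(* The splitting holds only almost everywhere, since the columns of a square integrable kernel are
   square integrable for almost every z. *)
have E : {ae mu, forall z, Opt (F i) f z =
    Opt (G i) f z + Opt (fun u v => F i u v - G i u v) f z}.
  have := ae_L2_section (L2K_tr LFi); have := ae_L2_section (L2K_tr LGi).
  by apply: filterS2 => z LGz LFz; rewrite /Opt ipBl// addrC subrK.
have LS := L2D LOG LOD.
rewrite (eq_ip_ae LOF LS LOF E) ipC (eq_ip_ae LOF LS LS E).
apply: le_trans (ip_add_le LOG LOD) _.
by rewrite lerD2l ler_pM2l//; exact: Opt_le.
Qed.

Lemma eigen_span_form_ge k n (phi : 'I_n -> T -> R) (th a : 'I_n -> R) c :
  psd_kernel mu k -> orthonormal_fun mu phi ->
  (forall i, c <= th i /\ eigenfun mu k (th i) (phi i)) -> \sum_i a i ^+ 2 = 1 ->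
  c <= ipm mu (Op mu k (fun x => \sum_i a i * phi i x)) (fun x => \sum_i a i * phi i x).
Proof.
move=> pk ophi ephi a1.
have Lphi i : L2 mu (phi i) by case: (ephi i) => _ [].
have Lf : L2 mu (fun x => \sum_i a i * phi i x) by apply: L2_sum => i; exact: L2Z.
have LOf := L2_Op (psd_L2K pk) Lf.
rewrite ip_sumr//; last by move=> i; exact: L2Z.
rewrite (eq_bigr (fun i => th i * a i ^+ 2)).
  rewrite -[c]mulr1 -a1 mulr_sumr; apply: ler_sum => i _.
  by rewrite ler_wpM2r ?sqr_ge0//; case: (ephi i).
move=> i _; rewrite ipZr//.
rewrite (ip_Op_eigen pk (th := th) (phi := phi))//; last by move=> l; case: (ephi l).
rewrite ip_suml//; last by move=> l; exact: L2Z.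
rewrite (bigD1 i)//= big1 => [|l li]; first by rewrite ipZl// ophi eqxx mulr1 addr0; ring.
by rewrite ipZl// ophi (negbTE li) mulr0.
Qed.

(* Weyl-type perturbation: only the size of the quadratic forms is compared. *)
Lemma gram_eigen_count F G (m : nat) (phi : 'I_m -> T -> R) (th : 'I_m -> R) (c e D : R) :
  (forall i, L2sec (F i)) -> (forall i, L2sec (G i)) ->
  orthonormal_fun mu phi ->
  (forall i, c <= th i /\ eigenfun mu (gram F) (th i) (phi i)) ->
  ~ has_eigenfuns mu (fun t => 0 < t) (gram F) m.+1 ->
  0 < c -> 0 < e ->
  \sum_(i <- r) hsnorm2 (fun u v => G i u v - F i u v) <= D ->
  2 * D < e -> e <= c / 2 - D ->
  has_eigenfuns mu (fun t => e <= t) (gram G) m /\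
  ~ has_eigenfuns mu (fun t => e <= t) (gram G) m.+1.
Proof.
move=> LF LG ophi ephi nF c0 e0 HD De ec.
have pF := gram_psd LF; have pG := gram_psd LG.
have Lphi i : L2 mu (phi i) by case: (ephi i) => _ [].
have HD' : \sum_(i <- r) hsnorm2 (fun u v => F i u v - G i u v) <= D.
  apply: le_trans HD; rewrite le_eqVlt; apply/orP; left; apply/eqP.
  apply: eq_bigr => i _; apply: eq_Rintegral => q _ /=; ring.
split.
- suff H j : (j <= m)%N -> has_eigenfuns mu (fun t => e <= t) (gram G) j by exact: H.
  elim: j => [_|j IH jm].
    by exists (fun _ _ => 0), (fun _ => 0); split; case.
  have [psi [ze [opsi epsi]]] := IH (ltnW jm).
  have [a [a1 apsi]] := orthogonal_combination (fun i l => ipm mu (phi i) (psi l)) jm.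
  pose f x := \sum_i a i * phi i x.
  have Lf : L2 mu f by apply: L2_sum => i; exact: L2Z.
  have f1 : ipm mu f f = 1 by rewrite ip_norm_sumsq.
  have Lpsi l : L2 mu (psi l) by case: (epsi l) => _ [].
  have fpsi l : ipm mu (psi l) f = 0.
    rewrite ipC ip_suml//; last by move=> i; exact: L2Z.
    by rewrite -[RHS](apsi l); apply: eq_bigr => i _; rewrite ipZl.
  have Ff : c <= ipm mu (Op mu (gram F) f) f by exact: eigen_span_form_ge pF ophi ephi a1.
  have eG : e <= ipm mu (Op mu (gram G) f) f.
    have aux x y z : c <= y -> x <= D -> y <= 2 * z + 2 * x * 1 -> e <= z by lra.
    by have := gram_form_le LF LG Lf; rewrite f1; exact: aux.
  have epsi' l : eigenfun mu (gram G) (ze l) (psi l) by case: (epsi l).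
  have [h [l [h1 [el [eh hpsi]]]]] := eigen_extension pG opsi epsi' Lf f1 fpsi e0 eG.
  exact: (has_eigenfunsS opsi epsi el h1 eh hpsi).
- move=> [psi [ze [opsi epsi]]].
  have [a [a1 aphi]] := orthogonal_combination (fun i l => ipm mu (psi i) (phi l)) (ltnSn m).
  pose f x := \sum_i a i * psi i x.
  have Lpsi l : L2 mu (psi l) by case: (epsi l) => _ [].
  have Lf : L2 mu f by apply: L2_sum => i; exact: L2Z.
  have f1 : ipm mu f f = 1 by rewrite ip_norm_sumsq.
  have fphi l : ipm mu (phi l) f = 0.
    rewrite ipC ip_suml//; last by move=> i; exact: L2Z.
    by rewrite -[RHS](aphi l); apply: eq_bigr => i _; rewrite ipZl.
  have Gf : e <= ipm mu (Op mu (gram G) f) f by exact: eigen_span_form_ge pG opsi epsi a1.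
  have F0 : 0 < ipm mu (Op mu (gram F) f) f.
    have aux x y z : e <= y -> x <= D -> y <= 2 * z + 2 * x * 1 -> 0 < z by lra.
    by have := gram_form_le LG LF Lf; rewrite f1; exact: aux.
  have ephi' i : eigenfun mu (gram F) (th i) (phi i) by case: (ephi i).
  have [h [l [h1 [el [eh hphi]]]]] := eigen_extension pF ophi ephi' Lf f1 fphi F0 (lexx _).
  apply: nF; apply: (has_eigenfunsS (th := th) ophi _ _ h1 eh hphi) => [i|].
    by case: (ephi i) => ci ei; split => //; exact: (lt_le_trans c0 ci).
  exact: (lt_le_trans F0 el).
Qed.

End GramKernels.

(** * Lebesgue measure on the interval as a finite measure on the line *)

Section Interval.
Context (R : realType) (a b : R).

Lemma measurable_Iab : measurable (Iab a b : set (measurableTypeR R)). Proof. exact: measurable_itv. Qed.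

Lemma leb_Iab_lty : (@leb R (Iab a b) < +oo)%E.
Proof.
rewrite /leb /Iab lebesgue_measure_itv; case: ifP => _ //.
by rewrite -EFinD ltry.
Qed.

Lemma measurable_patchI (f : R -> R) : measurable_fun (Iab a b) f ->
  measurable_fun (setT : set (measurableTypeR R)) (f \_ (Iab a b)).
Proof. by move=> mf; apply/(measurable_restrictT _ measurable_Iab). Qed.

Lemma measurable_patchIT (f : R -> R) : measurable_fun setT f ->
  measurable_fun (setT : set (measurableTypeR R)) (f \_ (Iab a b)).
Proof. by move=> mf; apply: measurable_patchI; exact: measurable_funTS. Qed.

(** The measure lives on the whole line, so that integrals run over [setT] and the general L2 theory
    applies without tracking a domain. *)
Definition muI : {finite_measure set (measurableTypeR R) -> \bar R} :=
  mfrestr measurable_Iab leb_Iab_lty.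

#[global] Instance muI_ae_filter : Filter (nbhs (almost_everywhere muI)) :=
  ae_filter_ringOfSetsType muI.

Lemma muIE (A : set R) : muI A = leb (A `&` Iab a b).
Proof. by []. Qed.

Lemma ae_muI (Q : R -> Prop) :
  {ae muI, forall u, Q u} <-> {ae @leb R, forall u, Iab a b u -> Q u}.
Proof.
split.
- move=> [N [mN N0 QN]]; exists (N `&` Iab a b); split => //.
  + by apply: measurableI => //; exact: measurable_Iab.
  + move=> u /= Hu; have Iu : Iab a b u by apply: contrapT => nI; apply: Hu.
    by split => //; apply: QN => /= Qu; apply: Hu.
- move=> [N [mN N0 QN]]; exists (N `|` ~` Iab a b); split => //.
  + by apply: measurableU => //; apply: measurableC; exact: measurable_Iab.
  + rewrite muIE setIUl setICl setU0; apply/eqP; rewrite eq_le /leb measure_ge0 andbT.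
    rewrite -[leRHS]N0; apply: le_measure; rewrite ?inE//.
    by apply: measurableI => //; exact: measurable_Iab.
  + move=> u /= Hu; have [Iu|] := pselect (Iab a b u); last by right.
    by left; apply: QN => /= H; apply: Hu; exact: H.
Qed.

Lemma integral_muI (f : R -> \bar R) : measurable_fun setT f ->
  (\int[muI]_x f x = \int[@leb R]_(x in Iab a b) f x)%E.
Proof.
move=> mf; have mI := measurable_Iab.
have <- : (\int[muI]_(x in Iab a b) f x = \int[@leb R]_(x in Iab a b) f x)%E.
  rewrite /leb; apply: eq_measure_integral => A mA AI.
  by rewrite [LHS]muIE setIidl.
rewrite [RHS]integral_mkcond; apply: ae_eq_integral => //.
- by apply/(measurable_restrictT _ mI); exact: measurable_funTS.
- apply/ae_muI; apply: aeW => u Iu _ /=.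
  by rewrite patchE mem_set.
Qed.

Lemma Rintegral_muI (f : R -> R) : measurable_fun setT f ->
  \int[muI]_x f x = \int[@leb R]_(x in Iab a b) f x.
Proof. by move=> mf; congr fine; rewrite integral_muI//; exact/measurable_EFinP. Qed.

Lemma L2_sq_int (f : R -> R) : L2 muI f -> sq_int a b f.
Proof.
move=> Lf; have mf := L2_measurable Lf; split; first exact: measurable_funTS.
rewrite -integral_muI; first exact: L2_lty.
exact/measurable_EFinP/measurable_funX.
Qed.

Lemma sq_int_L2 (f : R -> R) : sq_int a b f -> L2 muI (f \_ (Iab a b)).
Proof.
move=> [mf fi]; have mI := measurable_Iab.
have mf' : measurable_fun setT (f \_ (Iab a b)) by apply/(measurable_restrictT _ mI).
apply: L2P => //; rewrite integral_muI; last first.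
  exact/measurable_EFinP/measurable_funX.
rewrite (_ : integral _ _ _ = \int[@leb R]_(x in Iab a b) (f x ^+ 2)%:E)%E//.
by apply: eq_integral => x xI; rewrite patchE xI.
Qed.

Lemma ip_muI (f g : R -> R) : measurable_fun (Iab a b) f -> measurable_fun (Iab a b) g ->
  ip a b f g = ipm muI (f \_ (Iab a b)) (g \_ (Iab a b)).
Proof.
move=> mf mg; have mI := measurable_Iab; rewrite /ipm Rintegral_muI.
  by apply: eq_Rintegral => x xI; rewrite !patchE xI.
by apply: measurable_funM; apply/(measurable_restrictT _ mI).
Qed.

Lemma ip_muIT (f g : R -> R) : measurable_fun setT f -> measurable_fun setT g ->
  ip a b f g = ipm muI f g.
Proof. by move=> mf mg; rewrite /ipm Rintegral_muI//; exact: measurable_funM. Qed.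

(** The eigenvalue equation is required almost everywhere, so kernels whose sections agree almost
    everywhere have the same eigenfunctions. Functions known to be measurable on the interval only
    are extended by 0. *)
Lemma has_eigs_muI (Q : R -> Prop) (k k' : R -> R -> R) m :
  (forall u, measurable_fun setT (k u)) -> (forall u, measurable_fun setT (k' u)) ->
  {ae muI, forall u, {ae muI, forall v, k u v = k' u v}} ->
  has_eigs a b Q k m <-> has_eigenfuns muI Q k' m.
Proof.
move=> mk mk' kk'; have mI := measurable_Iab.
have K_Op f : measurable_fun (Iab a b) f ->
    {ae muI, forall u, Kop a b k f u = Op muI k' (f \_ (Iab a b)) u}.
  move=> mf; have mfI : measurable_fun setT (f \_ (Iab a b)).
    by apply/(measurable_restrictT _ mI).
  apply: filterS kk' => u ku.
  rewrite /Kop -/(ip a b (k u) f) ip_muI//; last exact: measurable_funTS.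
  congr fine; apply: ae_eq_integral => //.
  - by apply/measurable_EFinP/measurable_funM => //; exact: measurable_patchIT.
  - by apply/measurable_EFinP/measurable_funM; [exact: mk'|exact: mfI].
  - have : {ae muI, forall v, Iab a b v} by apply/ae_muI; exact: aeW.
    by move: ku; apply: filterS2 => v kv Iv _; rewrite !patchE mem_set// kv.
split=> -[phi [th [ophi ephi]]].
- exists (fun i => phi i \_ (Iab a b)), th; split.
    by move=> i j; rewrite -ip_muI ?ophi//; case: (ephi i) (ephi j) => _ [[? _] _] [_ [[? _] _]].
  move=> i; have [Qi [si ei]] := ephi i; split => //; split; first exact: sq_int_L2.
  move/ae_muI : ei; have := K_Op _ si.1.
  have : {ae muI, forall v, Iab a b v} by apply/ae_muI; exact: aeW.
  by apply: filterS3 => u Iu <- ->; rewrite patchE mem_set.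
- exists phi, th; split.
    by move=> i j; rewrite ip_muIT ?ophi//; case: (ephi i) (ephi j) => _ [[? _] _] [_ [[? _] _]].
  move=> i; have [Qi [Li ei]] := ephi i; have mi := L2_measurable Li.
  split => //; split; first exact: L2_sq_int.
  apply/ae_muI; move: ei; have := K_Op _ (measurable_funTS (mi : measurable_fun setT _)).
  apply: filterS2 => u -> <-; apply: (congr1 fine); apply: ae_eq_integral => //.
  + by apply/measurable_EFinP/measurable_funM; [exact: mk'|exact: (measurable_patchIT mi)].
  + by apply/measurable_EFinP/measurable_funM; [exact: mk'|exact: mi].
  + have : {ae muI, forall v, Iab a b v} by apply/ae_muI; exact: aeW.
    by apply: filterS => v Iv _; rewrite patchE mem_set.
Qed.

End Interval.

(** * From kernels close in mean square to equal eigenvalue counts *)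

Section Consistency.
Context (R : realType) (a b : R).
Local Notation mu := (muI a b).
Implicit Types M : R -> R -> R.

Let finite_section M := [set u : measurableTypeR R | (\int[mu]_v (M u v ^+ 2)%:E < +oo)%E].

(** A kernel in L2 of the square has square integrable sections only for almost every u. Putting the
    other sections to 0 yields [L2sec] without changing any eigenvalue count. *)
Let cut M : R -> R -> R := fun u v => \1_(finite_section M) u * M u v.

Let cutE M u v : finite_section M u -> cut M u v = M u v.
Proof. by move=> Mu; rewrite /cut indicE mem_set// mul1r. Qed.

Let measurable_int2 M : L2K mu mu M ->
  measurable_fun setT (fun u => \int[mu]_v (M u v ^+ 2)%:E)%E.
Proof.
move=> LM; apply: (@measurable_integral2 _ _ _ _ _ mu (fun u v => (M u v ^+ 2)%:E)).
  by move=> u v; rewrite lee_fin sqr_ge0.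
exact: (measurable_sqrE (L2K_measurable LM)).
Qed.

Let cut_L2sec M : L2K mu mu M -> L2sec mu (cut M).
Proof.
move=> LM; have mM := L2K_measurable LM.
have mG : measurable (finite_section M).
  have := emeasurable_fun_infty_o measurableT (measurable_int2 LM) +oo%E.
  by rewrite setTI.
have mc : measurable_fun setT (fun q : measurableTypeR R * measurableTypeR R => cut M q.1 q.2).
  by apply: measurable_funM => //; apply: measurableT_comp => //; exact: measurable_indic.
split.
  apply: (L2_le mc LM) => -[u v] /=; rewrite /cut indicE.
  by case: (_ \in _); rewrite ?mul1r ?mul0r// normr0.
move=> u; rewrite /cut; have [uG|uG] := pselect (finite_section M u).
  apply: L2Z; apply: L2P => //; exact: (measurable_section _ mM).
by apply: eq_L2 (L20 _) => v; rewrite indicE memNset// mul0r.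
Qed.

Let ae_finite_section M : L2K mu mu M -> {ae mu, forall u, finite_section M u}.
Proof. by move=> LM; have := ae_L2_section LM; apply: filterS => u /L2_lty. Qed.

Let K (p : nat) (F : nat -> R -> R -> R) : R -> R -> R :=
  fun u v => \sum_(1 <= k < p.+1) \int[@leb R]_(z in Iab a b) (F k u z * F k v z).

Let K_gram p F : (forall i, L2K mu mu (F i)) -> K p F = gram mu (index_iota 1 p.+1) F.
Proof.
move=> LF; apply/funext => u; apply/funext => v; apply: eq_bigr => i _.
rewrite /gram1 /ipm Rintegral_muI//.
by apply: measurable_funM; exact: (measurable_section _ (L2K_measurable (LF i))).
Qed.

Let gram_sec p F u : (forall i, L2K mu mu (F i)) ->
  measurable_fun setT (gram mu (index_iota 1 p.+1) F u).
Proof.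
move=> LF; apply: measurable_sum => i.
have mF := L2K_measurable (LF i).
apply: (@measurable_Rintegral2 _ _ _ _ _ mu (fun v z => F i u z * F i v z)).
apply: measurable_funM => //.
exact: (measurableT_comp (measurable_section u mF)).
Qed.

(** Here [c] is a lower bound of the d positive eigenvalues, and [delta] bounds each squared error,
    so that p * delta bounds their sum. The last two conditions on [e] are those of
    [gram_eigen_count] with D = p * delta. *)
Lemma eig_count_consistent p d (M : nat -> R -> R -> R) :
  (forall i, L2K mu mu (M i)) -> C3_eig a b (K p M) d ->
  exists2 c, 0 < c & forall (Mh : nat -> R -> R -> R) (e delta : R),
    (forall i, L2sec mu (Mh i)) -> 0 < e ->
    (forall i, (1 <= i <= p)%N ->
      (\int[mu]_u \int[mu]_v ((Mh i u v - M i u v) ^+ 2)%:E <= delta%:E)%E) ->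
    2 * (p%:R * delta) < e -> e <= c / 2 - p%:R * delta ->
    eig_count a b (fun t => e <= t) (K p Mh) d.
Proof.
move=> LM [[phi [th [ophi [ephi dth]]]] nK].
pose r := index_iota 1 p.+1; pose M' i := cut (M i).
have LM' i : L2sec mu (M' i) by exact: cut_L2sec.
have aeG : {ae mu, forall u, forall i, finite_section (M i) u}.
  by apply: ae_foralln => i; exact: ae_finite_section.
have bridge Q m : has_eigs a b Q (K p M) m <-> has_eigenfuns mu Q (gram mu r M') m.
  rewrite K_gram//; apply: has_eigs_muI.
  - by move=> u; exact: gram_sec.
  - by move=> u; apply: gram_sec => i; case: (LM' i).
  - have := aeG; apply: filterS => u Gu; have := aeG; apply: filterS => v Gv.
    apply: eq_bigr => i _; apply: eq_Rintegral => z _.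
    by rewrite /M' !cutE.
(* The smallest eigenvalue is the last one, as they decrease strictly; for d = 0 any positive number
   does. *)
have [c c0 cth] : exists2 c, 0 < c & forall i, c <= th i.
  case: d phi th ophi ephi dth nK => [|d] phi th _ ephi dth _; first by exists 1 => // -[].
  exists (th ord_max); first by case: (ephi ord_max).
  move=> i; have [->//|im] := eqVneq i ord_max; apply/ltW/dth.
  by rewrite ltn_neqAle -ltnS ltn_ord andbT; apply: contra im => /eqP im; apply/eqP/val_inj.
have [psi [ze [opsi epsi]]] : has_eigenfuns mu (fun t => c <= t) (gram mu r M') d.
  apply/bridge; exists phi, th; split => // i; split; first exact: cth.
  by case: (ephi i).
have nF : ~ has_eigenfuns mu (fun t => 0 < t) (gram mu r M') d.+1 by move/bridge.
exists c; [exact: c0|move=> Mh e delta LMh e0 Hd de ec].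
have bridgeh Q m : has_eigs a b Q (K p Mh) m <-> has_eigenfuns mu Q (gram mu r Mh) m.
  rewrite K_gram; last by move=> i; case: (LMh i).
  apply: has_eigs_muI.
  - by move=> u; apply: gram_sec => i; case: (LMh i).
  - by move=> u; apply: gram_sec => i; case: (LMh i).
  - by apply: aeW => u; exact: aeW.
have HD : \sum_(i <- r) hsnorm2 mu (fun u v => Mh i u v - M' i u v) <= p%:R * delta.
  rewrite (_ : p%:R * delta = \sum_(i <- r) delta); last first.
    by rewrite big_const_seq count_predT size_iota subSS subn0 iter_addr_0 mulr_natl.
  rewrite [leLHS]big_seq [leRHS]big_seq.
  apply: ler_sum => i; rewrite mem_index_iota => ip; have [L1 _] := LMh i; have [L2' _] := LM' i.
  have LD : L2K mu mu (fun u v => Mh i u v - M' i u v) by exact: (L2B L1 L2').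
  have LD' : L2K mu mu (fun u v => Mh i u v - M i u v) by exact: (L2B L1 (LM i)).
  rewrite -lee_fin (L2KE LD); apply: le_trans (Hd i ip).
  rewrite le_eqVlt; apply/orP; left; apply/eqP; apply: ae_eq_integral => //.
  - exact: measurable_int2.
  - exact: measurable_int2.
  - apply: filterS aeG => u Gu _; apply: eq_integral => v _.
    by rewrite /M' cutE.
have [H1 H2] := gram_eigen_count (fun i => cut_L2sec (LM i)) LMh opsi epsi nF c0 e0 HD de ec.
by split; [apply/bridgeh|move/bridgeh].
Qed.

End Consistency.

(** * Covariance inequality under psi-mixing *)

Section Comparison.
Context d (T : measurableType d) (R : realType) (P : probability T R).
Implicit Types (f g h U V : T -> R).
Local Notation E f := (\int[P]_w f w).

Lemma dominated_cvgR (F : nat -> T -> R) f g :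
  (forall n, measurable_fun setT (F n)) -> measurable_fun setT f ->
  {ae P, forall w, F n w @[n --> \oo] --> f w} ->
  P.-integrable setT (EFin \o g) -> (forall n w, `|F n w| <= g w) ->
  E (F n) @[n --> \oo] --> E f.
Proof.
move=> mF mf Ff ig Fg.
have [|||||if_ _ C] := @dominated_convergence _ _ _ P setT measurableT
  (fun n w => (F n w)%:E) (EFin \o f) (EFin \o g).
- by move=> n; exact/measurable_EFinP.
- exact/measurable_EFinP.
- by apply: filterS Ff => w Fw _; apply: cvg_EFin; [near=> n|exact: Fw].
- exact: ig.
- by apply: aeW => w n _; rewrite lee_fin.
apply: fine_cvg; rewrite fineK; first exact: C.
exact: integrable_fin_num.
Unshelve. all: by end_near. Qed.

Lemma integrable_bounded f N : measurable_fun setT f -> (forall w, `|f w| <= N) ->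
  P.-integrable setT (EFin \o f).
Proof.
move=> mf fN; apply: (@integrable_le _ _ _ P f (cst N)) => //.
exact: finite_measure_integrable_cst.
Qed.

Lemma integrable_mul_bounded f g N : P.-integrable setT (EFin \o f) ->
  measurable_fun setT g -> (forall w, `|g w| <= N) ->
  P.-integrable setT (EFin \o (fun w => f w * g w)).
Proof.
move=> fi mg gN.
have mf : measurable_fun setT f by apply/measurable_EFinP; case/integrableP: fi.
apply: (@integrable_le _ _ _ P _ (fun w => N * `|f w|)).
- exact: measurable_funM.
- by apply: integrable_scaleR; exact: integrable_norm.
- by move=> w; rewrite normrM mulrC ler_wpM2r.
Qed.

Lemma Rintegral_sum n (F : 'I_n -> T -> R) :
  (forall i, P.-integrable setT (EFin \o F i)) ->
  E (fun w => \sum_(i < n) F i w) = \sum_(i < n) E (F i).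
Proof.
move=> iF; suff : P.-integrable setT (EFin \o (fun w => \sum_(i <- index_enum 'I_n) F i w)) /\
  E (fun w => \sum_(i <- index_enum 'I_n) F i w) = \sum_(i <- index_enum 'I_n) E (F i) by case.
elim: (index_enum 'I_n) => [|i r [IH1 IH2]].
  under eq_fun do rewrite big_nil; rewrite big_nil; split.
    exact: (integrable0 P).
  by rewrite /Rintegral integral0.
under eq_fun do rewrite big_cons; rewrite big_cons; split.
  exact: integrable_addR.
by rewrite RintegralD// IH2.
Qed.

(** The sum is the integer part of x, counted as the number of positive integers up to x. *)
Lemma count_le (n : nat) (x : R) : 0 <= x <= n%:R ->
  x - 1 <= \sum_(i < n) (i.+1%:R <= x :> R)%:R <= x.
Proof.
elim: n x => [|n IH] x.
  move=> /andP[x0 x1]; rewrite big_ord0 (_ : x = 0) ?lexx ?sub0r ?oppr_le0 ?ler01//.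
  by apply/eqP; rewrite eq_le x0 x1.
move=> /andP[x0 x1]; rewrite big_ord_recr/=.
have [xn|nx] := leP x n%:R.
  rewrite (_ : (n.+1%:R <= x) = false) ?addr0; first by apply: IH; rewrite x0.
  by apply/negbTE; rewrite -ltNge (le_lt_trans xn)// ltr_nat.
rewrite (eq_bigr (fun=> 1)) => [|i _]; last first.
  by rewrite (_ : (_ <= x) = true)//; apply/ltW/(le_lt_trans _ nx); rewrite ler_nat.
rewrite sumr_const card_ord; move: x1; rewrite -natr1 => x1.
by case: (leP (n%:R + 1) x) => H /=; apply/andP; split; lra.
Qed.

(* A comparison of set functions extends to bounded functions, which are uniform
   limits of the step functions (N/n) * sum_(i=1..n) 1_(f >= i N / n). *)
Lemma Rintegral_comparison (g h : T -> R) (U V : T -> R) (f : R -> R) N :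
  P.-integrable setT (EFin \o g) -> P.-integrable setT (EFin \o h) ->
  measurable_fun setT U -> measurable_fun setT V ->
  (forall A, measurable A -> E (fun w => g w * \1_A (U w)) <= E (fun w => h w * \1_A (V w))) ->
  measurable_fun setT f -> (forall x, 0 <= f x <= N) ->
  E (fun w => g w * f (U w)) <= E (fun w => h w * f (V w)).
Proof.
move=> ig ih mU mV H mf fN.
have N0 : 0 <= N by have /andP[p0 p1] := fN 0; exact: le_trans p0 p1.
have [N00|Nn0] := eqVneq N 0.
  have f0 x : f x = 0.
    by have := fN x; rewrite N00 => /andP[? ?]; apply/eqP; rewrite eq_le; apply/andP.
  by rewrite /Rintegral; under eq_integral do rewrite f0 mulr0;
    under [in leRHS]eq_integral do rewrite f0 mulr0; rewrite integral0.
have Np : 0 < N by rewrite lt_neqAle eq_sym Nn0.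
pose A n i := [set x | i.+1%:R <= n%:R / N * f x] : set R.
have mA n i : measurable (A n i).
  have := measurable_fun_ler (@measurable_cst _ _ R R setT i.+1%:R)
    (measurable_funM (@measurable_cst _ _ R R setT (n%:R / N)) mf).
  by move=> /(_ measurableT [set true]); rewrite setTI; apply.
pose s n x : R := N / n%:R * \sum_(i < n) \1_(A n i) x.
have ms n : measurable_fun setT (s n).
  apply: measurable_funM => //; apply: measurable_sum => i.
  exact: measurable_indic.
have sf n x : (0 < n)%N -> `|f x - s n x| <= N / n%:R.
  move=> n0; have n0' : 0 < n%:R :> R by rewrite ltr0n.
  have := @count_le n (n%:R / N * f x) _.
  have -> : \sum_(i < n) (i.+1%:R <= n%:R / N * f x :> R)%:R = \sum_(i < n) \1_(A n i) x :> R.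
    apply: eq_bigr => i _; rewrite indicE; congr ((nat_of_bool _)%:R).
    by apply/idP/idP; rewrite inE.
  set S := \sum_(i < n) _ => SS.
  have /andP[S1 S2] : n%:R / N * f x - 1 <= S <= n%:R / N * f x.
    apply: SS; have /andP[f0 f1] := fN x; apply/andP; split.
      by rewrite mulr_ge0// divr_ge0// ltW.
    by rewrite mulrAC ler_pdivrMr// ler_wpM2l// ltW.
  rewrite /s -/S; have fE : f x = N / n%:R * (n%:R / N * f x).
    by field; rewrite Nn0 gt_eqF.
  have Nn : 0 < N / n%:R by rewrite divr_gt0.
  rewrite {1}fE -mulrBr normrM gtr0_norm// ger_pMr// ler_norml.
  by apply/andP; split; lra.
have bs n x : (0 < n)%N -> `|s n x| <= N + N / n%:R.
  move=> n0; rewrite -[s n x](subrK (f x)) (le_trans (ler_normD _ _))// addrC.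
  rewrite lerD//; last by rewrite distrC; exact: sf.
  by have /andP[? ?] := fN x; rewrite ger0_norm.
have iS g' U' n : (0 < n)%N -> P.-integrable setT (EFin \o g') -> measurable_fun setT U' ->
    P.-integrable setT (EFin \o (fun w => g' w * s n (U' w))).
  move=> n0 ig' mU'; apply: (integrable_mul_bounded (N := N + N / n%:R) ig').
    exact: measurableT_comp.
  by move=> w; exact: bs.
have ifg g' U' : P.-integrable setT (EFin \o g') -> measurable_fun setT U' ->
    P.-integrable setT (EFin \o (fun w => g' w * f (U' w))).
  move=> ig' mU'; apply: (integrable_mul_bounded (N := N) ig').
    exact: measurableT_comp.
  by move=> w; have /andP[? ?] := fN (U' w); rewrite ger0_norm.
have Es g' U' n : (0 < n)%N -> P.-integrable setT (EFin \o g') -> measurable_fun setT U' ->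
    E (fun w => g' w * s n (U' w)) =
    N / n%:R * \sum_(i < n) E (fun w => g' w * \1_(A n i) (U' w)).
  move=> n0 ig' mU'.
  have iA i : P.-integrable setT (EFin \o (fun w => g' w * \1_(A n i) (U' w))).
    apply: (integrable_mul_bounded (N := 1) ig').
      by apply: measurableT_comp => //; exact: measurable_indic.
    by move=> w; rewrite indicE; case: (_ \in _); rewrite ?normr1 ?normr0.
  rewrite -Rintegral_sum// -RintegralZl//; last first.
    suff : P.-integrable setT (EFin \o (fun w => (N / n%:R)^-1 * (g' w * s n (U' w)))).
      apply: eq_integrable => // w _ /=; congr EFin; rewrite /s mulrCA mulKf ?mulr_sumr//.
      by rewrite mulf_eq0 invr_eq0 negb_or Nn0 pnatr_eq0 -lt0n.
    by apply: integrable_scaleR; exact: iS.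
  by apply: eq_Rintegral => w _; rewrite /s mulrCA mulr_sumr.
have dist g' U' n : (0 < n)%N -> P.-integrable setT (EFin \o g') -> measurable_fun setT U' ->
    `|E (fun w => g' w * f (U' w)) - E (fun w => g' w * s n (U' w))| <=
    N / n%:R * E (fun w => `|g' w|).
  move=> n0 ig' mU'; rewrite -RintegralB//; [|exact: ifg|exact: iS].
  apply: le_trans (le_normr_Rintegral _ _) _ => //.
    have := integrableB measurableT (ifg _ _ ig' mU') (iS _ _ _ n0 ig' mU').
    by apply: eq_integrable => // w _.
  rewrite -RintegralZl//; last exact: integrable_norm.
  apply: le_Rintegral => //.
  - apply: (integrable_norm (f := fun w => g' w * f (U' w) - g' w * s n (U' w))).
    have := integrableB measurableT (ifg _ _ ig' mU') (iS _ _ _ n0 ig' mU').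
    by apply: eq_integrable => // w _.
  - by apply: integrable_scaleR; exact: integrable_norm.
  - by move=> w _; rewrite -mulrBr normrM mulrC ler_wpM2r//; exact: sf.
have Hs n : (0 < n)%N -> E (fun w => g w * s n (U w)) <= E (fun w => h w * s n (V w)).
  move=> n0; rewrite !Es// ler_wpM2l ?divr_ge0//.
  by apply: ler_sum => i _; apply: H.
apply/ler_addgt0Pr => e e0.
pose S := E (fun w => `|g w|) + E (fun w => `|h w|).
have S0 : 0 <= S by rewrite addr_ge0// Rintegral_ge0.
pose n := (Num.truncn (N * S / e)).+1.
have n0 : 0 < n%:R :> R by rewrite ltr0n.
have nS : N / n%:R * S <= e.
  rewrite mulrAC ler_pdivrMr// -ler_pdivrMl// mulrC.
  exact/ltW/truncnS_gt.
have aux x1 x2 x3 x4 y1 y2 : `|x1 - x2| <= y1 -> `|x3 - x4| <= y2 -> x2 <= x4 ->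
    y1 + y2 <= e -> x1 <= x3 + e.
  by rewrite !ler_norml => /andP[? ?] /andP[? ?]; lra.
apply: (aux _ _ _ _ _ _ (dist g U n isT ig mU) (dist h V n isT ih mV) (Hs n isT)).
by rewrite -mulrDr.
Qed.

(** The psi-mixing inequality with indicators replaced by functions. It is meant for nonnegative F
    and G: the right-hand side is then linear in each of them, so the inequality is stable under
    sums and limits. *)
Definition mix (c : R) (F G : T -> R) :=
  `|E (fun w => F w * G w) - E F * E G| <= c * (E F * E G).

Definition bounded_mfun f := measurable_fun setT f /\ exists N, forall w, 0 <= f w <= N.

Lemma bounded_mfun_integrable f : bounded_mfun f -> P.-integrable setT (EFin \o f).
Proof.
move=> [mf [N fN]]; apply: (integrable_bounded (N := N)) => // w.
by have /andP[? ?] := fN w; rewrite ger0_norm.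
Qed.

Lemma bounded_mfunM f g : bounded_mfun f -> bounded_mfun g ->
  bounded_mfun (fun w => f w * g w).
Proof.
move=> [mf [N fN]] [mg [M gM]]; split; first exact: measurable_funM.
exists (N * M) => w; have /andP[? ?] := fN w; have /andP[? ?] := gM w.
by rewrite mulr_ge0// ler_pM.
Qed.

Lemma mix_sym c F G : mix c F G -> mix c G F.
Proof.
rewrite /mix (mulrC (E G)); congr (`|_ - _| <= _).
by apply: eq_Rintegral => w _; rewrite mulrC.
Qed.

(** For fixed F and G the absolute value amounts to two inequalities that are linear in f(U), and
    each of them is an instance of [Rintegral_comparison]. *)
Lemma mix_ext c F G U (f : R -> R) N : bounded_mfun F -> bounded_mfun G ->
  measurable_fun setT U -> measurable_fun setT f -> (forall x, 0 <= f x <= N) ->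
  (forall A, measurable A -> mix c (fun w => F w * \1_A (U w)) G) ->
  mix c (fun w => F w * f (U w)) G.
Proof.
move=> bF bG mU mf fN H.
have iF := bounded_mfun_integrable bF; have iG := bounded_mfun_integrable bG.
have iFG := bounded_mfun_integrable (bounded_mfunM bF bG).
(* All the weights needed on the two sides have the form x F + y F G. *)
have ext (x y : R) (X : R -> R) : measurable_fun setT X -> (exists M, forall z, 0 <= X z <= M) ->
  E (fun w => (x * F w + y * (F w * G w)) * X (U w)) =
  x * E (fun w => F w * X (U w)) + y * E (fun w => F w * X (U w) * G w).
  move=> mX [M XM]; have bX : bounded_mfun (X \o U).
    by split; [exact: measurableT_comp|exists M => w; exact: XM].
  have i1 := bounded_mfun_integrable (bounded_mfunM bF bX).
  have i2 := bounded_mfun_integrable (bounded_mfunM (bounded_mfunM bF bX) bG).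
  rewrite -!RintegralZl// -RintegralD//; try exact: integrable_scaleR.
  by apply: eq_Rintegral => w _ /=; ring.
have iw x y : P.-integrable setT (EFin \o (fun w => x * F w + y * (F w * G w))).
  by apply: integrable_addR; exact: integrable_scaleR.
have b1 A : measurable A -> measurable_fun setT (\1_A : R -> R) /\
    (exists M : R, forall z, 0 <= (\1_A : R -> R) z <= M).
  move=> mA; split; first exact: measurable_indic.
  by exists 1 => z; rewrite indicE; case: (_ \in _); rewrite ?lexx ?ler01.
have bf : exists M, forall z, 0 <= f z <= M by exists N.
have C1 : E (fun w => (0 * F w + 1 * (F w * G w)) * f (U w)) <=
    E (fun w => ((1 + c) * E G * F w + 0 * (F w * G w)) * f (U w)).
  apply: (Rintegral_comparison (N := N)) => // A mA.
  rewrite !ext; [|by case: (b1 A mA)..].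
  have := H A mA; rewrite /mix ler_norml => /andP[_].
  set x1 := E (fun w => F w * \1_A (U w) * G w).
  set x2 := E (fun w => F w * \1_A (U w)).
  by move: x1 x2 (E G) => x y z; lra.
have C2 : E (fun w => (E G * F w + 0 * (F w * G w)) * f (U w)) <=
    E (fun w => (c * E G * F w + 1 * (F w * G w)) * f (U w)).
  apply: (Rintegral_comparison (N := N)) => // A mA.
  rewrite !ext; [|by case: (b1 A mA)..].
  have := H A mA; rewrite /mix ler_norml => /andP[+ _].
  set x1 := E (fun w => F w * \1_A (U w) * G w).
  set x2 := E (fun w => F w * \1_A (U w)).
  by move: x1 x2 (E G) => x y z; lra.
move: C1 C2; rewrite !ext// /mix ler_norml.
set x1 := E (fun w => F w * f (U w) * G w).
set x2 := E (fun w => F w * f (U w)).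
by move: x1 x2 (E G) => x y z ? ?; apply/andP; split; lra.
Qed.

(** The four indicators are replaced by functions one at a time. *)
Lemma mix4 c (U1 U2 U3 U4 : T -> R) (f1 f2 f3 f4 : R -> R) N :
  measurable_fun setT U1 -> measurable_fun setT U2 ->
  measurable_fun setT U3 -> measurable_fun setT U4 ->
  measurable_fun setT f1 -> measurable_fun setT f2 ->
  measurable_fun setT f3 -> measurable_fun setT f4 ->
  (forall x, 0 <= f1 x <= N) -> (forall x, 0 <= f2 x <= N) ->
  (forall x, 0 <= f3 x <= N) -> (forall x, 0 <= f4 x <= N) ->
  (forall A1 A2 A3 A4, measurable A1 -> measurable A2 -> measurable A3 -> measurable A4 ->
    mix c (fun w => \1_A1 (U1 w) * \1_A2 (U2 w)) (fun w => \1_A3 (U3 w) * \1_A4 (U4 w))) ->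
  mix c (fun w => f1 (U1 w) * f2 (U2 w)) (fun w => f3 (U3 w) * f4 (U4 w)).
Proof.
move=> mU1 mU2 mU3 mU4 mf1 mf2 mf3 mf4 b1 b2 b3 b4 H.
have bI A U : measurable A -> measurable_fun setT U -> bounded_mfun (fun w => \1_A (U w)).
  move=> mA mU; split; first by apply: measurableT_comp => //; exact: measurable_indic.
  by exists 1 => z; rewrite indicE; case: (_ \in _); rewrite ?lexx ?ler01.
have bf (f : R -> R) U : measurable_fun setT f -> (forall x, 0 <= f x <= N) ->
    measurable_fun setT U -> bounded_mfun (fun w => f (U w)).
  by move=> mf fN mU; split; [exact: measurableT_comp|exists N].
have swap c' F F' G : mix c' (fun w => F w * F' w) G -> mix c' (fun w => F' w * F w) G.
  by rewrite (_ : (fun w => F w * F' w) = (fun w => F' w * F w))//;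
    apply/funext => w; rewrite mulrC.
have H1 A2 A3 A4 : measurable A2 -> measurable A3 -> measurable A4 ->
    mix c (fun w => f1 (U1 w) * \1_A2 (U2 w)) (fun w => \1_A3 (U3 w) * \1_A4 (U4 w)).
  move=> m2 m3 m4; apply: (swap); apply: (mix_ext (N := N)) => //; first exact: bI.
    by apply: bounded_mfunM; exact: bI.
  by move=> A mA; apply: (swap); exact: H.
have H2 A3 A4 : measurable A3 -> measurable A4 ->
    mix c (fun w => f1 (U1 w) * f2 (U2 w)) (fun w => \1_A3 (U3 w) * \1_A4 (U4 w)).
  move=> m3 m4; apply: (mix_ext (N := N)) => //; first exact: bf.
    by apply: bounded_mfunM; exact: bI.
  by move=> A mA; exact: H1.
have b12 : bounded_mfun (fun w => f1 (U1 w) * f2 (U2 w)) by apply: bounded_mfunM; exact: bf.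
have H3 A4 : measurable A4 ->
    mix c (fun w => f1 (U1 w) * f2 (U2 w)) (fun w => f3 (U3 w) * \1_A4 (U4 w)).
  move=> m4; apply: mix_sym; apply: (swap); apply: (mix_ext (N := N)) => //; first exact: bI.
  by move=> A mA; apply: (swap); apply: mix_sym; exact: H2.
apply: mix_sym; apply: (mix_ext (N := N)) => //; first exact: bf.
by move=> A mA; apply: mix_sym; exact: H3.
Qed.

Lemma L2_integrable f : L2 P f -> P.-integrable setT (EFin \o f).
Proof.
move=> Lf; have L1 : L2 P (cst 1).
  split => //; have := finite_measure_integrable_cst P (1:R) (@measurableT _ T).
  by apply: eq_integrable => // w _ /=; rewrite expr1n.
by have := L2_mul Lf L1; apply: eq_integrable => // w _ /=; rewrite mulr1.
Qed.

Lemma mix_lim c (F G : nat -> T -> R) (F' G' f g : T -> R) :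
  (forall n, measurable_fun setT (F n)) -> (forall n, measurable_fun setT (G n)) ->
  measurable_fun setT F' -> measurable_fun setT G' ->
  {ae P, forall w, F n w @[n --> \oo] --> F' w} ->
  {ae P, forall w, G n w @[n --> \oo] --> G' w} ->
  L2 P f -> L2 P g -> (forall n w, `|F n w| <= f w) -> (forall n w, `|G n w| <= g w) ->
  (forall n, mix c (F n) (G n)) -> mix c F' G'.
Proof.
move=> mF mG mF' mG' FF' GG' Lf Lg Ff Gg H.
have cF := dominated_cvgR mF mF' FF' (L2_integrable Lf) Ff.
have cG := dominated_cvgR mG mG' GG' (L2_integrable Lg) Gg.
have cFG : E (fun w => F n w * G n w) @[n --> \oo] --> E (fun w => F' w * G' w).
  apply: (@dominated_cvgR (fun n w => F n w * G n w) _ (fun w => f w * g w)).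
  - by move=> n; exact: measurable_funM.
  - exact: measurable_funM.
  - by move: FF' GG'; apply: filterS2 => w; exact: cvgM.
  - exact: L2_mul.
  - by move=> n w; rewrite normrM ler_pM.
have cp : E (F n) * E (G n) @[n --> \oo] --> E F' * E G' by exact: cvgM.
have c1 : `|E (fun w => F n w * G n w) - E (F n) * E (G n)| @[n --> \oo] -->
    `|E (fun w => F' w * G' w) - E F' * E G'| by apply: cvg_norm; exact: cvgB.
have c2 : c * (E (F n) * E (G n)) @[n --> \oo] --> c * (E F' * E G').
  by apply: cvgM => //; exact: cvg_cst.
apply: (ler_cvg_to c1 c2).
by near=> n; exact: H.
Unshelve. all: by end_near. Qed.

End Comparison.

(** * Covariance of products of unbounded variables *)

Section MixingCovariance.
Context d (T : measurableType d) (R : realType) (P : probability T R).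
Implicit Types (f g F G Z : T -> R).
Local Notation E f := (\int[P]_w f w).

Definition clip (N : nat) (x : R) : R := Num.min (Num.max x 0) N%:R.

Lemma clip_bounds N x : 0 <= clip N x <= N%:R.
Proof. by rewrite /clip le_min ge_min le_max lexx orbT lexx orbT ler0n. Qed.

Lemma clip_norm N x : `|clip N x| <= `|x|.
Proof.
rewrite ger0_norm; last by have /andP[] := clip_bounds N x.
by rewrite /clip ge_min ge_max ler_norm normr_ge0.
Qed.

Lemma continuous_clip N : continuous (clip N).
Proof.
move=> x; apply: (@continuous_min _ _ (fun y : R => Num.max y 0 : R^o) (fun=> N%:R));
  last exact: cvg_cst.
by apply: (@continuous_max _ _ (id : R -> R^o) (fun=> 0)); [exact: cvg_id|exact: cvg_cst].
Qed.

Lemma clip_cvg x : clip N x @[N --> \oo] --> Num.max x 0.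
Proof.
apply: cvg_near_cst; exists (Num.truncn `|x|).+1 => // n /= xn.
rewrite /clip; apply/min_idPl.
rewrite ge_max ler0n andbT (le_trans (ler_norm x))//.
by apply/ltW/(lt_le_trans (truncnS_gt _)); rewrite ler_nat.
Qed.

Lemma mixD c F F' G : L2 P F -> L2 P F' -> L2 P G -> mix P c F G -> mix P c F' G ->
  mix P c (fun w => F w + F' w) G.
Proof.
move=> LF LF' LG; rewrite /mix.
have -> : E (fun w => (F w + F' w) * G w) = E (fun w => F w * G w) + E (fun w => F' w * G w).
  by rewrite -RintegralD//; [apply: eq_Rintegral => w _; rewrite mulrDl|exact: L2_mul..].
rewrite RintegralD//; try exact: L2_integrable.
have aux (x y z t u : R) : `|x - z * u| <= c * (z * u) -> `|y - t * u| <= c * (t * u) ->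
    `|x + y - (z + t) * u| <= c * ((z + t) * u).
  by rewrite !ler_norml => /andP[? ?] /andP[? ?]; apply/andP; split; lra.
exact: aux.
Qed.

Lemma mixDr c F G G' : L2 P F -> L2 P G -> L2 P G' -> mix P c F G -> mix P c F G' ->
  mix P c F (fun w => G w + G' w).
Proof.
by move=> LF LG LG' /mix_sym H1 /mix_sym H2; apply: mix_sym; exact: mixD.
Qed.

(** For s = 1 and s = -1 these are the positive and negative parts of x - c. *)
Definition signed_part (s c x : R) : R := Num.max (s * (x - c)) 0.

Lemma continuous_part s c : continuous (signed_part s c).
Proof.
move=> x; apply: (@continuous_max _ _ (fun x => s * (x - c) : R^o) (fun=> 0));
  last exact: cvg_cst.
by apply: cvgM; [exact: cvg_cst|apply: cvgB; [exact: cvg_id|exact: cvg_cst]].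
Qed.

Lemma part_norm s c x : `|s| = 1 -> `|signed_part s c x| <= `|x - c|.
Proof.
move=> s1; rewrite ger0_norm; last by rewrite le_max lexx orbT.
by rewrite ge_max normr_ge0 andbT (le_trans (ler_norm _))// normrM s1 mul1r.
Qed.

Variables (y1 y2 y3 y4 : T -> R) (u1 u2 u3 u4 : nat -> T -> R) (c : R).
Hypotheses (my1 : measurable_fun setT y1) (my2 : measurable_fun setT y2)
  (my3 : measurable_fun setT y3) (my4 : measurable_fun setT y4).
Hypotheses (mu1 : forall n, measurable_fun setT (u1 n)) (mu2 : forall n, measurable_fun setT (u2 n))
  (mu3 : forall n, measurable_fun setT (u3 n)) (mu4 : forall n, measurable_fun setT (u4 n)).
Hypotheses (uy1 : {ae P, forall w, u1 n w @[n --> \oo] --> y1 w})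
  (uy2 : {ae P, forall w, u2 n w @[n --> \oo] --> y2 w})
  (uy3 : {ae P, forall w, u3 n w @[n --> \oo] --> y3 w})
  (uy4 : {ae P, forall w, u4 n w @[n --> \oo] --> y4 w}).
Hypothesis Hmix : forall n A1 A2 A3 A4,
  measurable A1 -> measurable A2 -> measurable A3 -> measurable A4 ->
  mix P c (fun w => \1_A1 (u1 n w) * \1_A2 (u2 n w)) (fun w => \1_A3 (u3 n w) * \1_A4 (u4 n w)).
Variables (c1 c2 c3 c4 : R).
Let Z w := (y1 w - c1) * (y2 w - c2).
Let Z' w := (y3 w - c3) * (y4 w - c4).
Hypotheses (LZ : L2 P Z) (LZ' : L2 P Z').

Let mclip N s cc : measurable_fun setT (fun x => clip N (signed_part s cc x)).
Proof.
apply: continuous_measurable_fun => x.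
by apply: continuous_comp; [exact: continuous_part|exact: continuous_clip].
Qed.

Let ccvg N s cc (u : nat -> T -> R) y : {ae P, forall w, u n w @[n --> \oo] --> y w} ->
  {ae P, forall w, clip N (signed_part s cc (u n w)) @[n --> \oo] --> clip N (signed_part s cc (y w))}.
Proof.
apply: filterS => w uw; apply: continuous_cvg; first exact: continuous_clip.
by apply: continuous_cvg uw; exact: continuous_part.
Qed.

(** At a fixed truncation level everything is bounded and continuous, so dominated convergence
    passes from the approximations [u1 n], ..., [u4 n] to their almost sure limits. *)
Let mix_clip N s1 s2 s3 s4 :
  mix P c (fun w => clip N (signed_part s1 c1 (y1 w)) * clip N (signed_part s2 c2 (y2 w)))
    (fun w => clip N (signed_part s3 c3 (y3 w)) * clip N (signed_part s4 c4 (y4 w))).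
Proof.
have LN : L2 P (cst (N%:R * N%:R : R)).
  split => //; have := finite_measure_integrable_cst P ((N%:R * N%:R) ^+ 2 : R) (@measurableT _ T).
  by apply: eq_integrable => // w _.
have mc s cc (y : T -> R) : measurable_fun setT y -> measurable_fun setT (fun w => clip N (signed_part s cc (y w))).
  by move=> my; exact: (measurableT_comp (mclip N s cc) my).
have bb x y : `|clip N x * clip N y| <= N%:R * N%:R.
  by rewrite normrM ler_pM// ger0_norm; have /andP[] := clip_bounds N x; have /andP[] := clip_bounds N y.
apply: (mix_lim (F := fun n w => clip N (signed_part s1 c1 (u1 n w)) * clip N (signed_part s2 c2 (u2 n w)))
  (G := fun n w => clip N (signed_part s3 c3 (u3 n w)) * clip N (signed_part s4 c4 (u4 n w)))
  (f := cst (N%:R * N%:R)) (g := cst (N%:R * N%:R)));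
  try (by move=> n w; exact: bb); try exact: LN.
- by move=> n; apply: measurable_funM; exact: mc.
- by move=> n; apply: measurable_funM; exact: mc.
- by apply: measurable_funM; exact: mc.
- by apply: measurable_funM; exact: mc.
- have := ccvg N s1 c1 uy1; have := ccvg N s2 c2 uy2.
  by apply: filterS2 => w H2 H1; exact: cvgM.
- have := ccvg N s3 c3 uy3; have := ccvg N s4 c4 uy4.
  by apply: filterS2 => w H2 H1; exact: cvgM.
move=> n; apply: (@mix4 _ _ _ P c (u1 n) (u2 n) (u3 n) (u4 n)
  (fun x => clip N (signed_part s1 c1 x)) (fun x => clip N (signed_part s2 c2 x))
  (fun x => clip N (signed_part s3 c3 x)) (fun x => clip N (signed_part s4 c4 x)) N%:R);
  try (by move=> x; exact: clip_bounds); try exact: mclip.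
- exact: mu1.
- exact: mu2.
- exact: mu3.
- exact: mu4.
- exact: Hmix.
Qed.

Let prodpart s1 s2 w := signed_part s1 c1 (y1 w) * signed_part s2 c2 (y2 w).
Let prodpart' s3 s4 w := signed_part s3 c3 (y3 w) * signed_part s4 c4 (y4 w).

Let mpart s cc (y : T -> R) : measurable_fun setT y -> measurable_fun setT (fun w => signed_part s cc (y w)).
Proof.
move=> my; apply: measurableT_comp my; apply: continuous_measurable_fun.
exact: continuous_part.
Qed.

(** The truncation level tends to infinity, with |Z| and |Z'| as dominating functions. Only the
    products, not the single factors, are assumed to be square integrable. *)
Let mix_part s1 s2 s3 s4 : `|s1| = 1 -> `|s2| = 1 -> `|s3| = 1 -> `|s4| = 1 ->
  mix P c (prodpart s1 s2) (prodpart' s3 s4).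
Proof.
move=> n1 n2 n3 n4.
have absL f : L2 P f -> L2 P (fun w => `|f w|).
  move=> Lf; apply: L2_le (Lf) _ => //; last by move=> w; rewrite normr_id.
  by apply: measurableT_comp => //; exact: L2_measurable Lf.
have lim s cc x : clip N (signed_part s cc x) @[N --> \oo] --> signed_part s cc x.
  have := @clip_cvg (signed_part s cc x); rewrite (_ : Num.max (signed_part s cc x) 0 = signed_part s cc x)//.
  by apply/max_idPl; rewrite /signed_part le_max lexx orbT.
have mc N s cc (y : T -> R) : measurable_fun setT y -> measurable_fun setT (fun w => clip N (signed_part s cc (y w))).
  by move=> my; exact: (measurableT_comp (mclip N s cc) my).
apply: (mix_lim (F := fun N w => clip N (signed_part s1 c1 (y1 w)) * clip N (signed_part s2 c2 (y2 w)))
  (G := fun N w => clip N (signed_part s3 c3 (y3 w)) * clip N (signed_part s4 c4 (y4 w)))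
  (f := fun w => `|Z w|) (g := fun w => `|Z' w|)).
- by move=> N; apply: measurable_funM; exact: mc.
- by move=> N; apply: measurable_funM; exact: mc.
- by apply: measurable_funM; exact: mpart.
- by apply: measurable_funM; exact: mpart.
- by apply: aeW => w /=; apply: cvgM; exact: lim.
- by apply: aeW => w /=; apply: cvgM; exact: lim.
- exact: absL.
- exact: absL.
- move=> N w; rewrite /Z !normrM ler_pM//.
    by apply: le_trans (clip_norm _ _) _; exact: part_norm.
  by apply: le_trans (clip_norm _ _) _; exact: part_norm.
- move=> N w; rewrite /Z' !normrM ler_pM//.
    by apply: le_trans (clip_norm _ _) _; exact: part_norm.
  by apply: le_trans (clip_norm _ _) _; exact: part_norm.
- by move=> N; exact: mix_clip.
Qed.

Let L2_prodpart s1 s2 : `|s1| = 1 -> `|s2| = 1 -> L2 P (prodpart s1 s2).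
Proof.
move=> n1 n2; apply: (L2_le _ LZ); first by apply: measurable_funM; exact: mpart.
by move=> w; rewrite /Z /prodpart !normrM ler_pM//; exact: part_norm.
Qed.

Let L2_prodpart' s1 s2 : `|s1| = 1 -> `|s2| = 1 -> L2 P (prodpart' s1 s2).
Proof.
move=> n1 n2; apply: (L2_le _ LZ'); first by apply: measurable_funM; exact: mpart.
by move=> w; rewrite /Z' /prodpart' !normrM ler_pM//; exact: part_norm.
Qed.

Let partE cc x : x - cc = signed_part 1 cc x - signed_part (-1) cc x /\
  `|x - cc| = signed_part 1 cc x + signed_part (-1) cc x.
Proof.
rewrite /signed_part mul1r mulN1r; move: (x - cc) => a.
have [a0|a0] := leP 0 a.
  rewrite ger0_norm//; case: (ltP (- a) 0) => H; first by rewrite subr0 addr0.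
  by split; lra.
by rewrite ltr0_norm//; case: (ltP (- a) 0) => H; split; lra.
Qed.

(** Write Z = Zp - Zn and |Z| = Zp + Zn, where Zp collects the products of parts of equal sign and
    Zn those of opposite sign, and likewise for Z'. The four bounds for the pairs add up to c (E Zp
    + E Zn)(E Zp' + E Zn'). *)
Lemma mixing_covariance : `|E (fun w => Z w * Z' w) - E Z * E Z'| <=
  c * (E (fun w => `|Z w|) * E (fun w => `|Z' w|)).
Proof.
have m1 : `|-1| = 1 :> R by rewrite normrN1.
have p1 : `|1| = 1 :> R by rewrite normr1.
pose Zp w := prodpart 1 1 w + prodpart (-1) (-1) w.
pose Zn w := prodpart 1 (-1) w + prodpart (-1) 1 w.
pose Zp' w := prodpart' 1 1 w + prodpart' (-1) (-1) w.
pose Zn' w := prodpart' 1 (-1) w + prodpart' (-1) 1 w.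
have LZp : L2 P Zp by apply: L2D; exact: L2_prodpart.
have LZn : L2 P Zn by apply: L2D; exact: L2_prodpart.
have LZp' : L2 P Zp' by apply: L2D; exact: L2_prodpart'.
have LZn' : L2 P Zn' by apply: L2D; exact: L2_prodpart'.
have mixl s1 s2 s3 s4 s5 s6 : `|s1| = 1 -> `|s2| = 1 -> `|s3| = 1 -> `|s4| = 1 ->
    `|s5| = 1 -> `|s6| = 1 ->
    mix P c (fun w => prodpart s1 s2 w + prodpart s3 s4 w) (prodpart' s5 s6).
  move=> n1 n2 n3 n4 n5 n6; apply: mixD; try exact: L2_prodpart; try exact: L2_prodpart';
    exact: mix_part.
have Hpp : mix P c Zp Zp' by apply: mixDr => //; try exact: L2_prodpart'; exact: mixl.
have Hpn : mix P c Zp Zn' by apply: mixDr => //; try exact: L2_prodpart'; exact: mixl.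
have Hnp : mix P c Zn Zp' by apply: mixDr => //; try exact: L2_prodpart'; exact: mixl.
have Hnn : mix P c Zn Zn' by apply: mixDr => //; try exact: L2_prodpart'; exact: mixl.
have ZE w : Z w = Zp w - Zn w /\ `|Z w| = Zp w + Zn w.
  have [e1 a1] := partE c1 (y1 w); have [e2 a2] := partE c2 (y2 w).
  by split; rewrite /Z ?normrM ?a1 ?a2 ?[y1 w - _]e1 ?[y2 w - _]e2 /Zp /Zn /prodpart; ring.
have ZE' w : Z' w = Zp' w - Zn' w /\ `|Z' w| = Zp' w + Zn' w.
  have [e1 a1] := partE c3 (y3 w); have [e2 a2] := partE c4 (y4 w).
  by split; rewrite /Z' ?normrM ?a1 ?a2 ?[y3 w - _]e1 ?[y4 w - _]e2 /Zp' /Zn' /prodpart'; ring.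
have i1 := L2_integrable LZp; have i2 := L2_integrable LZn.
have i1' := L2_integrable LZp'; have i2' := L2_integrable LZn'.
have EZ : E Z = E Zp - E Zn.
  by rewrite -RintegralB//; apply: eq_Rintegral => w _; case: (ZE w).
have EZ' : E Z' = E Zp' - E Zn'.
  by rewrite -RintegralB//; apply: eq_Rintegral => w _; case: (ZE' w).
have EA : E (fun w => `|Z w|) = E Zp + E Zn.
  by rewrite -RintegralD//; apply: eq_Rintegral => w _; case: (ZE w).
have EA' : E (fun w => `|Z' w|) = E Zp' + E Zn'.
  by rewrite -RintegralD//; apply: eq_Rintegral => w _; case: (ZE' w).
have EZZ : E (fun w => Z w * Z' w) = ipm P Zp Zp' - ipm P Zp Zn' - (ipm P Zn Zp' - ipm P Zn Zn').
  rewrite -!ipBr// -ipBl//; last exact: L2B.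
  by apply: eq_Rintegral => w _; case: (ZE w) => -> _; case: (ZE' w) => -> _.
rewrite EZ EZ' EA EA' EZZ; move: Hpp Hpn Hnp Hnn; rewrite /mix -/(ipm P Zp Zp')
  -/(ipm P Zp Zn') -/(ipm P Zn Zp') -/(ipm P Zn Zn').
have aux (x1 x2 x3 x4 e1 e2 e3 e4 : R) :
  `|x1 - e1 * e3| <= c * (e1 * e3) -> `|x2 - e1 * e4| <= c * (e1 * e4) ->
  `|x3 - e2 * e3| <= c * (e2 * e3) -> `|x4 - e2 * e4| <= c * (e2 * e4) ->
  `|x1 - x2 - (x3 - x4) - (e1 - e2) * (e3 - e4)| <= c * ((e1 + e2) * (e3 + e4)).
  rewrite !ler_norml => /andP[? ?] /andP[? ?] /andP[? ?] /andP[? ?].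
  by apply/andP; split; lra.
exact: aux.
Qed.

End MixingCovariance.

(** * Pointwise values of the observed process *)

(** Convergence at (x, y) means that the upper limit of |F n - f| vanishes there. This is a
    nonnegative jointly measurable function, so by Tonelli it vanishes almost everywhere whichever
    variable comes first. *)
Lemma ae_cvg_fubini d1 d2 (S : measurableType d1) (T : measurableType d2) (R : realType)
  (nu : {sigma_finite_measure set S -> \bar R}) (mu : {sigma_finite_measure set T -> \bar R})
  (F : nat -> S -> T -> R) (f : S -> T -> R) :
  (forall n, measurable_fun setT (fun q : S * T => F n q.1 q.2)) ->
  measurable_fun setT (fun q : S * T => f q.1 q.2) ->
  {ae nu, forall x, {ae mu, forall y, F n x y @[n --> \oo] --> f x y}} ->
  {ae mu, forall y, {ae nu, forall x, F n x y @[n --> \oo] --> f x y}}.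
Proof.
move=> mF mf H.
pose h (q : S * T) : \bar R := limn_esup (fun n => (`|F n q.1 q.2 - f q.1 q.2|)%:E).
have mh : measurable_fun setT h.
  apply: measurable_fun_limn_esup => n; apply/measurable_EFinP.
  by apply: measurableT_comp => //; exact: measurable_funB.
have h0 q : (0 <= h q)%E.
  by apply: limf_esup_ge0 => // n; rewrite lee_fin.
have hP q : h q = 0%E <-> F n q.1 q.2 @[n --> \oo] --> f q.1 q.2.
  split=> [hq|C].
  - have : (fun n => (`|F n q.1 q.2 - f q.1 q.2|)%:E) @ \oo --> 0%:E.
      by apply: limn_esup_le_cvg => [|n]; [rewrite -/(h q) hq|rewrite lee_fin].
    move=> /fine_cvg H0.
    have H1 : (fun n => F n q.1 q.2 - f q.1 q.2) @ \oo --> (0 : R) by exact: norm_cvg0 H0.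
    by apply/subr_cvg0.
  - have H1 : (fun n => F n q.1 q.2 - f q.1 q.2) @ \oo --> (0 : R) by apply/subr_cvg0.
    have H2 : (fun n => `|F n q.1 q.2 - f q.1 q.2|) @ \oo --> (0 : R) by apply/norm_cvg0P.
    have : (fun n => (`|F n q.1 q.2 - f q.1 q.2|)%:E) @ \oo --> 0%:E.
      by apply: cvg_EFin; [near=> n|exact: H2].
    by case/cvg_limn_einf_sup.
have mh1 x : measurable_fun setT (fun y => h (x, y)).
  by have := measurableT_comp mh (pair1_measurable x).
have mh2 y : measurable_fun setT (fun x => h (x, y)).
  by have := measurableT_comp mh (pair2_measurable y).
have mI1 : measurable_fun setT (fun x => \int[mu]_y h (x, y))%E.
  exact: measurable_fun_fubini_tonelli_F.
have mI2 : measurable_fun setT (fun y => \int[nu]_x h (x, y))%E.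
  exact: measurable_fun_fubini_tonelli_G.
have I0 : (\int[mu]_y `|\int[nu]_x h (x, y)| = 0)%E.
  under eq_integral do rewrite gee0_abs ?integral_ge0//.
  rewrite -(@fubini_tonelli _ _ _ _ _ nu mu h)//.
  rewrite (ae_eq_integral (cst 0%E))//; first by rewrite integral0.
  apply: filterS H => x Hx _.
  rewrite (ae_eq_integral (cst 0%E))//; first by rewrite integral0.
  by apply: filterS Hx => y Hxy _; apply/hP.
have /(ae_eq_integral_abs mu measurableT mI2) := I0.
apply: filterS => y /(_ I) Iy.
have Iy' : (\int[nu]_x `|h (x, y)| = 0)%E.
  by under eq_integral do rewrite gee0_abs//.
have /(ae_eq_integral_abs nu measurableT (mh2 y)) := Iy'.
by apply: filterS => x /(_ I) /hP.
Unshelve. all: by end_near. Qed.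

(** * Stationarity and mixing for events given by scalar products *)

Section Cylinders.
Context (R : realType) (a b : R) (dO : measure_display) (Omega : measurableType dO).
Variable P : probability Omega R.
Variable Y : int -> Omega -> R -> R.
Hypothesis mY : forall t, measurable_fun setT (fun q : Omega * R => Y t q.1 q.2).

Lemma ip_muI_patch (f g : R -> R) : measurable_fun setT f -> measurable_fun (Iab a b) g ->
  ip a b f g = ipm (muI a b) f (g \_ (Iab a b)).
Proof.
move=> mf mg; rewrite /ipm Rintegral_muI.
  by apply: eq_Rintegral => x xI; rewrite !patchE xI.
by apply: measurable_funM => //; exact: measurable_patchI.
Qed.

Lemma measurable_Yw t w : measurable_fun setT (Y t w).
Proof. exact: (measurable_section w (mY t)). Qed.

Lemma measurable_Yu t u : measurable_fun setT (fun w => Y t w u).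
Proof. exact: (measurable_section2 u (mY t)). Qed.

Lemma measurable_ipY t g : sq_int a b g -> measurable_fun setT (fun w => ip a b (Y t w) g).
Proof.
move=> [mg _].
have -> : (fun w => ip a b (Y t w) g) = (fun w => ipm (muI a b) (Y t w) (g \_ (Iab a b))).
  by apply/funext => w; rewrite ip_muI_patch//; exact: measurable_Yw.
apply: (@measurable_Rintegral2 _ _ _ _ _ (muI a b) (fun w u => Y t w u * (g \_ (Iab a b)) u)).
apply: measurable_funM; first exact: mY.
by apply: measurableT_comp => //; exact: measurable_patchI.
Qed.

Lemma measurable_cyl t g B : sq_int a b g -> measurable B -> measurable (cyl a b Y t g B).
Proof.
move=> sg mB; have := measurable_ipY t sg; move=> /(_ measurableT B mB).
by rewrite setTI.
Qed.

Lemma E_indic2 (U V : Omega -> R) A B : measurable_fun setT U -> measurable_fun setT V ->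
  measurable A -> measurable B ->
  \int[P]_w (\1_A (U w) * \1_B (V w)) = fine (P (U @^-1` A `&` V @^-1` B)).
Proof.
move=> mU mV mA mB; rewrite /Rintegral; congr fine.
have mUA : measurable (U @^-1` A) by have := mU measurableT _ mA; rewrite setTI.
have mVB : measurable (V @^-1` B) by have := mV measurableT _ mB; rewrite setTI.
rewrite -[in RHS](setIT (_ `&` _)) -integral_indic//; last exact: measurableI.
apply: eq_integral => w _; congr EFin; rewrite !indicE -natrM mulnb; congr ((nat_of_bool _)%:R).
by rewrite in_setI; congr andb; apply/idP/idP; rewrite !inE.
Qed.

Lemma stationary2 (s1 s2 h : int) g1 g2 A1 A2 : strictly_stationary a b P Y ->
  sq_int a b g1 -> sq_int a b g2 -> measurable A1 -> measurable A2 ->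
  P (cyl a b Y (s1 + h) g1 A1 `&` cyl a b Y (s2 + h) g2 A2) =
  P (cyl a b Y s1 g1 A1 `&` cyl a b Y s2 g2 A2).
Proof.
move=> st sg1 sg2 mA1 mA2.
have := st [:: (s1, g1, A1); (s2, g2, A2)] h.
have capE (F : int * (R -> R) * set R -> set Omega) :
    \bigcap_(x in [set` [:: (s1, g1, A1); (s2, g2, A2)]]) F x = F (s1, g1, A1) `&` F (s2, g2, A2).
  apply/seteqP; split => w /=.
    by move=> H; split; apply: H => /=; rewrite !inE eqxx ?orbT.
  by move=> [H1 H2] x /=; rewrite !inE => /orP[] /eqP ->.
rewrite 2!capE /=; by apply => x; rewrite !inE => /orP[] /eqP -> /=.
Qed.

Lemma stationary4 (s1 s2 s3 s4 h : int) g1 g2 g3 g4 A1 A2 A3 A4 :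
  strictly_stationary a b P Y ->
  sq_int a b g1 -> sq_int a b g2 -> sq_int a b g3 -> sq_int a b g4 ->
  measurable A1 -> measurable A2 -> measurable A3 -> measurable A4 ->
  P (cyl a b Y (s1 + h) g1 A1 `&` cyl a b Y (s2 + h) g2 A2 `&`
     (cyl a b Y (s3 + h) g3 A3 `&` cyl a b Y (s4 + h) g4 A4)) =
  P (cyl a b Y s1 g1 A1 `&` cyl a b Y s2 g2 A2 `&`
     (cyl a b Y s3 g3 A3 `&` cyl a b Y s4 g4 A4)).
Proof.
move=> st sg1 sg2 sg3 sg4 mA1 mA2 mA3 mA4.
have := st [:: (s1, g1, A1); (s2, g2, A2); (s3, g3, A3); (s4, g4, A4)] h.
have capE (F : int * (R -> R) * set R -> set Omega) :
    \bigcap_(x in [set` [:: (s1, g1, A1); (s2, g2, A2); (s3, g3, A3); (s4, g4, A4)]]) F x =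
    F (s1, g1, A1) `&` F (s2, g2, A2) `&` (F (s3, g3, A3) `&` F (s4, g4, A4)).
  apply/seteqP; split => w /=.
    by move=> H; split; split; apply: H => /=; rewrite !inE eqxx ?orbT.
  by move=> [[H1 H2] [H3 H4]] x /=; rewrite !inE => /or4P[] /eqP ->.
by rewrite 2!capE /=; apply => x; rewrite !inE => /or4P[] /eqP -> /=.
Qed.

Lemma F_setI (S : set int) A B : F_ a b Y S A -> F_ a b Y S B -> F_ a b Y S (A `&` B).
Proof.
move=> FA FB; exact: (@measurableI _ (g_sigma_algebraType (gen_F a b Y S)) A B FA FB).
Qed.

Lemma F_cyl (S : set int) t g B : S t -> sq_int a b g -> measurable B ->
  F_ a b Y S (cyl a b Y t g B).
Proof. by move=> St sg mB; apply: sub_sigma_algebra; exists t, g, B. Qed.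

(** The denominator in [psi] is cleared. Pairs with P(A) P(B) = 0, excluded from the supremum,
    satisfy the inequality because then P(A and B) = 0 as well. *)
Lemma psi_event l A B : measurable A -> measurable B -> (psi a b P Y l < +oo)%E ->
  F_ a b Y [set t | t <= 0] A -> F_ a b Y [set t | l%:Z <= t] B ->
  `|fine (P (A `&` B)) - fine (P A) * fine (P B)| <=
  fine (psi a b P Y l) * (fine (P A) * fine (P B)).
Proof.
move=> mA mB psioo FA FB.
have PAf : P A \is a fin_num by exact: fin_num_measure.
have PBf : P B \is a fin_num by exact: fin_num_measure.
have PABf : P (A `&` B) \is a fin_num by apply: fin_num_measure; exact: measurableI.
have pA : 0 <= fine (P A) by exact: fine_ge0.
have pB : 0 <= fine (P B) by exact: fine_ge0.
have pAB : 0 <= fine (P (A `&` B)) by exact: fine_ge0.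
have leA : fine (P (A `&` B)) <= fine (P A).
  by rewrite fine_le//; apply: le_measure; rewrite ?inE//; exact: measurableI.
have leB : fine (P (A `&` B)) <= fine (P B).
  by rewrite fine_le//; apply: le_measure; rewrite ?inE//; exact: measurableI.
have [AB0|AB0] := leP (fine (P A) * fine (P B)) 0.
  have : fine (P A) * fine (P B) = 0 by apply/eqP; rewrite eq_le AB0 mulr_ge0.
  move=> e; rewrite e mulr0 subr0.
  move/eqP : e; rewrite mulf_eq0 => /orP[] /eqP e.
    by rewrite ger0_norm// -e.
  by rewrite ger0_norm// -e.
have := @ereal_sup_ubound R _ _ (ex_intro _ A (ex_intro _ B
  (conj FA (conj FB (conj AB0 erefl)))) :
   [set x | exists A B, F_ a b Y [set t | (t <= 0)%R] A /\ F_ a b Y [set t | (l%:Z <= t)%R] B /\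
     (0 < fine (P A) * fine (P B))%R /\
     x = (`| 1 - fine (P (A `&` B)) / (fine (P A) * fine (P B)) |)%:E] _).
rewrite -/(psi a b P Y l) => H.
have psi_fin : psi a b P Y l \is a fin_num.
  by rewrite ge0_fin_numE//; apply: le_trans H; rewrite lee_fin.
move: H; rewrite -(fineK psi_fin) lee_fin -(ler_pM2r AB0).
rewrite -[X in _ * X <= _](gtr0_norm AB0) -normrM mulrBl mul1r divfK ?gt_eqF//.
by rewrite distrC.
Qed.

(** In [psi] the past ends at time 0, whereas here it ends at [m]. Stationarity of the joint law of
    the four variables and of each pair shifts all times by m. *)
Lemma psi_rect l (m s1 s2 s3 s4 : int) g1 g2 g3 g4 A1 A2 A3 A4 :
  strictly_stationary a b P Y -> (psi a b P Y l < +oo)%E ->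
  s1 <= m -> s2 <= m -> m + l%:Z <= s3 -> m + l%:Z <= s4 ->
  sq_int a b g1 -> sq_int a b g2 -> sq_int a b g3 -> sq_int a b g4 ->
  measurable A1 -> measurable A2 -> measurable A3 -> measurable A4 ->
  mix P (fine (psi a b P Y l))
    (fun w => \1_A1 (ip a b (Y s1 w) g1) * \1_A2 (ip a b (Y s2 w) g2))
    (fun w => \1_A3 (ip a b (Y s3 w) g3) * \1_A4 (ip a b (Y s4 w) g4)).
Proof.
move=> st psioo h1 h2 h3 h4 sg1 sg2 sg3 sg4 mA1 mA2 mA3 mA4.
have E12 t t' g g' A A' : sq_int a b g -> sq_int a b g' -> measurable A -> measurable A' ->
  \int[P]_w (\1_A (ip a b (Y t w) g) * \1_A' (ip a b (Y t' w) g')) =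
  fine (P (cyl a b Y t g A `&` cyl a b Y t' g' A')).
  by move=> sg sg' mA mA'; apply: E_indic2 => //; exact: measurable_ipY.
rewrite /mix (E12 s1 s2)// (E12 s3 s4)//.
have -> : \int[P]_w (\1_A1 (ip a b (Y s1 w) g1) * \1_A2 (ip a b (Y s2 w) g2) *
    (\1_A3 (ip a b (Y s3 w) g3) * \1_A4 (ip a b (Y s4 w) g4))) =
  fine (P (cyl a b Y s1 g1 A1 `&` cyl a b Y s2 g2 A2 `&`
     (cyl a b Y s3 g3 A3 `&` cyl a b Y s4 g4 A4))).
  rewrite /Rintegral; congr fine.
  rewrite -[in RHS](setIT (_ `&` _)) -integral_indic//; last first.
    by apply: measurableI; apply: measurableI; exact: measurable_cyl.
  apply: eq_integral => w _; congr EFin; rewrite !indicE -!natrM !mulnb; congr ((nat_of_bool _)%:R).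
  by rewrite !in_setI; congr andb; congr andb; apply/idP/idP; rewrite !inE.
have mc t g B : sq_int a b g -> measurable B -> measurable (cyl a b Y t g B).
  exact: measurable_cyl.
have E4 := stationary4 (s1 - m) (s2 - m) (s3 - m) (s4 - m) m st
  sg1 sg2 sg3 sg4 mA1 mA2 mA3 mA4.
have E2 := stationary2 (s1 - m) (s2 - m) m st sg1 sg2 mA1 mA2.
have E2' := stationary2 (s3 - m) (s4 - m) m st sg3 sg4 mA3 mA4.
rewrite !subrK in E4 E2 E2'; rewrite E4 E2 E2'; apply: psi_event.
- by apply: measurableI; exact: mc.
- by apply: measurableI; exact: mc.
- exact: psioo.
- by apply: F_setI; apply: F_cyl => //=; rewrite subr_le0.
- by apply: F_setI; apply: F_cyl => //=; rewrite lerBrDl.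
Qed.

End Cylinders.

(** * Averages over shrinking balls *)

Section Averages.
Context (R : realType) (a b : R).

(** The ball of radius 1/(n+1) has length 2/(n+1), so the scalar product with this function is the
    mean over the ball. *)
Definition avg (n : nat) (u v : R) : R := n.+1%:R / 2 * \1_(ball u (n.+1%:R^-1)) v.

Lemma L2_cst_muI (c : R) : L2 (muI a b) (cst c).
Proof.
split => //; have := finite_measure_integrable_cst (muI a b) (c ^+ 2) (@measurableT _ _).
by apply: eq_integrable.
Qed.

Lemma measurable_avg2 n :
  measurable_fun setT (fun q : R * R => avg n q.1 q.2).
Proof.
apply: measurable_funM => //.
have mD : measurable [set q : R * R | `|q.1 - q.2| < n.+1%:R^-1].
  have m1 : measurable_fun setT (fun q : R * R => `|q.1 - q.2|).
    by apply: measurableT_comp => //; apply: measurable_funB.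
  have := measurable_fun_ltr m1 (@measurable_cst _ _ (R * R)%type R setT (n.+1%:R^-1)).
  by move=> /(_ measurableT [set true]); rewrite setTI; apply.
rewrite (_ : (fun q => _) = \1_[set q : R * R | `|q.1 - q.2| < n.+1%:R^-1]).
  exact: measurable_indic.
apply/funext => q; by rewrite !indicE; congr ((nat_of_bool _)%:R).
Qed.

Lemma measurable_avg n u : measurable_fun setT (avg n u).
Proof. by have := measurableT_comp (measurable_avg2 n) (pair1_measurable u). Qed.

Lemma sq_int_avg n u : sq_int a b (avg n u).
Proof.
apply: L2_sq_int; apply: (L2_le _ (L2_cst_muI (n.+1%:R / 2))).
  exact: measurable_avg.
move=> v; rewrite /avg indicE /cst normrM.
by case: (_ \in _); rewrite ?normr1 ?mulr1// normr0 mulr0.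
Qed.

(** Lebesgue's differentiation theorem for f extended by 0 outside the interval. *)
Lemma avg_cvg (f : R -> R) : L2 (muI a b) f ->
  {ae muI a b, forall u, ip a b f (avg n u) @[n --> \oo] --> f u}.
Proof.
move=> Lf; have mf := L2_measurable Lf; have mI := measurable_Iab a b.
have mfI : measurable_fun setT f by exact: mf.
have ifI : (@lebesgue_measure R).-integrable (Iab a b) (EFin \o f).
  have := L2_mul Lf (L2_cst_muI 1) => /integrableP[_].
  rewrite integral_muI; last first.
    by apply: measurableT_comp => //; apply/measurable_EFinP; apply: measurable_funM.
  under eq_integral do rewrite /= /cst mulr1.
  move=> ioo; apply/integrableP; split => //.
  by apply/measurable_EFinP; exact: measurable_funTS.
have locf := integrable_locally_restrict mI ifI.
have hE (x : R) : nicely_shrinking x (fun n => ball x (n.+1%:R^-1)).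
  split; first by move=> n; exact: measurable_ball.
  have r0 n : 0 < n.+1%:R^-1 :> R by rewrite invr_gt0.
  exists (1, fun n => PosNum (r0 n)); split => //=.
  - exact: cvg_harmonic.
  - by move=> n v.
  - by move=> n; rewrite mul1e.
have pts := lebesgue_differentiation locf.
have FF : Filter (nbhs (almost_everywhere (@lebesgue_measure R))) :=
  ae_filter_ringOfSetsType (@lebesgue_measure R).
apply/ae_muI; move: pts; apply: filterS => u pu Iu.
have := nice_lebesgue_differentiation hE locf pu.
rewrite (_ : (f \_ (Iab a b)) u = f u); last by rewrite patchE mem_set.
move=> /fine_cvg; apply: cvg_trans; apply: near_eq_cvg; near=> n => /=.
have r0 : 0 < n.+1%:R^-1 :> R by rewrite invr_gt0.
have mB : measurable (ball u (n.+1%:R^-1)) by exact: measurable_ball.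
have mfB : measurable_fun setT (fun v => f v * \1_(ball u n.+1%:R^-1) v).
  by apply: measurable_funM => //; exact: measurable_indic.
have iB : (@lebesgue_measure R).-integrable (Iab a b)
    (EFin \o (fun v => f v * \1_(ball u n.+1%:R^-1) v)).
  apply: le_integrable ifI => //.
    by apply/measurable_EFinP; exact: measurable_funTS.
  move=> v _ /=; rewrite lee_fin normrM ler_piMr// indicE.
  by case: (_ \in _); rewrite ?normr1 ?normr0.
have -> : (\int[lebesgue_measure]_(y in ball u n.+1%:R^-1) (f \_ (Iab a b) y)%:E =
    \int[lebesgue_measure]_(v in Iab a b) (f v * \1_(ball u n.+1%:R^-1) v)%:E)%E.
  rewrite [LHS]integral_mkcond [RHS]integral_mkcond; apply: eq_integral => v _.
  rewrite !patchE indicE; case: ifPn => vB; case: ifPn => vI //=.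
  - by rewrite mulr1.
  - by rewrite mulr0.
rewrite lebesgue_measure_ball ?ltW// /ip.
under eq_Rintegral do rewrite /avg mulrCA.
rewrite (RintegralZl _ _ iB)// /Rintegral -/(@leb R).
rewrite inver mulrn_eq0 /= gt_eqF// fineM//; last exact: integrable_fin_num iB.
congr (_ * _); rewrite /= -[_ *+ 2]mulr_natr; field.
by rewrite addrC natr1 pnatr_eq0.
Unshelve. all: by end_near. Qed.

End Averages.

Section Pointwise.
Context (R : realType) (a b : R) (dO : measure_display) (Omega : measurableType dO).
Variable P : probability Omega R.
Variable Y : int -> Omega -> R -> R.
Hypothesis mY : forall t, measurable_fun setT (fun q : Omega * R => Y t q.1 q.2).
Local Notation mu := (muI a b).

(* [Y t w u] is almost surely a limit of variables measurable for the sigma-algebra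
   of [Y t], which is generated by the scalar products with square integrable functions. *)
Definition regular_pt (t : int) (u : R) :=
  {ae P, forall w, ip a b (Y t w) (avg n u) @[n --> \oo] --> Y t w u}.

(** Differentiation works path by path: for almost every w, at almost every u. The two quantifiers
    are exchanged by [ae_cvg_fubini]. *)
Lemma ae_regular_pt t : {ae P, forall w, L2 mu (Y t w)} -> {ae mu, forall u, regular_pt t u}.
Proof.
move=> LY; apply: (@ae_cvg_fubini _ _ _ _ _ P mu (fun n w u => ip a b (Y t w) (avg n u)) (Y t)).
- move=> n.
  have -> : (fun q : Omega * measurableTypeR R => ip a b (Y t q.1) (avg n q.2)) =
      (fun q => ipm mu (Y t q.1) (avg n q.2 \_ (Iab a b))).
    apply/funext => q; rewrite ip_muI_patch//; first exact: measurable_Yw.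
    by apply: measurable_funTS; exact: measurable_avg.
  apply: (@measurable_Rintegral2 _ _ _ _ _ mu
    (fun (q : Omega * measurableTypeR R) v => Y t q.1 v * (avg n q.2 \_ (Iab a b)) v)).
  apply: measurable_funM.
    have := measurableT_comp (mY t) (@measurable_fun_pair _ _ _
      (Omega * measurableTypeR R * measurableTypeR R)%type Omega R
      (fun q => q.1.1) (fun q => q.2) _ _).
    by apply => //; exact: measurableT_comp.
  have -> : (fun q : Omega * measurableTypeR R * measurableTypeR R =>
      (avg n q.1.2 \_ (Iab a b)) q.2) = (fun q => avg n q.1.2 q.2 * \1_(Iab a b) q.2).
    apply/funext => q; rewrite patchE indicE; case: ifPn => _; first by rewrite mulr1.
    by rewrite mulr0.
  apply: measurable_funM.
    have := measurableT_comp (measurable_avg2 n) (@measurable_fun_pair _ _ _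
      (Omega * measurableTypeR R * measurableTypeR R)%type R R
      (fun q => q.1.2) (fun q => q.2) _ _).
    by apply => //; exact: measurableT_comp.
  apply: measurableT_comp => //; apply: measurable_indic; exact: measurable_Iab.
- exact: mY.
- by apply: filterS LY => w Lw; exact: avg_cvg.
Qed.

Lemma pointwise_cov l (m s1 s2 s3 s4 : int) (u v c1 c2 : R) :
  strictly_stationary a b P Y -> (psi a b P Y l < +oo)%E ->
  s1 <= m -> s2 <= m -> m + l%:Z <= s3 -> m + l%:Z <= s4 ->
  regular_pt s1 u -> regular_pt s2 v -> regular_pt s3 u -> regular_pt s4 v ->
  L2 P (fun w => (Y s1 w u - c1) * (Y s2 w v - c2)) ->
  L2 P (fun w => (Y s3 w u - c1) * (Y s4 w v - c2)) ->
  `| \int[P]_w ((Y s1 w u - c1) * (Y s2 w v - c2) * ((Y s3 w u - c1) * (Y s4 w v - c2))) -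
     \int[P]_w ((Y s1 w u - c1) * (Y s2 w v - c2)) *
     \int[P]_w ((Y s3 w u - c1) * (Y s4 w v - c2)) | <=
  fine (psi a b P Y l) *
    (\int[P]_w `|(Y s1 w u - c1) * (Y s2 w v - c2)| *
     \int[P]_w `|(Y s3 w u - c1) * (Y s4 w v - c2)|).
Proof.
move=> st psioo h1 h2 h3 h4 r1 r2 r3 r4 L12 L34.
have mU t x n : measurable_fun setT (fun w => ip a b (Y t w) (avg n x)).
  by apply: measurable_ipY => //; exact: sq_int_avg.
apply: (mixing_covariance (measurable_Yu mY s1 u) (measurable_Yu mY s2 v)
  (measurable_Yu mY s3 u) (measurable_Yu mY s4 v) (mU s1 u) (mU s2 v) (mU s3 u) (mU s4 v)
  r1 r2 r3 r4 _ L12 L34) => n A1 A2 A3 A4 mA1 mA2 mA3 mA4.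
by apply: (psi_rect mY st psioo h1 h2 h3 h4) => //; exact: sq_int_avg.
Qed.

(** Two applications of [Rintegral_comparison], one for each factor, reduce the claim for ball
    averages to pairs of events, where stationarity gives equality; then n tends to infinity. One
    direction suffices, the aim being a bound on moments that is uniform in t. *)
Lemma stationary_bounded t u v (f : R -> R) M : strictly_stationary a b P Y ->
  regular_pt t u -> regular_pt t v -> regular_pt 0 u -> regular_pt 0 v ->
  continuous f -> (forall x, 0 <= f x <= M) ->
  \int[P]_w (f (Y t w u) * f (Y t w v)) <= \int[P]_w (f (Y 0 w u) * f (Y 0 w v)).
Proof.
move=> st tu tv zu zv cf bf.
have mf : measurable_fun setT f by exact: continuous_measurable_fun.
pose U s x n w := ip a b (Y s w) (avg n x).
have mU s x n : measurable_fun setT (U s x n).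
  by apply: measurable_ipY => //; exact: sq_int_avg.
have mfU s x n : measurable_fun setT (fun w => f (U s x n w)).
  exact: (measurableT_comp mf (mU s x n)).
have ifU s x n : P.-integrable setT (EFin \o (fun w => f (U s x n w))).
  by apply: bounded_mfun_integrable; split => //; exists M => w; exact: bf.
have mind A s x n : measurable A -> measurable_fun setT (fun w => \1_A (U s x n w) : R).
  by move=> mA; exact: (measurableT_comp (measurable_indic mA) (mU s x n)).
have iind A s x n : measurable A -> P.-integrable setT (EFin \o (fun w => \1_A (U s x n w) : R)).
  move=> mA; apply: bounded_mfun_integrable; split; first exact: mind.
  by exists 1 => w; rewrite indicE; case: (_ \in _); rewrite ?lexx ?ler01.
have statI n A B : measurable A -> measurable B ->
    \int[P]_w (\1_A (U t u n w) * \1_B (U t v n w)) =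
    \int[P]_w (\1_A (U 0 u n w) * \1_B (U 0 v n w)).
  move=> mA mB; rewrite !E_indic2//.
  have := @stationary2 R a b _ _ P Y 0 0 t (avg n u) (avg n v) A B st
    (sq_int_avg a b n u) (sq_int_avg a b n v) mA mB.
  by rewrite !add0r /cyl => ->.
have cU s x : regular_pt s x -> {ae P, forall w, U s x n w @[n --> \oo] --> Y s w x} by [].
clearbody U.
have step n : \int[P]_w (f (U t u n w) * f (U t v n w)) <=
    \int[P]_w (f (U 0 u n w) * f (U 0 v n w)).
  have flip (g h : Omega -> R) : \int[P]_w (g w * h w) = \int[P]_w (h w * g w).
    by apply: eq_Rintegral => w _; exact: mulrC.
  rewrite (flip (fun w => f (U t u n w))) (flip (fun w => f (U 0 u n w))).
  apply: (Rintegral_comparison (N := M) (ifU t v n) (ifU 0 v n) (mU t u n) (mU 0 u n) _ mf bf) => A mA.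
  rewrite (flip (fun w => f (U t v n w))) (flip (fun w => f (U 0 v n w))).
  apply: (Rintegral_comparison (N := M) (iind A t u n mA) (iind A 0 u n mA) (mU t v n) (mU 0 v n) _ mf bf).
  by move=> B mB; rewrite statI.
have lim s : regular_pt s u -> regular_pt s v ->
    \int[P]_w (f (U s u n w) * f (U s v n w)) @[n --> \oo] -->
    \int[P]_w (f (Y s w u) * f (Y s w v)).
  move=> su sv; apply: (@dominated_cvgR _ _ _ P (fun n w => f (U s u n w) * f (U s v n w)) _
    (cst (M * M))).
  - by move=> n; apply: measurable_funM; exact: mfU.
  - by apply: measurable_funM; exact: (measurableT_comp mf (measurable_Yu mY s _)).
  - have := cU _ _ su; have := cU _ _ sv; apply: filterS2 => w cv cu; apply: cvgM.
      by apply: continuous_cvg cu; exact: cf.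
    by apply: continuous_cvg cv; exact: cf.
  - exact: finite_measure_integrable_cst.
  - move=> n w; have /andP[p1 p2] := bf (U s u n w); have /andP[p3 p4] := bf (U s v n w).
    rewrite ger0_norm; last by rewrite mulr_ge0.
    by rewrite /cst ler_pM.
apply: (ler_cvg_to (lim t tu tv) (lim 0 zu zv)).
by near=> n; exact: step.
Unshelve. all: by end_near. Qed.

Lemma stationary_clip t u v N : strictly_stationary a b P Y ->
  regular_pt t u -> regular_pt t v -> regular_pt 0 u -> regular_pt 0 v ->
  \int[P]_w (clip N (Y t w u ^+ 2) * clip N (Y t w v ^+ 2)) <=
  \int[P]_w (clip N (Y 0 w u ^+ 2) * clip N (Y 0 w v ^+ 2)).
Proof.
move=> st tu tv zu zv.
apply: (@stationary_bounded t u v (fun x => clip N (x ^+ 2)) N%:R st tu tv zu zv).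
  move=> x; apply: continuous_cvg; first exact: continuous_clip.
  exact: exprn_continuous.
by move=> x; exact: clip_bounds.
Qed.

(** Monotone convergence in the truncation level, with extended values because the moments may be
    infinite at particular u and v. *)
Lemma stationary_sqr t u v : strictly_stationary a b P Y ->
  regular_pt t u -> regular_pt t v -> regular_pt 0 u -> regular_pt 0 v ->
  (\int[P]_w (Y t w u ^+ 2 * Y t w v ^+ 2)%:E <=
   \int[P]_w (Y 0 w u ^+ 2 * Y 0 w v ^+ 2)%:E)%E.
Proof.
move=> st tu tv zu zv.
have mYu s x : measurable_fun setT (fun w => Y s w x) by exact: measurable_Yu.
have mc N s x : measurable_fun setT (fun w => clip N (Y s w x ^+ 2)).
  apply: measurableT_comp; first exact: continuous_measurable_fun (@continuous_clip _ N).
  exact: measurable_funX.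
have mcc N s : measurable_fun setT (fun w => (clip N (Y s w u ^+ 2) * clip N (Y s w v ^+ 2))%:E).
  by apply/measurable_EFinP; apply: measurable_funM; exact: mc.
have c0 N (x : R) : 0 <= clip N x by have /andP[] := @clip_bounds R N x.
have lim w : (clip N (Y t w u ^+ 2) * clip N (Y t w v ^+ 2))%:E @[N --> \oo] -->
    (Y t w u ^+ 2 * Y t w v ^+ 2)%:E.
  apply: cvg_EFin; first by near=> N.
  have lim1 (x : R) : clip N (x ^+ 2) @[N --> \oo] --> x ^+ 2.
    have := @clip_cvg R (x ^+ 2); rewrite (_ : Num.max (x ^+ 2) 0 = x ^+ 2)//.
    by apply/max_idPl; exact: sqr_ge0.
  by apply: cvgM; exact: lim1.
have nd w : nondecreasing_seq (fun N => (clip N (Y t w u ^+ 2) * clip N (Y t w v ^+ 2))%:E).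
  move=> N M NM; rewrite lee_fin; have ndc (x : R) : clip N x <= clip M x.
    rewrite /clip le_min ge_min lexx /= ge_min orbC.
    by rewrite (_ : N%:R <= M%:R) ?ler_nat.
  by apply: ler_pM.
have g0 N w : (0 <= (clip N (Y t w u ^+ 2) * clip N (Y t w v ^+ 2))%:E)%E.
  by rewrite lee_fin mulr_ge0 ?c0.
have mono := @cvg_monotone_convergence _ _ _ P setT measurableT
  (fun N w => (clip N (Y t w u ^+ 2) * clip N (Y t w v ^+ 2))%:E)
  (fun N => mcc N t) (fun N w _ => g0 N w) (fun w _ => nd w).
have {}mono : (\int[P]_w (clip N (Y t w u ^+ 2) * clip N (Y t w v ^+ 2))%:E @[N --> \oo] -->
    \int[P]_w (Y t w u ^+ 2 * Y t w v ^+ 2)%:E)%E.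
  have -> : (\int[P]_w (Y t w u ^+ 2 * Y t w v ^+ 2)%:E =
    \int[P]_w limn (fun N => (clip N (Y t w u ^+ 2) * clip N (Y t w v ^+ 2))%:E))%E.
    by apply: eq_integral => w _; apply/esym/cvg_lim => //; exact: lim.
  exact: mono.
apply: (cvge_to_le mono); near=> N.
have fi s : (\int[P]_w (clip N (Y s w u ^+ 2) * clip N (Y s w v ^+ 2))%:E)%E \is a fin_num.
  apply: integrable_fin_num => //.
  apply: (@bounded_mfun_integrable _ _ _ P (fun w => clip N (Y s w u ^+ 2) * clip N (Y s w v ^+ 2))).
  apply: bounded_mfunM; split; [exact: mc| |exact: mc|]; exists N%:R => w; exact: clip_bounds.
apply: (@le_trans _ _ (\int[P]_w (clip N (Y 0 w u ^+ 2) * clip N (Y 0 w v ^+ 2))%:E)%E).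
  by rewrite -(fineK (fi t)) -(fineK (fi 0)) lee_fin; exact: stationary_clip.
apply: ge0_le_integral => //.
- by move=> w _; rewrite lee_fin mulr_ge0 ?c0.
- by apply/measurable_EFinP; apply: measurable_funM; exact: measurable_funX.
- move=> w _; rewrite lee_fin; apply: ler_pM => //;
  by rewrite /clip ge_min ge_max lexx sqr_ge0.
Unshelve. all: by end_near. Qed.

End Pointwise.

(** * Second moments *)

Section SumSecondMoment.
Context d (T : measurableType d) (R : realType) (mu : {measure set T -> \bar R}).

(** Think of [h j] as a covariance at lag j: each of the first k lags costs C, and the later ones
    are summable. The induction keeps min(m, k) of the former and m - k of the latter. *)
Let cov_sum_le (C S : R) (r h : nat -> R) (k M : nat) : 0 <= C ->
  (forall N, \sum_(1 <= l < N) r l <= S) ->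
  (forall j, (0 < j <= M)%N -> h j <= C) ->
  (forall l, (0 < l)%N -> (k + l <= M)%N -> h (k + l)%N <= C * r l) ->
  \sum_(1 <= j < M.+1) h j <= C * (k%:R + S).
Proof.
move=> C0 HS h1 h2.
suff H m : (m <= M)%N -> \sum_(1 <= j < m.+1) h j <=
    C * (minn m k)%:R + C * \sum_(1 <= l < (m - k).+1) r l.
  apply: le_trans (H M (leqnn M)) _; rewrite -mulrDr ler_wpM2l// lerD//.
  by rewrite ler_nat geq_minr.
elim: m => [_|m IH mM]; first by rewrite big_nil min0n mulr0 add0r sub0n big_nil mulr0.
rewrite big_nat_recr//; have {}IH := IH (ltnW mM); have [mk|km] := leqP m.+1 k.
  have e1 : minn m.+1 k = m.+1 by apply/minn_idPl.
  have e2 : minn m k = m by apply/minn_idPl; exact: ltnW.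
  have e3 : (m.+1 - k = 0)%N by apply/eqP; rewrite subn_eq0.
  have e4 : (m - k = 0)%N by apply/eqP; rewrite subn_eq0; exact: ltnW.
  move: IH; rewrite ?e1 e2 e3 e4 big_nil mulr0 !addr0 -natr1 mulrDr mulr1 => IH.
  by apply: lerD => //; exact: h1.
have e1 : minn m.+1 k = k by apply/minn_idPr; exact: ltnW.
have e2 : minn m k = k by apply/minn_idPr.
move: IH; rewrite ?e1 e2 subSn// => IH.
rewrite [X in _ <= _ + _ * X]big_nat_recr// mulrDr addrA.
apply: lerD => //; have e : (m.+1 = k + (m - k).+1)%N by rewrite addnS subnKC.
by rewrite {1}e; apply: h2; rewrite -?e.
Qed.

(** Adding one term increases the second moment by its own, at most C, plus twice its covariances
    with the earlier terms, at most C (k + S). The offset k is there because lag-k products whose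
    indices differ by at most k overlap in time. *)
Lemma sum_second_moment (xi : nat -> T -> R) (C S : R) (r : nat -> R) (k m : nat) :
  (forall j, L2 mu (xi j)) -> 0 <= C ->
  (forall N, \sum_(1 <= l < N) r l <= S) ->
  (forall j, ipm mu (xi j) (xi j) <= C) ->
  (forall i l, (0 < l)%N -> ipm mu (xi i) (xi (i + (k + l))%N) <= C * r l) ->
  ipm mu (fun x => \sum_(1 <= j < m.+1) xi j x) (fun x => \sum_(1 <= j < m.+1) xi j x)
  <= m%:R * (C * (1 + 2 * (k%:R + S))).
Proof.
move=> Lxi C0 HS h1 h2; elim: m => [|m IH].
  rewrite mul0r; under [X in ipm _ X]eq_fun do rewrite big_nil.
  by rewrite ip0l.
pose A x := \sum_(1 <= j < m.+1) xi j x.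
have LA : L2 mu A by exact: L2_sum.
have -> : (fun x => \sum_(1 <= j < m.+2) xi j x) = (fun x => A x + xi m.+1 x).
  by apply/funext => x; rewrite big_nat_recr.
rewrite ip_sqD//.
have HA : ipm mu A (xi m.+1) <= C * (k%:R + S).
  rewrite /A ip_suml//.
  (* The sum is reversed so that the index becomes the lag. *)
  have -> : \sum_(1 <= j < m.+1) ipm mu (xi j) (xi m.+1) =
      \sum_(1 <= j < m.+1) ipm mu (xi (m.+1 - j)%N) (xi m.+1).
    by rewrite big_nat_rev /=; apply: eq_bigr => j _; rewrite add1n subSS.
  apply: (@cov_sum_le C S r (fun j => ipm mu (xi (m.+1 - j)%N) (xi m.+1)) k m) => //.
    move=> j _; have := ip_ge0 mu (fun x => xi (m.+1 - j)%N x - xi m.+1 x).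
    rewrite ip_sqB//; have := h1 (m.+1 - j)%N; have := h1 m.+1.
    move: (ipm mu (xi (m.+1 - j)%N) _) (ipm mu _ (xi m.+1)) (ipm mu (xi m.+1) (xi m.+1)).
    by move=> x y z; lra.
  move=> l l0 lm; have := h2 (m.+1 - (k + l))%N l l0.
  by rewrite subnK// leqW.
have aux (x y z M D : R) : x <= M -> y <= D -> z <= C -> x + 2 * y + z <= M + C + 2 * D.
  by lra.
apply: (le_trans (aux _ _ _ _ _ IH HA (h1 m.+1))).
by rewrite -[m.+1%:R]natr1 [leRHS]mulrDl mul1r -addrA lerD2l [leRHS]mulrDr mulr1 [C * (2 * _)]mulrCA.
Qed.

End SumSecondMoment.

Lemma ae_prod d1 d2 (S : measurableType d1) (T : measurableType d2) (R : realType)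
  (nu : {sigma_finite_measure set S -> \bar R}) (mu : {sigma_finite_measure set T -> \bar R})
  (Q : S -> Prop) (Q' : T -> Prop) :
  {ae nu, forall x, Q x} -> {ae mu, forall y, Q' y} ->
  {ae (nu \x mu)%E, forall q, Q q.1 /\ Q' q.2}.
Proof.
move=> [N [mN N0 QN]] [M [mM M0 QM]].
exists (N `*` setT `|` setT `*` M); split.
- by apply: measurableU; apply: measurableX.
- have e1 : (nu \x mu)%E (N `*` setT) = 0%E.
    by transitivity (nu N * mu setT)%E; [exact: product_measure1E|rewrite N0 mul0e].
  have e2 : (nu \x mu)%E (setT `*` M) = 0%E.
    by transitivity (nu setT * mu M)%E; [exact: product_measure1E|rewrite M0 mule0].
  by apply: null_set_setU => //; exact: measurableX.
- move=> [x y] /= H; have [Qx|nQx] := pselect (Q x).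
    right; split => //; apply: QM => /= Qy; exact: H.
  by left; split => //; exact: QN.
Qed.

Lemma tensor_norm d1 d2 (S : measurableType d1) (T : measurableType d2) (R : realType)
  (nu : {sigma_finite_measure set S -> \bar R}) (mu : {sigma_finite_measure set T -> \bar R})
  (f : S -> R) (g : T -> R) : L2 nu f -> L2 mu g ->
  ipm (nu \x mu)%E (fun q => f q.1 * g q.2) (fun q => f q.1 * g q.2) = ipm nu f f * ipm mu g g.
Proof.
move=> Lf Lg; have LT := L2_tensor Lf Lg.
have [<- _] := L2K_fubini LT LT.
rewrite /ipm -RintegralZr//; last exact: L2_mul.
apply: eq_Rintegral => x _; rewrite -RintegralZl//; last exact: L2_mul.
by apply: eq_Rintegral => y _; rewrite mulrACA.
Qed.

Section Moments.
Context (R : realType) (a b : R) (dO : measure_display) (Omega : measurableType dO).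
Variable P : probability Omega R.
Variable Y : int -> Omega -> R -> R.
Hypothesis mY : forall t, measurable_fun setT (fun q : Omega * R => Y t q.1 q.2).
Hypothesis stY : strictly_stationary a b P Y.
Hypothesis C2Y : C2 a b P Y.
Local Notation mu := (muI a b).

Let S t w := (\int[mu]_u (Y t w u ^+ 2)%:E)%E.

Let S_ge0 t w : (0 <= S t w)%E.
Proof. by apply: integral_ge0 => u _; rewrite lee_fin sqr_ge0. Qed.

Let mS t : measurable_fun setT (S t).
Proof.
apply: (@measurable_integral2 _ _ _ _ _ mu (fun w u => (Y t w u ^+ 2)%:E)).
  by move=> w u; rewrite lee_fin sqr_ge0.
by apply: (@measurable_sqrE _ _ Omega (measurableTypeR R) R (Y t)); exact: mY.
Qed.

Let SS_lty t : (\int[P]_w (S t w * S t w) < +oo)%E.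
Proof.
have e w : S t w = (\int[@leb R]_(u in Iab a b) (Y t w u ^+ 2)%:E)%E.
  apply: integral_muI; apply/measurable_EFinP; apply: measurable_funX.
  exact: (measurable_Yw mY).
under eq_integral do rewrite e.
exact: C2Y.
Qed.

Lemma ae_L2_Y t : {ae P, forall w, L2 mu (Y t w)}.
Proof.
have iS : P.-integrable setT (fun w => S t w * S t w)%E.
  apply/integrableP; split; first exact: emeasurable_funM.
  apply: le_lt_trans (SS_lty t); rewrite le_eqVlt; apply/orP; left; apply/eqP.
  by apply: eq_integral => w _; rewrite gee0_abs// mule_ge0.
have := integrable_ae measurableT iS; apply: filterS => w /(_ I) SSf.
apply: L2P; first exact: (measurable_Yw mY).
rewrite ltNge leye_eq; apply/negP => /eqP e.
by move: SSf; rewrite /S e mulyy.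
Qed.

Definition sqnorm t w : R := ipm mu (Y t w) (Y t w).

Let sqnormE t : {ae P, forall w, (sqnorm t w)%:E = S t w}.
Proof. by have := ae_L2_Y t; apply: filterS => w Lw; rewrite /sqnorm ipE. Qed.

Lemma measurable_sqnorm t : measurable_fun setT (sqnorm t).
Proof.
apply: (@measurable_Rintegral2 _ _ _ _ _ mu (fun w u => Y t w u * Y t w u)).
by apply: measurable_funM; exact: mY.
Qed.

Lemma L2_sqnorm t : L2 P (sqnorm t).
Proof.
apply: L2P; first exact: measurable_sqnorm.
apply: le_lt_trans (SS_lty t); apply: ae_ge0_le_integral => //.
- by move=> w _; rewrite lee_fin sqr_ge0.
- by apply/measurable_EFinP; apply: measurable_funX; exact: measurable_sqnorm.
- by move=> w _; rewrite mule_ge0.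
- exact: emeasurable_funM.
- by have := sqnormE t; apply: filterS => w <- _; rewrite -EFinM expr2.
Qed.

Lemma L2K_Y t : L2K P mu (Y t).
Proof.
apply: L2K_lty; first exact: mY.
have : (\int[P]_w (sqnorm t w)%:E < +oo)%E.
  by apply: integrable_lty => //; exact: L2_integrable (L2_sqnorm t).
apply: le_lt_trans.
rewrite le_eqVlt; apply/orP; left; apply/eqP; apply: ae_eq_integral => //.
- exact: mS.
- by apply/measurable_EFinP; exact: measurable_sqnorm.
- by have := sqnormE t; apply: filterS => w /= -> _.
Qed.

Lemma ae_regular_nat : {ae mu, forall u, forall n : nat, regular_pt a b P Y n%:Z u}.
Proof. by apply: ae_foralln => n; apply: ae_regular_pt => //; exact: ae_L2_Y. Qed.

Let quad t w u v := (Y t w u ^+ 2 * Y t w v ^+ 2)%:E : \bar R.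

Let quad_ge0 t w u v : (0 <= quad t w u v)%E.
Proof. by rewrite lee_fin mulr_ge0 ?sqr_ge0. Qed.

Let m_quad t d (V : measurableType d) (f1 : V -> Omega) (f2 f3 : V -> measurableTypeR R) :
  measurable_fun setT f1 -> measurable_fun setT f2 -> measurable_fun setT f3 ->
  measurable_fun setT (fun q => quad t (f1 q) (f2 q) (f3 q)).
Proof.
move=> m1 m2 m3; apply/measurable_EFinP.
have mYf f : measurable_fun setT f -> measurable_fun setT (fun q : V => Y t (f1 q) (f q) ^+ 2).
  move=> mf; apply: measurable_funX.
  by have := measurableT_comp (mY t) (measurable_fun_pair m1 mf).
by apply: measurable_funM; exact: mYf.
Qed.

(** The fourth moment of the norm becomes a double integral of the two-point moments E Y_t(u)^2
    Y_t(v)^2, to which stationarity applies for almost every u and v. *)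
Let sqnorm2E t : (ipm P (sqnorm t) (sqnorm t))%:E =
  (\int[mu]_u \int[mu]_v \int[P]_w quad t w u v)%E.
Proof.
rewrite (ipE (L2_sqnorm t)).
transitivity (\int[P]_w \int[mu]_u \int[mu]_v quad t w u v)%E.
  apply: ae_eq_integral => //.
  - by apply/measurable_EFinP; apply: measurable_funX; exact: measurable_sqnorm.
  - apply: (@measurable_integral2 _ _ _ _ _ mu (fun w u => \int[mu]_v quad t w u v)%E).
      by move=> w u; apply: integral_ge0.
    apply: (@measurable_integral2 _ _ _ _ _ mu (fun (q : Omega * measurableTypeR R) v => quad t q.1 q.2 v)).
      by move=> q v.
    by apply: m_quad => //; exact: measurableT_comp.
  - have := ae_L2_Y t; apply: filterS => w Lw _.
    have mw : measurable_fun setT (fun u : measurableTypeR R => (Y t w u ^+ 2)%:E).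
      by apply/measurable_EFinP; apply: measurable_funX; exact: L2_measurable Lw.
    have e u : (\int[mu]_v quad t w u v = (sqnorm t w)%:E * (Y t w u ^+ 2)%:E)%E.
      under eq_integral do rewrite /quad EFinM.
      rewrite ge0_integralZl_EFin ?sqr_ge0//; last by move=> v _; rewrite lee_fin sqr_ge0.
      by rewrite /sqnorm (ipE Lw) muleC.
    under eq_integral do rewrite e.
    rewrite ge0_integralZl_EFin//; last 2 first.
    - by move=> v _; rewrite lee_fin sqr_ge0.
    - exact: ip_ge0.
    by rewrite -(ipE Lw) -EFinM expr2.
rewrite (@fubini_tonelli _ _ _ _ _ P mu (fun q : Omega * measurableTypeR R =>
  (\int[mu]_v quad t q.1 q.2 v)%E))//; last 2 first.
- apply: (@measurable_integral2 _ _ _ _ _ mu (fun (q : Omega * measurableTypeR R) v => quad t q.1 q.2 v)).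
    by move=> q v.
  by apply: m_quad => //; exact: measurableT_comp.
- by move=> q; apply: integral_ge0.
apply: eq_integral => u _ /=.
rewrite (@fubini_tonelli _ _ _ _ _ P mu (fun q : Omega * measurableTypeR R => quad t q.1 u q.2))//.
by apply: m_quad => //; exact: measurable_cst.
Qed.

Lemma sqnorm2_le (n : nat) :
  ipm P (sqnorm n%:Z) (sqnorm n%:Z) <= ipm P (sqnorm 0) (sqnorm 0).
Proof.
rewrite -lee_fin !sqnorm2E.
have m1 t u : measurable_fun setT (fun v => \int[P]_w quad t w u v)%E.
  apply: (@measurable_integral2 _ _ _ _ _ P (fun v w => quad t w u v)) => //.
  by apply: m_quad => //; exact: measurable_cst.
have m2 t : measurable_fun setT (fun u => \int[mu]_v \int[P]_w quad t w u v)%E.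
  apply: (@measurable_integral2 _ _ _ _ _ mu (fun u v => \int[P]_w quad t w u v)%E) => //.
    by move=> u v; apply: integral_ge0.
  apply: (@measurable_integral2 _ _ _ _ _ P (fun (q : measurableTypeR R * measurableTypeR R) w =>
     quad t w q.1 q.2)) => //.
  by apply: m_quad => //; exact: measurableT_comp.
apply: ae_ge0_le_integral; first exact: measurableT.
- by move=> u _; apply: integral_ge0 => v _; exact: integral_ge0.
- exact: m2.
- by move=> u _; apply: integral_ge0 => v _; exact: integral_ge0.
- exact: m2.
have := ae_regular_nat; apply: filterS => u ru _.
apply: ae_ge0_le_integral; first exact: measurableT.
- by move=> v _; exact: integral_ge0.
- exact: m1.
- by move=> v _; exact: integral_ge0.
- exact: m1.
have := ae_regular_nat; apply: filterS => v rv _.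
rewrite /quad; exact: (stationary_sqr mY stY (ru n) (rv n) (ru 0%N) (rv 0%N)).
Qed.

Definition mean u : R := \int[P]_w Y 0 w u.

Definition centred t w u : R := Y t w u - mean u.

Local Notation W := centred.

Lemma L2_mean : L2 mu mean.
Proof.
have [H _] := kernel_op_L2 (L2K_tr (L2K_Y 0)) (L2_cst P 1).
by apply: eq_L2 H => u; apply: eq_Rintegral => w _; rewrite mulr1.
Qed.

Lemma L2K_centred t : L2K P mu (W t).
Proof.
apply: L2B; first exact: L2K_Y.
by apply: (eq_L2 _ (L2_tensor (L2_cst P 1) L2_mean)) => q /=; rewrite mul1r.
Qed.

Lemma ae_L2_centred t : {ae P, forall w, L2 mu (W t w)}.
Proof. exact: ae_L2_section (L2K_centred t). Qed.

Definition sqnorm_centred t w : R := ipm mu (W t w) (W t w).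

Lemma L2_sqnorm_centred : exists2 C, 0 <= C & forall n : nat,
  L2 P (sqnorm_centred n%:Z) /\ ipm P (sqnorm_centred n%:Z) (sqnorm_centred n%:Z) <= C.
Proof.
pose m := ipm mu mean mean.
(* From |Y - mean|^2 <= 2 |Y|^2 + 2m, and the square of 2x + 2z is at most 8x^2 + 8z^2. *)
exists (8 * ipm P (sqnorm 0) (sqnorm 0) + 8 * m ^+ 2).
  by rewrite addr_ge0 ?mulr_ge0 ?ip_ge0 ?sqr_ge0.
move=> n.
have mW : measurable_fun setT (sqnorm_centred n%:Z).
  apply: (@measurable_Rintegral2 _ _ _ _ _ mu (fun w u => W n%:Z w u * W n%:Z w u)).
  by apply: measurable_funM; exact: L2K_measurable (L2K_centred n%:Z).
have iB : P.-integrable setT (EFin \o (fun w => 8 * sqnorm n%:Z w ^+ 2 + 8 * m ^+ 2)).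
  apply: integrable_addR.
    by apply: integrable_scaleR; case: (L2_sqnorm n%:Z).
  exact: finite_measure_integrable_cst.
have [|LW le] := L2_sqr_le mW iB.
  have := ae_L2_Y n%:Z; apply: filterS => w Lw.
  have aux (x y z : R) : 0 <= x -> 0 <= y -> 0 <= z -> y <= 2 * x + 2 * z ->
      y ^+ 2 <= 8 * x ^+ 2 + 8 * z ^+ 2.
    move=> x0 y0 z0 h; have h1 : 0 <= (x - z) ^+ 2 by exact: sqr_ge0.
    have h2 : y ^+ 2 <= (2 * x + 2 * z) ^+ 2 by rewrite ler_sqr ?nnegrE// addr_ge0// mulr_ge0.
    by nra.
  exact: (aux (sqnorm n%:Z w) (sqnorm_centred n%:Z w) m (ip_ge0 _ _) (ip_ge0 _ _) (ip_ge0 _ _)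
    (ip_sub_le Lw L2_mean)).
split => //; apply: le_trans le _.
rewrite RintegralD//; last 2 first.
- by apply: integrable_scaleR; case: (L2_sqnorm n%:Z).
- exact: finite_measure_integrable_cst.
rewrite Rintegral_cst// [X in _ * X](_ : _ = 1); last by rewrite [X in fine X]probability_setT.
rewrite mulr1 lerD2r RintegralZl//; last by case: (L2_sqnorm n%:Z).
rewrite ler_pM2l//; apply: le_trans (sqnorm2_le n).
by rewrite le_eqVlt; apply/orP; left; apply/eqP; apply: eq_Rintegral => w _; rewrite expr2.
Qed.

End Moments.

(** Applying [L2_sqr_le] to the square root of |f| gives integrability and the bound at once. *)
Lemma Rintegral_ae_le d (T : measurableType d) (R : realType)
  (nu : {sigma_finite_measure set T -> \bar R}) (f g : T -> R) :
  measurable_fun setT f -> nu.-integrable setT (EFin \o g) ->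
  {ae nu, forall x, `|f x| <= g x} -> \int[nu]_x f x <= \int[nu]_x g x.
Proof.
move=> mf ig fg.
have e x : Num.sqrt `|f x| * Num.sqrt `|f x| = `|f x| by rewrite -expr2 sqr_sqrtr.
have ms : measurable_fun setT (fun x => Num.sqrt `|f x|).
  apply: (@measurableT_comp _ _ _ _ _ _ (@Num.sqrt R)); last exact: measurableT_comp.
  by apply: continuous_measurable_fun; exact: sqrt_continuous.
have [|[_ Lf] le] := @L2_sqr_le _ _ _ nu _ g ms ig.
  by apply: filterS fg => x; rewrite sqr_sqrtr.
apply: le_trans (le_trans (ler_norm _) _) le.
rewrite [leRHS](_ : _ = \int[nu]_x `|f x|); last by apply: eq_Rintegral => x _; exact: e.
apply: le_normr_Rintegral => //.
by apply: (integrable_le mf Lf) => x; rewrite sqr_sqrtr.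
Qed.

(** The variance of a sum of random elements of L2(nu) with common mean m, from pointwise covariance
    bounds. It serves for the lag-k products on the square and for the centred process itself on the
    interval. The factor 4 comes from |Z - m|^2 <= 2 |Z|^2 + 2 |m|^2 and |m|^2 <= C. *)
Lemma mixing_second_moment d1 d2 (Omega : measurableType d1) (T : measurableType d2)
  (R : realType) (P : probability Omega R)
  (nu : {sigma_finite_measure set T -> \bar R})
  (Z : nat -> Omega -> T -> R) (m : T -> R) (C S : R) (r : nat -> R) (k n : nat) :
  (forall j, L2K P nu (Z j)) -> 0 <= C ->
  (forall j, ipm (P \x nu)%E (fun q => Z j q.1 q.2) (fun q => Z j q.1 q.2) <= C) ->
  measurable_fun setT m ->
  (forall j, {ae nu, forall t, \int[P]_w Z j w t = m t}) ->
  (forall l, 0 <= r l) -> (forall N, \sum_(1 <= l < N) r l <= S) ->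
  (forall i l, (0 < l)%N -> {ae nu, forall t,
    `| \int[P]_w (Z i w t * Z (i + (k + l))%N w t) -
       \int[P]_w Z i w t * \int[P]_w Z (i + (k + l))%N w t | <=
    r l * (\int[P]_w `|Z i w t| * \int[P]_w `|Z (i + (k + l))%N w t|)}) ->
  L2 nu m /\
  (forall j, L2K P nu (fun w t => Z j w t - m t)) /\
  ipm (P \x nu)%E (fun q => \sum_(1 <= j < n.+1) (Z j q.1 q.2 - m q.2))
                  (fun q => \sum_(1 <= j < n.+1) (Z j q.1 q.2 - m q.2))
  <= n%:R * (4 * C * (1 + 2 * (k%:R + S))).
Proof.
move=> LZ C0 ZC mm EZ r0 rS cov.
have L1 := L2_cst P 1; have n1 := ip_cst1 P.
have LZt j := ae_L2_section (L2K_tr (LZ j)).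
have sqE j (t : T) : L2 P (fun w => Z j w t) -> (\int[P]_w `|Z j w t|) ^+ 2 <= ipm P (fun w => Z j w t) (fun w => Z j w t).
  move=> Lj; have Lj' : L2 P (fun w => `|Z j w t|).
    apply: (L2_le _ Lj); last by move=> w; rewrite normr_id.
    by apply: measurableT_comp => //; exact: L2_measurable Lj.
  have := Rintegral_sqr_le Lj'.
  move=> /le_trans; apply; rewrite le_eqVlt; apply/orP; left; apply/eqP.
  by apply: eq_Rintegral => w _; rewrite -normrM ger0_norm// -expr2 sqr_ge0.
have swap j : \int[nu]_t ipm P (fun w => Z j w t) (fun w => Z j w t) =
    ipm (P \x nu)%E (fun q => Z j q.1 q.2) (fun q => Z j q.1 q.2).
  by have [_ <-] := L2K_fubini (LZ j) (LZ j).
have intZ j : nu.-integrable setT (EFin \o (fun t => ipm P (fun w => Z j w t) (fun w => Z j w t))).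
  exact: integrable_section (L2K_tr (LZ j)).
have [Lm mC] : L2 nu m /\ ipm nu m m <= C.
  have [|Lm le] := L2_sqr_le mm (intZ 0%N).
    apply: filterS2 (LZt 0%N) (EZ 0%N) => t Lt <-.
    exact: Rintegral_sqr_le.
  by split => //; apply: le_trans le _; rewrite swap.
have Lm2 : L2K P nu (fun _ t => m t).
  by apply: (eq_L2 _ (L2_tensor L1 Lm)) => q /=; rewrite mul1r.
have Lxi j : L2K P nu (fun w t => Z j w t - m t) by exact: (L2B (LZ j) Lm2).
have nm2 : ipm (P \x nu)%E (fun q => m q.2) (fun q => m q.2) = ipm nu m m.
  rewrite -[RHS]mul1r -n1 -(tensor_norm L1 Lm).
  by apply: eq_Rintegral => q _; rewrite /= !mul1r.
split => //; split => //.
apply: (@sum_second_moment _ _ _ _ (fun j q => Z j q.1 q.2 - m q.2) (4 * C) S r k n) => //.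
- by rewrite mulr_ge0.
- move=> j; apply: le_trans (ip_sub_le (LZ j) Lm2) _; rewrite nm2.
  have := ZC j; move: mC.
  have aux (x y z : R) : x <= z -> y <= z -> 2 * y + 2 * x <= 4 * z by lra.
  exact: aux.
move=> i l l0; set j := (i + (k + l))%N.
have [_ <-] := L2K_fubini (Lxi i) (Lxi j).
(* The product of first moments is split by xy <= (x^2 + y^2)/2, and each square by Jensen, which
   leaves section norms whose integrals are at most C. *)
apply: (@le_trans _ _ (\int[nu]_t (r l / 2 * ipm P (fun w => Z i w t) (fun w => Z i w t) +
    r l / 2 * ipm P (fun w => Z j w t) (fun w => Z j w t)))); last first.
  rewrite RintegralD//; [|exact: integrable_scaleR..].
  rewrite !RintegralZl// !swap.
  have := ZC i; have := ZC j; have := r0 l.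
  have aux (x y z c : R) : 0 <= z -> y <= c -> x <= c -> 0 <= c -> z / 2 * x + z / 2 * y <= 4 * c * z by nra.
  by move=> h1 h2 h3; apply: aux.
apply: Rintegral_ae_le.
- refine (@measurable_Rintegral2' _ _ _ _ _ P (fun w t => (Z i w t - m t) * (Z j w t - m t)) _).
  by apply: measurable_funM; exact: L2K_measurable (Lxi _).
- by apply: integrable_addR; exact: integrable_scaleR.
have FF : Filter (nbhs (almost_everywhere nu)) := ae_filter_ringOfSetsType nu.
near=> t.
have Li : L2 P (fun w => Z i w t) by near: t; exact: LZt.
have Lj : L2 P (fun w => Z j w t) by near: t; exact: LZt.
have Ei : \int[P]_w Z i w t = m t by near: t; exact: EZ.
have Ej : \int[P]_w Z j w t = m t by near: t; exact: EZ.
have ct : `| \int[P]_w (Z i w t * Z j w t) - \int[P]_w Z i w t * \int[P]_w Z j w t | <=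
    r l * (\int[P]_w `|Z i w t| * \int[P]_w `|Z j w t|) by near: t; exact: cov.
have -> : \int[P]_w ((Z i w t - m t) * (Z j w t - m t)) =
    \int[P]_w (Z i w t * Z j w t) - \int[P]_w Z i w t * \int[P]_w Z j w t.
  have Lc : L2 P (fun=> m t) by apply: (eq_L2 _ (L2Z (m t) L1)) => w /=; rewrite mulr1.
  have := ipBl Li Lc (L2B Lj Lc); rewrite /ipm => ->.
  have := ipBr Lj Lc Li; rewrite /ipm => ->; have := ipBr Lj Lc Lc; rewrite /ipm => ->.
  have E1 h : L2 P h -> \int[P]_w (m t * h w) = m t * \int[P]_w h w.
    by move=> Lh; rewrite RintegralZl//; exact: L2_integrable Lh.
  have -> : \int[P]_w (Z i w t * m t) = m t * m t.
    by under eq_Rintegral do rewrite mulrC; rewrite E1// Ei.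
  rewrite (E1 _ Lj) (E1 _ Lc) Ei Ej.
  have -> : \int[P]_w m t = m t.
    by rewrite Rintegral_cst// [X in _ * fine X]probability_setT mulr1.
  by rewrite subrr subr0.
apply: le_trans ct _.
have := sqE i t Li; have := sqE j t Lj; have := r0 l.
set x := \int[P]_w _; set y := \int[P]_w _.
set x2 := ipm _ _ _; set y2 := ipm _ _ _.
have aux (r' x' y' x2' y2' : R) : 0 <= r' -> y' ^+ 2 <= y2' -> x' ^+ 2 <= x2' ->
    r' * (x' * y') <= r' / 2 * x2' + r' / 2 * y2'.
  move=> r0' hy hx; have : 0 <= r' * (x' - y') ^+ 2 by rewrite mulr_ge0 ?sqr_ge0.
  have : 0 <= r' * (x2' - x' ^+ 2) by rewrite mulr_ge0 ?subr_ge0.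
  have : 0 <= r' * (y2' - y' ^+ 2) by rewrite mulr_ge0 ?subr_ge0.
  by nra.
move=> h1 h2 h3; exact: aux.
Unshelve. all: by end_near.
Qed.

Section Square.
Context (R : realType) (a b : R).
(** The product measure is named in order to carry a finite measure structure, so that it can be a
    factor of a further product with P. *)
Definition muI2 := (muI a b \x muI a b)%E.
HB.instance Definition _ := Measure.on muI2.
Let muI2_fin : fin_num_fun muI2.
Proof.
have E := @product_measure1E _ _ _ _ _ (muI a b) (muI a b) _ _ measurableT measurableT.
rewrite setXTT in E; apply: lty_fin_num_fun.
apply: (@eq_ind_r _ _ (fun x => (x < +oo)%E) _ _ E).
by apply: lte_mul_pinfty; [exact: measure_ge0|exact: fin_num_measure|rewrite ltey_eq fin_num_measure].
Qed.
HB.instance Definition _ := Measure_isFinite.Build _ _ _ muI2 muI2_fin.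

#[global] Instance muI2_ae_filter : Filter (nbhs (almost_everywhere muI2)) :=
  ae_filter_ringOfSetsType muI2.

End Square.

Section Fluctuations.
Context (R : realType) (a b : R) (dO : measure_display) (Omega : measurableType dO).
Variable P : probability Omega R.
Variable Y : int -> Omega -> R -> R.
Hypothesis mY : forall t, measurable_fun setT (fun q : Omega * R => Y t q.1 q.2).
Hypothesis stY : strictly_stationary a b P Y.
Hypothesis C2Y : C2 a b P Y.
Hypothesis psiY : forall l, (0 < l)%N -> (psi a b P Y l < +oo)%E.
Local Notation mu := (muI a b).
Local Notation mu2 := (muI2 a b).
Local Notation W := (centred P Y).
Local Notation sqnormW := (sqnorm_centred a b P Y).

Let mW t : measurable_fun setT (fun q : Omega * measurableTypeR R => W t q.1 q.2).
Proof. exact: L2K_measurable (L2K_centred mY C2Y t). Qed.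

Definition centred2 (s t : int) w (q : measurableTypeR R * measurableTypeR R) : R := W s w q.1 * W t w q.2.

Local Notation W2 := centred2.

Let mW2 s t : measurable_fun setT (fun x : Omega * (measurableTypeR R * measurableTypeR R) => W2 s t x.1 x.2).
Proof.
apply: measurable_funM.
  apply: (measurableT_comp (mW s) (g := fun x : Omega * (measurableTypeR R * measurableTypeR R) => (x.1, x.2.1))).
  by apply: measurable_fun_pair => //; exact: measurableT_comp.
apply: (measurableT_comp (mW t) (g := fun x : Omega * (measurableTypeR R * measurableTypeR R) => (x.1, x.2.2))).
by apply: measurable_fun_pair => //; exact: measurableT_comp.
Qed.

(** The squared norm of the tensor product of W_s and W_t is |W_s|^2 |W_t|^2; Cauchy-Schwarz over P
    bounds its mean by the fourth moments. *)
Lemma L2K_centred2 : exists2 C, 0 <= C & forall s t : nat,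
  L2K P mu2 (W2 s%:Z t%:Z) /\
  ipm (P \x mu2)%E (fun x => W2 s%:Z t%:Z x.1 x.2) (fun x => W2 s%:Z t%:Z x.1 x.2) <= C.
Proof.
have [C C0 H] := L2_sqnorm_centred mY stY C2Y.
exists C => // s t.
have [Ls les] := H s; have [Lt let_] := H t.
have aeE : {ae P, forall w, (\int[mu2]_q (W2 s%:Z t%:Z w q ^+ 2)%:E)%E =
    (sqnormW s%:Z w * sqnormW t%:Z w)%:E}.
  apply: filterS2 (ae_L2_centred mY C2Y s%:Z) (ae_L2_centred mY C2Y t%:Z) => w Lsw Ltw.
  by rewrite -(tensor_norm Lsw Ltw) ipE//; exact: L2_tensor.
have mS : measurable_fun setT (fun w => (\int[mu2]_q (W2 s%:Z t%:Z w q ^+ 2)%:E)%E).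
  apply: (@measurable_integral2 _ _ _ _ _ mu2 (fun w q => (W2 s%:Z t%:Z w q ^+ 2)%:E)).
    by move=> w q; rewrite lee_fin sqr_ge0.
  by apply/measurable_EFinP; apply: measurable_funX; exact: mW2.
have iS := L2_mul Ls Lt.
have intE : (\int[P]_w \int[mu2]_q (W2 s%:Z t%:Z w q ^+ 2)%:E)%E =
    (\int[P]_w (sqnormW s%:Z w * sqnormW t%:Z w)%:E)%E.
  apply: ae_eq_integral => //.
  - by have [] := integrableP _ _ _ iS.
  - by apply: filterS aeE => w -> _.
have LW2 : L2K P mu2 (W2 s%:Z t%:Z).
  apply: L2K_lty; first exact: mW2.
  by rewrite intE; exact: integrable_lty.
split => //; rewrite -lee_fin (L2KE LW2) intE.
have -> : (\int[P]_w (sqnormW s%:Z w * sqnormW t%:Z w)%:E)%E = (ipm P (sqnormW s%:Z) (sqnormW t%:Z))%:E.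
  by rewrite /ipm /Rintegral fineK//; exact: integrable_fin_num.
rewrite lee_fin.
have aux (x y z c : R) : y ^+ 2 <= x * z -> 0 <= x -> 0 <= z -> 0 <= c -> x <= c -> z <= c -> y <= c.
  move=> h x0 z0 c0 xc zc; rewrite leNgt; apply/negP => cy.
  have : y ^+ 2 <= c ^+ 2 by apply: le_trans h _; rewrite expr2 ler_pM.
  by apply/negP; rewrite -ltNge ltr_pXn2r// nnegrE// ltW// (le_lt_trans c0).
exact: (aux _ _ _ _ (ip_CS Ls Lt) (ip_ge0 _ _) (ip_ge0 _ _)).
Qed.

Lemma ip_centred_le : exists2 C, 0 <= C & forall t : nat,
  ipm (P \x mu)%E (fun x => W t%:Z x.1 x.2) (fun x => W t%:Z x.1 x.2) <= C.
Proof.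
have [C C0 H] := L2_sqnorm_centred mY stY C2Y.
(* The second moment is bounded through its square, by x <= 1 + x^2. *)
exists (1 + C); first by rewrite addr_ge0.
move=> t; have [Lt let_] := H t.
rewrite -(Rintegral_section (L2K_centred mY C2Y t%:Z)).
have := Rintegral_sqr_le Lt.
have aux (x y c : R) : x ^+ 2 <= y -> y <= c -> x <= 1 + c by nra.
by move/aux; exact.
Qed.

(** The inequality for products of two factors is applied with the constant 1, centred at 0, as
    second factor on each side. *)
Lemma pointwise_cov1 l (m s1 s3 : int) (u c1 : R) : (0 < l)%N ->
  s1 <= m -> m + l%:Z <= s3 ->
  regular_pt a b P Y s1 u -> regular_pt a b P Y s3 u ->
  L2 P (fun w => Y s1 w u - c1) -> L2 P (fun w => Y s3 w u - c1) ->
  `| \int[P]_w ((Y s1 w u - c1) * (Y s3 w u - c1)) -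
     \int[P]_w (Y s1 w u - c1) * \int[P]_w (Y s3 w u - c1) | <=
  fine (psi a b P Y l) * (\int[P]_w `|Y s1 w u - c1| * \int[P]_w `|Y s3 w u - c1|).
Proof.
move=> l0 h1 h3 r1 r3 L1 L3.
have mU t x n : measurable_fun setT (fun w => ip a b (Y t w) (avg n x)).
  by apply: measurable_ipY => //; exact: sq_int_avg.
have m1 : measurable_fun setT (fun _ : Omega => 1 : R) by [].
have cc : {ae P, forall w, (1 : R) @[n --> \oo] --> (1 : R)} by apply: aeW => w; exact: cvg_cst.
have e1 t : (fun w => (Y t w u - c1) * (1 - 0)) = (fun w => Y t w u - c1).
  by apply/funext => w; rewrite subr0 mulr1.
have L1' : L2 P (fun w => (Y s1 w u - c1) * (1 - 0)) by rewrite e1.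
have L3' : L2 P (fun w => (Y s3 w u - c1) * (1 - 0)) by rewrite e1.
have mk n A1 A2 A3 A4 : measurable A1 -> measurable A2 -> measurable A3 -> measurable A4 ->
    mix P (fine (psi a b P Y l))
      (fun w => \1_A1 (ip a b (Y s1 w) (avg n u)) * \1_A2 (1 : R))
      (fun w => \1_A3 (ip a b (Y s3 w) (avg n u)) * \1_A4 (1 : R)).
  move=> mA1 mA2 mA3 mA4.
  (* The indicator of the constant 1 is rewritten as that of the whole line or the empty set at a
     scalar product, the form [psi_rect] expects. *)
  have cstE (A : set R) : exists2 A' : set R, measurable A' & forall x, \1_A 1 = \1_A' x :> R.
    have [A1in|nA1] := pselect (A 1).
      by exists setT => // x; rewrite !indicE mem_set// in_setT.
    by exists set0 => // x; rewrite !indicE memNset// in_set0.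
  have [A2' mA2' E2] := cstE A2; have [A4' mA4' E4] := cstE A4.
  have := psi_rect mY stY (psiY l0) h1 h1 h3 h3 (sq_int_avg a b n u) (sq_int_avg a b n u)
    (sq_int_avg a b n u) (sq_int_avg a b n u) mA1 mA2' mA3 mA4'.
  rewrite (_ : (fun w => _ * \1_A2' _) = fun w => \1_A1 (ip a b (Y s1 w) (avg n u)) * \1_A2 1).
    rewrite (_ : (fun w => _ * \1_A4' _) = fun w => \1_A3 (ip a b (Y s3 w) (avg n u)) * \1_A4 1)//.
    by apply/funext => w; rewrite -E4.
  by apply/funext => w; rewrite -E2.
have := mixing_covariance (measurable_Yu mY s1 u) m1 (measurable_Yu mY s3 u) m1
  (mU s1 u) (fun=> m1) (mU s3 u) (fun=> m1) r1 cc r3 cc mk L1' L3'.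
have eN t : \int[P]_w `|(Y t w u - c1) * (1 - 0)| = \int[P]_w `|Y t w u - c1|.
  by apply: eq_Rintegral => w _; rewrite subr0 mulr1.
have eP : \int[P]_w ((Y s1 w u - c1) * (1 - 0) * ((Y s3 w u - c1) * (1 - 0))) =
    \int[P]_w ((Y s1 w u - c1) * (Y s3 w u - c1)).
  by apply: eq_Rintegral => w _; rewrite subr0 !mulr1.
by rewrite !e1 !eN eP.
Qed.

End Fluctuations.

(** * Signal plus white noise *)

Section Signal.
Context (R : realType) (a b : R) (dO : measure_display) (Omega : measurableType dO).
Variable P : probability Omega R.
Variables Y X eps : int -> Omega -> R -> R.
Hypothesis M : model a b P Y X eps.
Hypothesis C4X : C4 P X eps.
Local Notation mu := (muI a b).
Local Notation W := (centred P Y).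

Lemma model_measurable t : measurable_fun setT (fun q : Omega * R => Y t q.1 q.2).
Proof.
have [YE [mX [me _]]] := M.
rewrite (_ : (fun q => _) = fun q => X t q.1 q.2 + eps t q.1 q.2); last first.
  by apply/funext => q; rewrite YE.
exact: measurable_funD.
Qed.

Let L2K_le (F : Omega -> R -> R) t : measurable_fun setT (fun q : Omega * R => F q.1 q.2) ->
  (forall w u, F w u ^+ 2 <= X t w u ^+ 2 + eps t w u ^+ 2) -> L2K mu P (fun u w => F w u).
Proof.
move=> mF Fle; have [YE [mX [me [_ [_ [int_lty _]]]]]] := M.
have mF' : measurable_fun setT (fun q : measurableTypeR R * Omega => F q.2 q.1).
  exact: (measurableT_comp mF (@measurable_swap _ _ (measurableTypeR R) Omega)).
have mX' : measurable_fun setT (fun q : measurableTypeR R * Omega => X t q.2 q.1).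
  exact: (measurableT_comp (mX t) (@measurable_swap _ _ (measurableTypeR R) Omega)).
have me' : measurable_fun setT (fun q : measurableTypeR R * Omega => eps t q.2 q.1).
  exact: (measurableT_comp (me t) (@measurable_swap _ _ (measurableTypeR R) Omega)).
have mS : measurable_fun setT (fun u : measurableTypeR R =>
    \int[P]_w (X t w u ^+ 2 + eps t w u ^+ 2)%:E)%E.
  apply: (@measurable_integral2 _ _ (measurableTypeR R) Omega R P
    (fun u w => (X t w u ^+ 2 + eps t w u ^+ 2)%:E)).
    by move=> u w; rewrite lee_fin addr_ge0 ?sqr_ge0.
  by apply/measurable_EFinP; apply: measurable_funD; apply: measurable_funX.
apply: L2K_lty; first exact: mF'.
have := int_lty t; rewrite -(@integral_muI R a b); last exact: mS.
apply: le_lt_trans.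
apply: ge0_le_integral; first exact: measurableT.
- by move=> u _; apply: integral_ge0 => w _; rewrite lee_fin sqr_ge0.
- apply: (@measurable_integral2 _ _ (measurableTypeR R) Omega R P (fun u w => (F w u ^+ 2)%:E)).
    by move=> u w; rewrite lee_fin sqr_ge0.
  by apply/measurable_EFinP; apply: measurable_funX.
- exact: mS.
move=> u _; apply: ge0_le_integral; first exact: measurableT.
- by move=> w _; rewrite lee_fin sqr_ge0.
- apply/measurable_EFinP; apply: measurable_funX.
  exact: (@measurable_section _ _ (measurableTypeR R) Omega R (fun u w => F w u)).
- apply/measurable_EFinP; apply: measurable_funD; apply: measurable_funX.
    exact: (@measurable_section _ _ (measurableTypeR R) Omega R (fun u w => X t w u)).
  exact: (@measurable_section _ _ (measurableTypeR R) Omega R (fun u w => eps t w u)).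
- by move=> w _; rewrite lee_fin.
Qed.

Definition square_integrable_pt (u : R) := forall t : nat,
  L2 P (fun w => X t%:Z w u) /\ L2 P (fun w => eps t%:Z w u).

Lemma ae_square_integrable_pt : {ae mu, forall u, square_integrable_pt u}.
Proof.
have [_ [mX [me _]]] := M.
apply: ae_foralln => t.
have LX : L2K mu P (fun u w => X t%:Z w u).
  by apply: (@L2K_le _ t%:Z) => // w u; rewrite lerDl sqr_ge0.
have Le : L2K mu P (fun u w => eps t%:Z w u).
  by apply: (@L2K_le _ t%:Z) => // w u; rewrite lerDr sqr_ge0.
apply: filterS2 (ae_L2_section LX) (ae_L2_section Le) => u LXu Leu; split; [exact: LXu|exact: Leu].
Qed.

Let L2_int (f : Omega -> R) : L2 P f -> P.-integrable setT (EFin \o f).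
Proof. exact: L2_integrable. Qed.

Let EY u (t : nat) : square_integrable_pt u -> \int[P]_w Y t%:Z w u = \int[P]_w X 0 w u.
Proof.
move=> su; have [YE [_ [_ [Ee [_ [_ [EX _]]]]]]] := M.
have [LX Le] := su t.
under eq_Rintegral do rewrite YE.
rewrite RintegralD//; [|exact: L2_int..].
have := Ee t%:Z u; have := EX t%:Z u; rewrite /Ex => -> ->.
by rewrite addr0.
Qed.

Lemma L2_centred u t : square_integrable_pt u -> L2 P (fun w => W (Posz t) w u).
Proof.
move=> su; have [YE _] := M; have [LX Le] := su t.
apply: (@eq_L2 _ _ _ _ (fun w => (X t%:Z w u + eps t%:Z w u) + - mean P Y u)).
  by move=> w; rewrite /centred YE.
by apply: L2D; [exact: L2D|exact: L2_cst].
Qed.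

Let meanE u : square_integrable_pt u -> mean P Y u = \int[P]_w X 0 w u.
Proof. by move=> su; rewrite -(EY 0%N su). Qed.

Let L2Y u (t : nat) : square_integrable_pt u -> L2 P (fun w => Y t%:Z w u).
Proof.
move=> su; have [YE _] := M; have [LX Le] := su t.
apply: (@eq_L2 _ _ _ _ (fun w => (X t%:Z w u + eps t%:Z w u))).
  by move=> w; rewrite YE.
exact: L2D.
Qed.

Lemma Rintegral_centred u (t : nat) : square_integrable_pt u -> \int[P]_w W t%:Z w u = 0.
Proof.
move=> su; rewrite /centred RintegralB//; last 2 first.
- exact/L2_int/L2Y.
- exact/L2_int/L2_cst.
rewrite EY// Rintegral_cst// [X in _ * fine X]probability_setT mulr1 meanE//.
exact: subrr.
Qed.

(** Of the four products in Y = X + eps, the mixed ones vanish by C4, used with the two times in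
    both orders, and the noise term vanishes because k > 0 makes the times distinct. *)
Lemma Rintegral_centred2 u v (t k : nat) : (0 < k)%N -> square_integrable_pt u -> square_integrable_pt v ->
  \int[P]_w (W t%:Z w u * W (t + k)%:Z w v) = Mk P X k u v.
Proof.
move=> k0 su sv; have [YE [_ [_ [Ee [cee [_ [EX cXX]]]]]]] := M.
have [LXu Leu] := su t; have [LXv Lev] := sv (t + k)%N.
have LYu := L2Y t su; have LYv := L2Y (t + k)%N sv.
have Lc c := L2_cst P c.
have e1 : \int[P]_w (W t%:Z w u * W (t + k)%:Z w v) =
    ipm P (fun w => Y t%:Z w u) (fun w => Y (t + k)%:Z w v) - mean P Y u * mean P Y v.
  have -> : \int[P]_w (W t%:Z w u * W (t + k)%:Z w v) =
     ipm P (fun w => Y t%:Z w u - cst (mean P Y u) w) (fun w => Y (t + k)%:Z w v - cst (mean P Y v) w) by [].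
  rewrite ipBl//; last by exact: L2B.
  rewrite ipBr// ipBr//.
  have cE c f : L2 P f -> ipm P f (cst c) = c * \int[P]_w f w.
    move=> Lf; rewrite -RintegralZl//; last exact: L2_int.
    by apply: eq_Rintegral => w _; rewrite mulrC.
  rewrite cE// (ipC _ (cst _) (fun w => Y _ w v)) cE// cE//.
  have ci c : \int[P]_w (cst c w) = c.
    by rewrite Rintegral_cst// [X in _ * fine X]probability_setT mulr1.
  rewrite ci !EY// !meanE//.
  by move: (ipm _ _ _) (\int[P]_w _) (\int[P]_w _) => x y z; ring.
have e2 : ipm P (fun w => Y t%:Z w u) (fun w => Y (t + k)%:Z w v) =
    (ipm P (fun w => X t%:Z w u) (fun w => X (t + k)%:Z w v) +
     ipm P (fun w => X t%:Z w u) (fun w => eps (t + k)%:Z w v)) +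
    (ipm P (fun w => eps t%:Z w u) (fun w => X (t + k)%:Z w v) +
     ipm P (fun w => eps t%:Z w u) (fun w => eps (t + k)%:Z w v)).
  rewrite -ipDr// -ipDr// -ipDl//; last by exact: L2D.
  by apply: eq_Rintegral => w _; rewrite !YE.
have cE f g : cov P f g = ipm P f g - \int[P]_w f w * \int[P]_w g w by [].
have c1 : ipm P (fun w => X t%:Z w u) (fun w => eps (t + k)%:Z w v) = 0.
  have := C4X t%:Z (t + k)%:Z u v; rewrite cE.
  by have := Ee (t + k)%:Z v; rewrite /Ex => ->; rewrite mulr0 subr0.
have c2 : ipm P (fun w => eps t%:Z w u) (fun w => X (t + k)%:Z w v) = 0.
  have := C4X (t + k)%:Z t%:Z v u; rewrite cE ipC.
  by have := Ee t%:Z u; rewrite /Ex => ->; rewrite mulr0 subr0.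
have c3 : ipm P (fun w => eps t%:Z w u) (fun w => eps (t + k)%:Z w v) = 0.
  have nt : t%:Z <> (t + k)%:Z by case => /eqP; rewrite -{1}(addn0 t) eqn_add2l eq_sym gtn_eqF.
  have := cee t%:Z (t + k)%:Z u v nt; rewrite cE.
  by have := Ee t%:Z u; rewrite /Ex => ->; rewrite mul0r subr0.
have c4 := cXX t%:Z k u v; rewrite !cE in c4.
rewrite e1 e2 c1 c2 c3 !addr0 !meanE// /Mk cE.
have E1 := EX t%:Z u; have E2 := EX (t%:Z + k%:Z) v; have E3 := EX k%:Z v; rewrite /Ex in E1 E2 E3.
by rewrite E1 E2 E3 in c4; rewrite E3 -c4.
Qed.

End Signal.

(** * Second moments of the sums entering the estimators *)

Section MixingSums.
Context (R : realType) (a b : R) (dO : measure_display) (Omega : measurableType dO).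
Variable P : probability Omega R.
Variables Y X eps : int -> Omega -> R -> R.
Hypothesis M : model a b P Y X eps.
Hypothesis C4X : C4 P X eps.
Hypothesis C1Y : C1 a b P Y.
Hypothesis C2Y : C2 a b P Y.
Local Notation mu := (muI a b).
Local Notation mu2 := (muI2 a b).
Local Notation W := (centred P Y).
Local Notation W2 := (centred2 P Y).
Local Notation r := (fun l => fine (psi a b P Y l)).

Let mY := model_measurable M.
Let stY : strictly_stationary a b P Y. Proof. by case: C1Y. Qed.
Let psiY l : (0 < l)%N -> (psi a b P Y l < +oo)%E.
Proof. by case: C1Y => _ [H _]; exact: H. Qed.

Lemma psi_ge0 l : 0 <= fine (psi a b P Y l).
Proof.
apply: fine_ge0; apply: ereal_sup_ubound.
have FT T : F_ a b Y T setT.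
  rewrite -(setD0 setT); apply: sigma_algebraCD; exact: sigma_algebra0.
exists setT, setT; split; [exact: FT|split; [exact: FT|]].
by rewrite setIT probability_setT /= mulr1 divr1 subrr normr0.
Qed.

(** If C bounds the partial sums of l psi(l)^(1/2), then psi(l)^(1/2) <= C for each l >= 1, hence
    psi(l) <= C l psi(l)^(1/2). *)
Lemma psi_summable : exists S, forall N, \sum_(1 <= l < N) fine (psi a b P Y l) <= S.
Proof.
have [_ [_ [C H]]] := C1Y.
have C0 : 0 <= C by have := H 0%N; rewrite big_geq.
have le l : (0 < l)%N -> Num.sqrt (r l) <= l%:R * Num.sqrt (r l).
  by move=> l0; rewrite ler_peMl ?sqrtr_ge0// ler1n.
have leC l : (0 < l)%N -> Num.sqrt (r l) <= C.
  move=> l0; apply: le_trans (le l l0) _; apply: le_trans (H l.+1).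
  rewrite big_nat_recr//= lerDr; apply: sumr_ge0 => i _.
  by rewrite mulr_ge0 ?sqrtr_ge0.
exists (C * C) => N.
apply: (@le_trans _ _ (C * \sum_(1 <= l < N) (l%:R * Num.sqrt (r l)))).
  rewrite big_distrr/= !big_nat; apply: ler_sum => l /andP[l0 _].
  rewrite -[leLHS]sqr_sqrtr ?psi_ge0// expr2 ler_pM ?sqrtr_ge0//.
  - exact: leC.
  - exact: le.
by rewrite ler_wpM2l.
Qed.

Let good u := square_integrable_pt P X eps u /\ forall n : nat, regular_pt a b P Y n%:Z u.

Let ae_good : {ae mu, forall u, good u}.
Proof.
apply: filterS2 (ae_square_integrable_pt M) (ae_regular_nat mY C2Y) => u su ru.
by split; [exact: su|exact: ru].
Qed.

Let ae_good2 : {ae mu2, forall q, good q.1 /\ good q.2}.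
Proof. exact: ae_prod ae_good ae_good. Qed.

Lemma measurable_Mk k : measurable_fun setT
  (fun q : measurableTypeR R * measurableTypeR R => Mk P X k q.1 q.2).
Proof.
have [_ [mX _]] := M.
have m1 (t : int) d (V : measurableType d) (f : V -> measurableTypeR R) : measurable_fun setT f ->
    measurable_fun setT (fun q : Omega * V => X t q.1 (f q.2)).
  move=> mf; apply: (measurableT_comp (mX t) (g := fun q : Omega * V => (q.1, f q.2))).
  by apply: measurable_fun_pair => //; exact: measurableT_comp.
have mE t d (V : measurableType d) (f : V -> measurableTypeR R) : measurable_fun setT f ->
    measurable_fun setT (fun q : V => \int[P]_w X t w (f q)).
  move=> mf; refine (@measurable_Rintegral2' _ _ _ _ _ P (fun w q => X t w (f q)) _).
  exact: m1.
apply: measurable_funB; last by apply: measurable_funM; exact: mE.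
refine (@measurable_Rintegral2' _ _ _ (measurableTypeR R * measurableTypeR R)%type _ P
  (fun w q => X 0 w q.1 * X k%:Z w q.2) _).
by apply: measurable_funM; exact: m1.
Qed.

Lemma second_moments p : exists2 C, 0 <= C &
  (forall k m, (0 < k <= p)%N ->
    [/\ L2K mu mu (Mk P X k),
        forall j : nat, L2K P mu2 (fun w q => W2 j%:Z (j + k)%:Z w q - Mk P X k q.1 q.2) &
        ipm (P \x mu2)%E
          (fun x => \sum_(1 <= j < m.+1) (W2 j%:Z (j + k)%:Z x.1 x.2 - Mk P X k x.2.1 x.2.2))
          (fun x => \sum_(1 <= j < m.+1) (W2 j%:Z (j + k)%:Z x.1 x.2 - Mk P X k x.2.1 x.2.2))
        <= m%:R * C]) /\
  (forall c m : nat,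
    ipm (P \x mu)%E (fun x => \sum_(1 <= j < m.+1) W (j + c)%:Z x.1 x.2)
                    (fun x => \sum_(1 <= j < m.+1) W (j + c)%:Z x.1 x.2) <= m%:R * C).
Proof.
have [S HS] := psi_summable.
have S0 : 0 <= S by have := HS 0%N; rewrite big_geq.
have [C1 C10 H1] := L2K_centred2 mY stY C2Y.
have [C2 C20 H2] := ip_centred_le mY stY C2Y.
(* Using p in place of k gives one constant for all lags and for both families of sums. *)
pose C := 4 * (C1 + C2) * (1 + 2 * (p%:R + S)).
have C0 : 0 <= C by rewrite !mulr_ge0 ?addr_ge0 ?mulr_ge0 ?addr_ge0.
exists C => //; split.
  move=> k m /andP[k0 kp].
  pose Z (j : nat) w q := W2 j%:Z (j + k)%:Z w q.
  have LZ j : L2K P mu2 (Z j) by case: (H1 j (j + k)%N).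
  have ZC j : ipm (P \x mu2)%E (fun x => Z j x.1 x.2) (fun x => Z j x.1 x.2) <= C1.
    by case: (H1 j (j + k)%N).
  have EZ j : {ae mu2, forall q, \int[P]_w Z j w q = Mk P X k q.1 q.2}.
    by apply: filterS ae_good2 => q [[su _] [sv _]]; exact: (Rintegral_centred2 M C4X).
  have [] := @mixing_second_moment _ _ _ _ _ P mu2 Z (fun q => Mk P X k q.1 q.2) C1 S r k m
    LZ C10 ZC (measurable_Mk k) EZ psi_ge0 HS.
    move=> i l l0.
    have LZi := ae_L2_section (L2K_tr (LZ i)).
    have LZj := ae_L2_section (L2K_tr (LZ (i + (k + l))%N)).
    apply: filterS3 ae_good2 LZi LZj => -[u v] /= [[_ ru] [_ rv]] Li Lj.
    (* The earlier product ends at time i + k and the later one starts at i + k + l, which leaves a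
       gap l. *)
    apply: (@pointwise_cov R a b dO Omega P Y mY l (i + k)%:Z) => //.
    - exact: psiY.
    - by rewrite lez_nat leq_addr.
    - by rewrite lez_nat addnA.
    - by rewrite lez_nat addnA leq_addr.
  move=> LM [Lxi le]; split => //.
  apply: le_trans le _; rewrite ler_wpM2l// /C.
  have : k%:R <= p%:R :> R by rewrite ler_nat.
  have : 0 <= k%:R :> R by [].
  move: (k%:R) (p%:R) => x y x0 xy.
  by apply: ler_pM; rewrite ?mulr_ge0 ?addr_ge0 ?mulr_ge0 ?addr_ge0//; lra.
move=> c m.
pose Z (j : nat) w u := W (j + c)%:Z w u.
have EZ j : {ae mu, forall u, \int[P]_w Z j w u = cst 0 u}.
  by apply: filterS ae_good => u [su _]; exact: (Rintegral_centred M _ su).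
have LZ j : L2K P mu (Z j) by exact: L2K_centred.
have [] := @mixing_second_moment _ _ _ _ _ P mu Z (cst 0) C2 S r 0 m
  LZ C20 (fun j => H2 (j + c)%N) (@measurable_cst _ _ _ _ _ _) EZ psi_ge0 HS.
  move=> i l l0.
  apply: filterS ae_good => u [su ru].
  apply: (@pointwise_cov1 R a b dO Omega P Y mY stY psiY l (i + c)%:Z) => //.
  - by rewrite lez_nat add0n addnAC.
  - exact: (L2_centred M (i + c) su).
  - exact: (L2_centred M (i + (0 + l) + c) su).
move=> _ [_ le].
have -> : (fun x : Omega * measurableTypeR R => \sum_(1 <= j < m.+1) W (j + c)%:Z x.1 x.2) =
    (fun x => \sum_(1 <= j < m.+1) (Z j x.1 x.2 - cst 0 x.2)).
  by apply/funext => x; apply: eq_bigr => j _; rewrite subr0.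
apply: le_trans le _; rewrite ler_wpM2l// /C.
have : 0 <= p%:R :> R by [].
move: (p%:R) => x x0.
by apply: ler_pM; rewrite ?mulr_ge0 ?addr_ge0 ?mulr_ge0 ?addr_ge0//; lra.
Qed.

End MixingSums.

(** * Sample autocovariances *)

Section SampleError.
Context (R : realType) (a b : R) (dO : measure_display) (Omega : measurableType dO).
Variable P : probability Omega R.
Variables Y X : int -> Omega -> R -> R.
Local Notation mu := (muI a b).
Local Notation mu2 := (muI2 a b).
Local Notation W := (centred P Y).
Local Notation W2 := (centred2 P Y).

Definition lag_error k m w q : R :=
  m%:R^-1 * \sum_(1 <= j < m.+1) (W2 j%:Z (j + k)%:Z w q - Mk P X k q.1 q.2).

Definition mean_error c m w u : R := m%:R^-1 * \sum_(1 <= j < m.+1) W (j + c)%:Z w u.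

Let sample_cov_expand (m : nat) (f g : nat -> R) (x y z : R) : m%:R != 0 :> R ->
  m%:R^-1 * (\sum_(1 <= j < m.+1) (f j - x) * (g j - y)) - z =
  m%:R^-1 * (\sum_(1 <= j < m.+1) (f j * g j - z)) -
  (m%:R^-1 * (\sum_(1 <= j < m.+1) f j)) * y - x * (m%:R^-1 * (\sum_(1 <= j < m.+1) g j)) + x * y.
Proof.
move=> m0.
have -> : \sum_(1 <= j < m.+1) (f j - x) * (g j - y) =
    \sum_(1 <= j < m.+1) (f j * g j - z) - (\sum_(1 <= j < m.+1) f j) * y -
    x * (\sum_(1 <= j < m.+1) g j) + m%:R * (x * y + z).
  rewrite mulr_suml mulr_sumr -!sumrB.
  have -> : m%:R * (x * y + z) = \sum_(1 <= j < m.+1) (x * y + z).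
    by rewrite sumr_const_nat subn1 /= mulr_natl.
  rewrite -big_split /=; apply: eq_bigr => j _.
  by move: (f j) (g j) => s t; ring.
move: (\sum_(1 <= j < m.+1) (f j * g j - z)) (\sum_(1 <= j < m.+1) f j)
  (\sum_(1 <= j < m.+1) g j) => s t u.
by move: m%:R m0 => e e0; field.
Qed.

Let centered n j w u : (0 < n)%N -> Y j w u - Ybar Y n w u = W j w u - mean_error 0 n w u.
Proof.
move=> n0; have n0' : n%:R != 0 :> R by rewrite pnatr_eq0 -lt0n.
have -> : Ybar Y n w u = mean P Y u + mean_error 0 n w u.
  rewrite /Ybar /mean_error -[mean P Y u](mulKf n0') -mulrDr; congr (_ * _).
  have -> : n%:R * mean P Y u = \sum_(1 <= j < n.+1) mean P Y u.
    by rewrite sumr_const_nat subn1 /= mulr_natl.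
  rewrite -big_split /=; apply: eq_bigr => i _.
  by rewrite addn0 /centred addrC subrK.
by rewrite /centred opprD addrA.
Qed.

(** [Ybar] averages all n observations while the lagged sum has n - p terms, so three empirical
    means occur: over 1..n, over 1..n-p, and over 1+k..n-p+k. *)
Lemma Mhat_error p n k w u v : (p < n)%N ->
  Mhat Y p n k w u v - Mk P X k u v =
  lag_error k (n - p) w (u, v) - mean_error 0 (n - p) w u * mean_error 0 n w v
  - mean_error 0 n w u * mean_error k (n - p) w v + mean_error 0 n w u * mean_error 0 n w v.
Proof.
move=> pn; have n0 : (0 < n)%N by apply: leq_ltn_trans pn.
have m0 : (n - p)%:R != 0 :> R by rewrite pnatr_eq0 -lt0n subn_gt0.
have -> : Mhat Y p n k w u v = (n - p)%:R^-1 * (\sum_(1 <= j < (n - p).+1)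
    (W j%:Z w u - mean_error 0 n w u) * (W (j + k)%:Z w v - mean_error 0 n w v)).
  rewrite /Mhat; congr (_ * _).
    by rewrite subzn ?(ltnW pn)// -pmulrn.
  by apply: eq_bigr => j _; rewrite !centered.
have e0 : mean_error 0 (n - p) w u = (n - p)%:R^-1 * \sum_(1 <= j < (n - p).+1) W j%:Z w u.
  by congr (_ * _); apply: eq_bigr => j _; rewrite addn0.
by rewrite sample_cov_expand// e0.
Qed.

Lemma Mhat_sec p n k w : (0 < n)%N -> (forall j : nat, L2 mu (W j%:Z w)) ->
  L2sec mu (Mhat Y p n k w).
Proof.
move=> n0 LW.
have LD : L2 mu (mean_error 0 n w) by apply: L2Z; apply: L2_sum => j; exact: LW.
have Lc j : L2 mu (fun u => W (Posz j) w u - mean_error 0 n w u) by exact: L2B.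
have e u v : Mhat Y p n k w u v = ((n%:Z - p%:Z)%:~R)^-1 * \sum_(1 <= j < (n - p).+1)
    (W j%:Z w u - mean_error 0 n w u) * (W (j + k)%:Z w v - mean_error 0 n w v).
  by congr (_ * _); apply: eq_bigr => j _; rewrite !centered.
split.
  apply: (@eq_L2 _ _ _ _ (fun q : measurableTypeR R * measurableTypeR R =>
    ((n%:Z - p%:Z)%:~R)^-1 * \sum_(1 <= j < (n - p).+1)
    (W j%:Z w q.1 - mean_error 0 n w q.1) * (W (j + k)%:Z w q.2 - mean_error 0 n w q.2))).
    by move=> q; rewrite e.
  apply: L2Z; apply: L2_sum => j; exact: L2_tensor (Lc j) (Lc (j + k)%N).
move=> u.
apply: (@eq_L2 _ _ _ _ (fun v : measurableTypeR R =>
    ((n%:Z - p%:Z)%:~R)^-1 * \sum_(1 <= j < (n - p).+1)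
    (W j%:Z w u - mean_error 0 n w u) * (W (j + k)%:Z w v - mean_error 0 n w v))).
  by move=> v; rewrite e.
by apply: L2Z; apply: L2_sum => j; apply: L2Z; exact: Lc.
Qed.

(** Each of the four terms has squared norm at most delta: a product of two means gives delta^2 <=
    delta, as delta <= 1. Applying |x + y|^2 <= 2 |x|^2 + 2 |y|^2 twice to four terms yields 16
    delta. *)
Lemma Mhat_error_le p n k w (delta : R) : (p < n)%N -> (forall j : nat, L2 mu (W j%:Z w)) ->
  L2K mu mu (Mk P X k) -> 0 <= delta <= 1 ->
  ipm mu2 (lag_error k (n - p) w) (lag_error k (n - p) w) <= delta ->
  ipm mu (mean_error 0 (n - p) w) (mean_error 0 (n - p) w) <= delta ->
  ipm mu (mean_error k (n - p) w) (mean_error k (n - p) w) <= delta ->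
  ipm mu (mean_error 0 n w) (mean_error 0 n w) <= delta ->
  (\int[mu]_u \int[mu]_v ((Mhat Y p n k w u v - Mk P X k u v) ^+ 2)%:E <= (16 * delta)%:E)%E.
Proof.
move=> pn LW LM /andP[d0 d1] hA hB hBk hD.
have LE c m : L2 mu (mean_error c m w) by apply: L2Z; apply: L2_sum => j; exact: LW.
have LA : L2 mu2 (lag_error k (n - p) w).
  apply: L2Z; apply: L2_sum => j; apply: L2B; last exact: LM.
  exact: L2_tensor (LW j) (LW (j + k)%N).
have [LMh _] := Mhat_sec p k (leq_ltn_trans (leq0n _) pn) LW.
have LMM : L2K mu mu (fun u v => Mhat Y p n k w u v - Mk P X k u v) by exact: L2B.
rewrite -(L2KE LMM) lee_fin.
have L1 : L2 mu2 (fun q => mean_error 0 (n - p) w q.1 * mean_error 0 n w q.2).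
  exact: L2_tensor (LE _ _) (LE _ _).
have L2' : L2 mu2 (fun q => mean_error 0 n w q.1 * mean_error k (n - p) w q.2).
  exact: L2_tensor (LE _ _) (LE _ _).
have L3 : L2 mu2 (fun q => mean_error 0 n w q.1 * mean_error 0 n w q.2).
  exact: L2_tensor (LE _ _) (LE _ _).
have T (f g : R -> R) : L2 mu f -> L2 mu g -> ipm mu f f <= delta -> ipm mu g g <= delta ->
    ipm mu2 (fun q => f q.1 * g q.2) (fun q => f q.1 * g q.2) <= delta.
  move=> Lf Lg hf hg; rewrite [leLHS](tensor_norm Lf Lg).
  have := ip_ge0 mu f; have := ip_ge0 mu g; move: (ipm _ _ _) (ipm _ _ _) hf hg => x y hx hy y0 x0.
  by apply: le_trans (ler_pM x0 y0 hx hy) _; rewrite ler_piMl.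
have h1 := T _ _ (LE 0%N (n - p)%N) (LE 0%N n) hB hD.
have h2 := T _ _ (LE 0%N n) (LE k (n - p)%N) hD hBk.
have h3 := T _ _ (LE 0%N n) (LE 0%N n) hD hD.
set A := lag_error k (n - p) w in hA LA.
set B := (fun q => mean_error 0 (n - p) w q.1 * mean_error 0 n w q.2) in L1 h1.
set B' := (fun q => mean_error 0 n w q.1 * mean_error k (n - p) w q.2) in L2' h2.
set D := (fun q => mean_error 0 n w q.1 * mean_error 0 n w q.2) in L3 h3.
have LAB := L2B LA L1; have LBD := L2B L3 L2'.
have -> : (fun q : measurableTypeR R * measurableTypeR R => Mhat Y p n k w q.1 q.2 - Mk P X k q.1 q.2) =
    (fun q => (A q - B q) + (D q - B' q)).
  apply/funext => -[u v]; rewrite Mhat_error// /A /B /B' /D /=.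
  by rewrite -!addrA; congr (_ + (_ + _)); exact: addrC.
apply: le_trans (ip_add_le LAB LBD) _.
have i1 := ip_sub_le LA L1; have i2 := ip_sub_le L3 L2'.
have aux (x y s t z : R) (a1 a2 : R) : a1 <= 2 * x + 2 * y -> a2 <= 2 * s + 2 * t ->
   x <= z -> y <= z -> s <= z -> t <= z -> 2 * a1 + 2 * a2 <= 16 * z by lra.
exact: (aux _ _ _ _ _ _ _ i1 i2 hA h1 h3 h2).
Qed.

End SampleError.

(** * The exceptional event *)

Section Tail.
Context (R : realType) (a b : R) (dO : measure_display) (Omega : measurableType dO).
Variable P : probability Omega R.
Variables Y X eps : int -> Omega -> R -> R.
Hypothesis M : model a b P Y X eps.
Hypothesis C4X : C4 P X eps.
Hypothesis C1Y : C1 a b P Y.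
Hypothesis C2Y : C2 a b P Y.
Local Notation mu := (muI a b).
Local Notation mu2 := (muI2 a b).
Local Notation W := (centred P Y).

Let mean_second_moment d (T : measurableType d) (nu : {sigma_finite_measure set T -> \bar R})
  (F : Omega -> T -> R) (m : nat) C : (0 < m)%N -> L2K P nu F ->
  ipm (P \x nu)%E (fun x => F x.1 x.2) (fun x => F x.1 x.2) <= m%:R * C ->
  let g := fun w => ipm nu (fun t => m%:R^-1 * F w t) (fun t => m%:R^-1 * F w t) in
  P.-integrable setT (EFin \o g) /\ \int[P]_w g w <= C / m%:R.
Proof.
move=> m0 LF le g.
have m0' : 0 < m%:R :> R by rewrite ltr0n.
have LF' : L2K P nu (fun w t => m%:R^-1 * F w t) by exact: L2Z.
split; first exact: (integrable_section LF').
rewrite (Rintegral_section LF') (ipZl _ LF LF') (ipZr _ LF LF).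
rewrite [leLHS]mulrC; apply: ler_wpM2r; first by rewrite invr_ge0 ltW.
by rewrite ler_pdivrMl//.
Qed.

(** One event serves all lags: Markov's inequality is applied to the sum of all the squared norms. A
    null set is added to it, off which every path is square integrable. *)
Lemma sample_tail p : exists2 C, 0 <= C &
  (forall k, (0 < k <= p)%N -> L2K mu mu (Mk P X k)) /\
  forall n (delta : R), (p < n)%N -> 0 < delta -> exists A, [/\ measurable A,
    fine (P A) <= C / (n - p)%:R / delta &
    forall w, ~ A w -> (forall j : nat, L2 mu (W j%:Z w)) /\
      forall k, (0 < k <= p)%N ->
        [/\ ipm mu2 (lag_error P Y X k (n - p) w) (lag_error P Y X k (n - p) w) <= delta,
            ipm mu (mean_error P Y 0 (n - p) w) (mean_error P Y 0 (n - p) w) <= delta,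
            ipm mu (mean_error P Y k (n - p) w) (mean_error P Y k (n - p) w) <= delta &
            ipm mu (mean_error P Y 0 n w) (mean_error P Y 0 n w) <= delta]].
Proof.
have [C C0 [H1 H2]] := second_moments M C4X C1Y C2Y p.
have mY := model_measurable M.
exists ((p.+1.*2)%:R * C); first by rewrite mulr_ge0.
split; first by move=> k kp; have [] := H1 k 0%N kp.
move=> n delta pn delta0; set m := (n - p)%N.
have m0 : (0 < m)%N by rewrite subn_gt0.
have n0 : (0 < n)%N by apply: leq_ltn_trans pn.
pose al k w := ipm mu2 (lag_error P Y X k m w) (lag_error P Y X k m w).
pose be k w := ipm mu (mean_error P Y k m w) (mean_error P Y k m w).
pose ga w := ipm mu (mean_error P Y 0 n w) (mean_error P Y 0 n w).
have LS c k : L2K P mu (fun w u => \sum_(1 <= j < k.+1) W (j + c)%:Z w u).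
  by apply: L2_sum => j; exact: L2K_centred.
have Ial k : (0 < k <= p)%N -> P.-integrable setT (EFin \o al k) /\ \int[P]_w al k w <= C / m%:R.
  move=> kp; have [LM Lxi le] := H1 k m kp.
  have LF : L2K P mu2 (fun w q => \sum_(1 <= j < m.+1)
      (centred2 P Y j%:Z (j + k)%:Z w q - Mk P X k q.1 q.2)) by exact: L2_sum.
  exact: (mean_second_moment m0 LF le).
have Ibe k : P.-integrable setT (EFin \o be k) /\ \int[P]_w be k w <= C / m%:R.
  exact: (mean_second_moment m0 (LS k m) (H2 k m)).
have Iga : P.-integrable setT (EFin \o ga) /\ \int[P]_w ga w <= C / m%:R.
  have [i le] := mean_second_moment n0 (LS 0%N n) (H2 0%N n).
  split; [exact: i|apply: le_trans le _].
  by rewrite ler_wpM2l// lef_pV2 ?posrE ?ltr0n// ler_nat leq_subr.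
(* There are 2(p+1) nonnegative summands of mean at most C/m; bounding their sum by delta bounds
   each of them. *)
pose tau w := (\sum_(1 <= k < p.+1) (al k w + be k w)) + (be 0%N w + ga w).
have dbl j : (j.+1.*2)%:R * C / m%:R = (j.*2)%:R * C / m%:R + (C / m%:R + C / m%:R) :> R.
  rewrite doubleS -addn2 natrD; move: (j.*2%:R) (m%:R^-1) => x y; ring.
have tauI : P.-integrable setT (EFin \o tau) /\ \int[P]_w tau w <= (p.+1.*2)%:R * C / m%:R.
  have I2 : P.-integrable setT (EFin \o (fun w => be 0%N w + ga w)).
    by apply: integrable_addR; [have [] := Ibe 0%N|have [] := Iga].
  have Ik k : (0 < k <= p)%N -> P.-integrable setT (EFin \o (fun w => al k w + be k w)).
    by move=> kp; apply: integrable_addR; [have [] := Ial k kp|have [] := Ibe k].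
  have S j : (j <= p)%N -> P.-integrable setT (EFin \o (fun w => \sum_(1 <= k < j.+1) (al k w + be k w))) /\
      \int[P]_w (\sum_(1 <= k < j.+1) (al k w + be k w)) <= (j.*2)%:R * C / m%:R.
    elim: j => [_|j IH jp].
      under eq_fun do rewrite big_geq//.
      split; first exact: integrable0.
      by rewrite Rintegral_cst// !mul0r.
    have [I le] := IH (ltnW jp).
    under eq_fun do rewrite big_nat_recr//=.
    split; first by apply: integrable_addR => //; exact: Ik.
    have [Ia la] := Ial j.+1 jp; have [Ib lb] := Ibe j.+1.
    rewrite RintegralD//; last exact: Ik.
    by rewrite RintegralD// dbl; apply: lerD => //; exact: lerD.
  have [I le] := S p (leqnn p).
  split; first exact: integrable_addR.
  have [Ib lb] := Ibe 0%N; have [Ig lg] := Iga.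
  by rewrite RintegralD// RintegralD// dbl; apply: lerD => //; exact: lerD.
have [tauint taule] := tauI.
have mtau : measurable_fun setT tau by apply/measurable_EFinP; case/integrableP: tauint.
have tau_ge0 w : 0 <= tau w.
  by rewrite addr_ge0 ?addr_ge0 ?ip_ge0// sumr_ge0// => k _; rewrite addr_ge0 ?ip_ge0.
have aeL : {ae P, forall w, forall j : nat, L2 mu (W j%:Z w)}.
  by apply: ae_foralln => j; exact: ae_L2_centred.
have [N [mN N0 NL]] := aeL.
pose B := [set w | (delta%:E <= `|(tau w)%:E|)%E].
have mB : measurable B.
  rewrite -[B]setTI; apply: emeasurable_fun_c_infty => //.
  by apply: measurableT_comp => //; exact/measurable_EFinP.
exists (N `|` B); split; first exact: measurableU.
  have mark : (delta%:E * P B <= (\int[P]_w tau w)%:E)%E.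
    have H := @le_integral_abse _ _ _ P setT measurableT (EFin \o tau) delta
      ((measurable_EFinP setT tau).2 mtau) delta0.
    rewrite setTI in H; apply: (le_trans H).
    rewrite le_eqVlt; apply/orP; left; apply/eqP.
    rewrite /Rintegral fineK; last exact: integrable_fin_num.
    by apply: eq_integral => w _ /=; rewrite ger0_norm.
  have PN : P (N `|` B) = P B.
    by rewrite setUC measureU0.
  rewrite PN ler_pdivlMr// mulrC; apply: le_trans taule.
  by rewrite -lee_fin EFinM fineK// fin_num_measure.
move=> w nA; split.
  by apply: contrapT => h; apply: nA; left; exact: NL.
have tw : tau w < delta.
  rewrite ltNge; apply/negP => h; apply: nA; right.
  by rewrite /B /= lee_fin ger0_norm.
move=> k kp.
have : al k w + be k w <= \sum_(1 <= k < p.+1) (al k w + be k w).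
  rewrite (big_rem k) /=; last by rewrite mem_index_iota.
  by rewrite lerDl sumr_ge0// => i _; rewrite addr_ge0 ?ip_ge0.
have := ip_ge0 mu2 (lag_error P Y X k m w); have := ip_ge0 mu (mean_error P Y k m w).
have := ip_ge0 mu (mean_error P Y 0 m w); have := ip_ge0 mu (mean_error P Y 0 n w).
rewrite -/(al k w) -/(be k w) -/(be 0%N w) -/(ga w); move: tw; rewrite /tau.
have aux (S x y z t e : R) : S + (z + t) < e -> 0 <= t -> 0 <= z -> 0 <= y -> 0 <= x ->
    x + y <= S -> [/\ x <= e, z <= e, y <= e & t <= e].
  by move=> *; split; lra.
exact: aux.
Qed.

End Tail.

Unset Implicit Arguments.

(** The event that the count differs from d is not claimed to be measurable; it is enclosed in
    measurable sets [A n] whose probabilities tend to 0. *)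
Theorem theorem3 (R : realType) (a b : R) (dO : measure_display)
  (Omega : measurableType dO) (P : probability Omega R)
  (Y X eps : int -> Omega -> R -> R) (d p : nat) (epsn : nat -> R) :
  a < b ->
  (0 < d)%N -> (0 < p)%N ->
  model a b P Y X eps ->
  (* X_t is d-dimensional: lambda_d <> 0 = lambda_{d+1} for M_0 *)
  eig_count a b (fun l => l != 0) (Mk P X 0) d ->
  C1 a b P Y -> C2 a b P Y -> C3_eig a b (Kker a b P X p) d -> C4 P X eps ->
  (forall n, 0 < epsn n) ->
  epsn @ \oo --> 0 ->
  (fun n => epsn n ^+ 2 * n%:R) @ \oo --> +oo ->
  exists A : nat -> set Omega,
    (forall n, measurable (A n)) /\
    (forall n, [set w | ~ eig_count a b (fun th => epsn n <= th)
                             (Khat a b Y p n w) d] `<=` A n) /\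
    (fun n => fine (P (A n))) @ \oo --> 0.
Proof.
move=> ab d0 p0 M _ C1Y C2Y C3K C4X eps0 epsto0 epsnoo.
have [C C_ge0 [LMk tail]] := sample_tail M C4X C1Y C2Y p.
(* Square integrability is known for lags 1 to p only; the other indices, absent from the sum K, are
   filled with 0. *)
pose M' k := if (0 < k <= p)%N then Mk P X k else fun _ _ => 0.
have LM' k : L2K (muI a b) (muI a b) (M' k).
  by rewrite /M'; case: ifPn => [/LMk//|_]; exact: L20.
have C3' : C3_eig a b (fun u v => \sum_(1 <= k < p.+1)
    \int[@leb R]_(z in Iab a b) (M' k u z * M' k v z)) d.
  rewrite (_ : (fun _ _ => _) = Kker a b P X p)//.
  apply/funext => u; apply/funext => v; apply: eq_big_nat => k kp.
  by rewrite /M' -ltnS kp.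
have [c c0 consist] := eig_count_consistent LM' C3'.
pose c1 : R := Num.min (c / 4) 1.
have c1_gt0 : 0 < c1 by rewrite lt_min ltr01 andbT divr_gt0.
have p1 : 1 <= p%:R :> R by rewrite ler1n.
(* Holds for all large n: 2p < n gives n - p >= n/2, and epsilon <= min(c/4, 1) serves the
   eigenvalue count and delta <= 1. For the remaining n the whole space is taken as [A n]. *)
pose good n := (p.*2 < n)%N && (epsn n <= c1).
pose delta n := epsn n / (64 * p%:R).
have delta0 n : 0 < delta n by rewrite divr_gt0// mulr_gt0// ltr0n.
have choice n : exists A, measurable A /\ (good n -> fine (P A) <= C / (n - p)%:R / delta n) /\
    [set w | ~ eig_count a b (fun th => epsn n <= th) (Khat a b Y p n w) d] `<=` A.
  have [/andP[pn ec]|ng] := boolP (good n); last first.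
    exists setT; split; [exact: measurableT|split; last exact: subsetT].
    by [].

  have pn' : (p < n)%N by apply: leq_trans pn; rewrite ltnS -addnn leq_addr.
  have [A [mA PA HA]] := tail n (delta n) pn' (delta0 n).
  exists A; split; [exact: mA|split; [by move=> _; exact: PA|]] => w nec; apply: contrapT => /HA[LW H]; apply: nec.
  have e1 : epsn n <= 1 by apply: le_trans ec _; rewrite ge_min lexx orbT.
  have e4 : epsn n <= c / 4 by apply: le_trans ec _; rewrite ge_min lexx.
  (* This is the origin of 64: p kernels with squared error 16 delta each add up to epsilon/4, and
     then 2 (epsilon/4) < epsilon and epsilon <= c/2 - epsilon/4 because epsilon <= c/4. *)
  have pd : p%:R * (16 * delta n) = epsn n / 4.
    have p0' : p%:R != 0 :> R by rewrite gt_eqF// (lt_le_trans ltr01).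
    by rewrite /delta; move: (p%:R) (epsn n) p0' => x y x0; field.
  apply: (consist (fun k => Mhat Y p n k w) (epsn n) (16 * delta n)).
  - by move=> k; apply: (Mhat_sec (P := P)) => //; exact: leq_ltn_trans pn'.
  - exact: eps0.
  - move=> k /andP[k1 kp]; have kp' : (0 < k <= p)%N by rewrite k1 kp.
    have [h1 h2 h3 h4] := H k kp'.
    rewrite /M' kp'; apply: (Mhat_error_le pn' LW (LMk k kp')) => //.
    apply/andP; split; first exact: ltW.
    apply: le_trans e1; rewrite ler_pdivrMr ?mulr_gt0 ?ltr0n//.
    by rewrite ler_peMr ?ltW//; move: (p%:R) p1 => x x1; lra.
  - by rewrite pd; have := eps0 n; move: (epsn n) => x x0; lra.
  - by rewrite pd; have := eps0 n; move: (epsn n) e4 => x x0; lra.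
have {choice}[A HA] := boolp.choice choice.
exists A; split; first by move=> n; have [] := HA n.
split; first by move=> n; have [_ []] := HA n.
pose s n := epsn n ^+ 2 * n%:R.
have s_gt0 : \forall n \near \oo, 0 < s n.
  by exists 1%N => // n /= n0; rewrite mulr_gt0 ?exprn_gt0 ?eps0 ?ltr0n.
(* The Markov bound C / ((n - p) delta) is 64 p C / ((n - p) epsilon); n - p >= n/2 doubles the
   constant, and epsilon <= 1 replaces epsilon n by epsilon^2 n. *)
have s_cvg : (fun n => C * (128 * p%:R) * (s n)^-1) @ \oo --> 0.
  have s0 : (s n)^-1 @[n --> \oo] --> 0.
    by apply/(gtr0_cvgV0 s_gt0); exact: epsnoo.
  by rewrite -(mulr0 (C * (128 * p%:R))); apply: cvgM; [exact: cvg_cst|exact: s0].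
apply: (squeeze_cvgr _ (cvg_cst 0) s_cvg).
have neps : \forall n \near \oo, epsn n <= c1.
  by move/cvgr0Pnorm_le : epsto0 => /(_ _ c1_gt0); apply: filterS => n; exact: le_trans (ler_norm _).
near=> n.
have pn : (p.*2 < n)%N by near: n; exact: nbhs_infty_gt.
have en : epsn n <= c1 by near: n.
have [mA [PA _]] := HA n.
rewrite fine_ge0//=; apply: le_trans (PA _) _; first by rewrite /good pn en.
have e1 : epsn n <= 1 by apply: le_trans en _; rewrite ge_min lexx orbT.
rewrite /delta /s.
have n2 : n%:R <= 2 * (n - p)%:R :> R.
  rewrite -natrM ler_nat mulnBr leq_subRL ?leq_pmul2l//; last first.
    by apply: ltnW; apply: leq_trans pn; rewrite ltnS -addnn leq_addr.
  by rewrite !mul2n -[n.*2]addnn leq_add2r ltnW.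
have n0 : 0 < n%:R :> R by rewrite ltr0n (leq_ltn_trans _ pn).
have ppos : 0 < p%:R :> R by rewrite ltr0n.
have := eps0 n; move: (epsn n) (n%:R) ((n - p)%:R) (p%:R) e1 n0 n2 ppos => e x y z e1 x0 xy z0 e0.
have y0 : 0 < y by lra.
have -> : C / y / (e / (64 * z)) = C * (64 * z) / (e * y).
  by field; rewrite !gt_eqF.
have -> : C * (128 * z) / (e ^+ 2 * x) = C * (64 * z) / (e ^+ 2 * x / 2).
  by field; rewrite !gt_eqF.
apply: ler_wpM2l; first by rewrite mulr_ge0// mulr_ge0// ltW.
rewrite lef_pV2 ?posrE ?mulr_gt0 ?divr_gt0 ?exprn_gt0//.
rewrite expr2 -!mulrA ler_pM2l//.
have ex : e * x <= x by rewrite ler_piMl// ltW.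
by move: ex; rewrite mulrA; move: (e * x) => t; lra.
Unshelve. all: by end_near.
Qed.
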